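(* Let $\Phi$ be the map from the vertex set of the Apollonian kingdom to oriented circles in $\mathbb{C}_\infty$ defined by: if a vertex carries the lax lattice with ordered basis $(a,b)$, then $\Phi$ sends it to the oriented circle $M(\mathbb{R})$, where $M=\begin{pmatrix} a & b\end{pmatrix}$ is the matrix with columns $a,b$. Then $\Phi$ is a bijection from the vertices of the Apollonian kingdom onto the set of oriented Gaussian circles. Moreover, the connected components of the Apollonian kingdom are exactly the edge-labelled Apollonian palaces of all Apollonian circle packings consisting of Gaussian circles: for each connected component $K$, the set $\Phi(\text{vertices of }K)$ is the set of circles of an Apollonian circle packing $P$ of Gaussian circles, two vertices of $K$ are joined by an edge if and only if their circles are tangent, and the lax-vector label of that edge is the lax vector corresponding to the point of tangency; and every Apollonian circle packing consisting of Gaussian circles arises in this way from exactly one component.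
   Context: Units of $\mathbb{Z}[i]$ are $\{\pm1,\pm i\}$. A lax vector is a primitive vector of $\mathbb{Z}[i]^2$ (coprime entries) considered up to multiplication by units; lax vectors correspond to points of $\mathbb{P}^1(\mathbb{Q}(i))$, i.e.\ to points of $\mathbb{Q}(i)\cup\{\infty\}\subset\mathbb{C}_\infty$ via $(z_1,z_2)\mapsto z_1/z_2$. A basis is a pair of lax vectors whose representatives form a $\mathbb{Z}[i]$-basis of $\mathbb{Z}[i]^2$; a superbasis is a triple of lax vectors any two of which form a basis. An ultrabasis is a set of six lax vectors $u,v,w,x,y,z$ such that $\{u,v,w\},\{u,y,z\},\{v,x,z\},\{w,x,y\}$ are superbases; it is regarded as a chamber: a tetrahedron (complete graph on 4 vertices) whose six edges are labelled by the six lax vectors so that its four triangular faces (walls) carry these four superbases; ultrabases giving isomorphic labelled graphs are the same. Every superbasis has representatives $u,v,w$ with $u+v+w=0$, and the chambers containing it as a wall are exactly the left standard chamber (edges $u,v,w,u+iv,v+iw,w+iu$; walls $\{u,v,w\},\{u,u+iv,w+iu\},\{v,v+iw,u+iv\},\{w,w+iu,v+iw\}$) and the right standard chamber (edges $u,v,w,u-iv,v-iw,w-iu$; walls $\{u,v,w\},\{u,u-iv,w-iu\},\{v,v-iw,u-iv\},\{w,w-iu,v-iw\}$); every chamber can be written in left standard form. The Apollonian kingdom is the edge-labelled graph obtained from all chambers by gluing them along common walls (matching labels). Lax lattices: for an ordered $\mathbb{Z}[i]$-basis $(a,b)$ of $\mathbb{Z}[i]^2$, let $L=\mathbb{Z}a+\mathbb{Z}b$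 (a rank-2 $\mathbb{Z}$-submodule of $\mathbb{Z}[i]^2$), oriented by $(a,b)$ (ordered $\mathbb{Z}$-bases related by a determinant $1$ change of basis give the same orientation, determinant $-1$ the opposite one); the pair $\{L,iL\}$ ($iL$ oriented by $(ia,ib)$) is the lax lattice with ordered basis $(a,b)$. Vertex labels: for a chamber in left standard form with $u+v+w=0$, the vertex incident to edges $u,v,u+iv$ gets the lax lattice with ordered basis $(u,iv)$; the vertex at $v,w,v+iw$ gets $(v,iw)$; at $w,u,w+iu$ gets $(w,iu)$; at $u+iv,v+iw,w+iu$ gets $(w-iv,iu-v)$. For the right standard chamber, the three vertices of the wall $\{u,v,w\}$ get the same labels, and the vertex at $u-iv,v-iw,w-iu$ gets $(w+iv,iu+v)$. (These labels are independent of the choices made.) Circles: circles in $\mathbb{C}_\infty$ include straight lines. An oriented circle has a direction of travel; its interior is the region on the right; $\mathbb{R}$ is oriented toward $+\infty$. $\mathrm{PGL}_2(\mathbb{Z}[i])$ (matrices over $\mathbb{Z}[i]$ with unit determinant, modulo unit scalars) acts on $\mathbb{C}_\infty$ by M\''obius transformations $z\mapsto (az+b)/(cz+d)$ and on oriented circles (orientation determined by the image order of three points). A Gaussian circle is an oriented circle $M(\mathbb{R})$ with $M\in\mathrm{PGL}_2(\mathbb{Z}[i])$. A Descartes quadruple is a set of four oriented circles, pairwise tangent, with pairwise disjoint interiors. The Apollonian circle packing generated by a Descartes quadruple is obtained by repeatedly adding, for every triple of mutually tangent circles of disjoint interiors in the current collection, both circles completing it to a Descartes quadruple, and taking the union of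 all stages. Points of tangency of two tangent Gaussian circles lie in $\mathbb{Q}(i)\cup\{\infty\}$. The Apollonian palace of a packing is the graph with a vertex for each circle and an edge for each tangent pair; its edge-labelling labels each edge by the lax vector of the point of tangency. *)

(* Defs.v *)
From mathcomp Require Import all_boot all_order all_algebra all_fingroup.
From mathcomp Require Import all_classical reals.
From Stdlib Require Relation_Operators.

Set Implicit Arguments.
Unset Strict Implicit.
Unset Printing Implicit Defensive.

Import Order.TTheory GRing.Theory Num.Theory.
From mathcomp Require Import complex.

Local Open Scope classical_set_scope.
Local Open Scope ring_scope.

(* Z[i] is taken as a subset of the complex field R[i], so that vectors and
   matrices over Z[i] are complex ones with entries in [gaussInt]. *)
Definition gaussInt {R : realType} :=
  [qualify a z : R[i] | (Re z \is a Num.int) && (Im z \is a Num.int)].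

Definition gauss_unit {R : realType} : set R[i] := [set 1; -1; 'i%C; - 'i%C].

Definition gauss_dvd {R : realType} (d x : R[i]) : Prop :=
  exists2 q : R[i], q \is a gaussInt & x = q * d.

Definition primitive {R : realType} (v : 'cV[R[i]]_2) : Prop :=
  v \is a mxOver gaussInt /\
  forall d : R[i], d \is a gaussInt ->
    (forall k, gauss_dvd d (v k 0)) -> gauss_unit d.

Definition unit_multiples {R : realType} (v : 'cV[R[i]]_2) :
    set 'cV[R[i]]_2 :=
  [set w | exists2 e, gauss_unit e & w = e *: v].

(* A lax vector is the class of its four representatives. *)
Record laxvec (R : realType) := LaxVec {
  representatives : set 'cV[R[i]]_2;
  laxvecP :
    exists2 v, primitive v & representatives = unit_multiples v
}.

Definition gauss_basis {R : realType} (a b : 'cV[R[i]]_2) : Prop :=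
  [/\ a \is a mxOver gaussInt, b \is a mxOver gaussInt &
      forall x : 'cV[R[i]]_2, x \is a mxOver gaussInt ->
        exists! mn : R[i] * R[i],
          [/\ mn.1 \is a gaussInt, mn.2 \is a gaussInt &
              x = mn.1 *: a + mn.2 *: b]].

Definition lax_basis {R : realType} (l m : laxvec R) : Prop :=
  exists a b : 'cV[R[i]]_2,
    [/\ representatives l a, representatives m b & gauss_basis a b].

Definition superbasis {R : realType} (l m n : laxvec R) : Prop :=
  [/\ lax_basis l m, lax_basis m n & lax_basis l n].

Definition zlattice {R : realType} (a b : 'cV[R[i]]_2) : set 'cV[R[i]]_2 :=
  [set x | exists m n : int, x = m%:~R *: a + n%:~R *: b].

(* An orientation is given by the set of its positive ordered Z-bases. *)
Definition orientation {R : realType} (a b : 'cV[R[i]]_2) :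
    set ('cV[R[i]]_2 * 'cV[R[i]]_2) :=
  [set ab | exists p q r s : int,
     [/\ p * s - q * r = 1,
         ab.1 = p%:~R *: a + q%:~R *: b &
         ab.2 = r%:~R *: a + s%:~R *: b]].

Definition oriented_lattice (R : realType) : Type :=
  set 'cV[R[i]]_2 * set ('cV[R[i]]_2 * 'cV[R[i]]_2).

Definition olattice {R : realType} (a b : 'cV[R[i]]_2) : oriented_lattice R :=
  (zlattice a b, orientation a b).

Definition lax_lattice {R : realType} (a b : 'cV[R[i]]_2) :
    set (oriented_lattice R) :=
  [set olattice a b; olattice ('i%C *: a) ('i%C *: b)].

(* A tetrahedron with vertices 'I_4; an edge is a set of two vertices. The
   six edge labels are distinct (an ultrabasis is a set of six lax vectors):
   otherwise the edges oo,0,1,oo,1+i,i would satisfy the four superbasis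
   conditions. The values of [lab] on sets that are not edges are never used;
   isomorphic labelled tetrahedra are identified by [glue] below. *)
Record chamber (R : realType) := Chamber {
  lab : {set 'I_4} -> laxvec R;
  lab_inj : forall e f : {set 'I_4},
    #|e| = 2%N -> #|f| = 2%N -> lab e = lab f -> e = f;
  lab_wall : forall i j k : 'I_4, uniq [:: i; j; k] ->
    superbasis (lab [set i; j]%SET) (lab [set j; k]%SET) (lab [set i; k]%SET)
}.

(* A cell of a chamber: one of its vertices, or one of its edges, given by the
   set of its vertices. *)
Definition cell (R : realType) : Type := (chamber R * {set 'I_4})%type.

(* [p] maps the wall of [x.1] opposite to the vertex [k] to a wall of [y.1]
   with the same edge labels, and the cell [x.2] of the former to the cell
   [y.2] of the latter. Since each vertex and each edge of a tetrahedron lies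
   in some wall, this also identifies isomorphic labelled tetrahedra. *)
Definition glue {R : realType} (x y : cell R) : Prop :=
  exists (p : {perm 'I_4}) (k : 'I_4),
    [/\ forall e : {set 'I_4}, #|e| = 2%N -> k \notin e ->
          lab x.1 e = lab y.1 (p @: e),
        k \notin x.2 & y.2 = p @: x.2].

Definition glued {R : realType} : cell R -> cell R -> Prop :=
  Relation_Operators.clos_refl_sym_trans (cell R) glue.

Record kcell (R : realType) (n : nat) := KCell {
  cells : set (cell R);
  kcellP : exists2 x : cell R, #|x.2| = n & cells = [set y | glued x y]
}.

Definition kvertex (R : realType) : Type := kcell R 1.
Definition kedge (R : realType) : Type := kcell R 2.

Definition joins {R : realType} (e : kedge R) (x y : kvertex R) : Prop :=
  exists (c : chamber R) (i j : 'I_4),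
    [/\ i != j, cells e (c, [set i; j]%SET),
        cells x (c, [set i]%SET) & cells y (c, [set j]%SET)].

Definition kedge_label {R : realType} (e : kedge R) (l : laxvec R) : Prop :=
  exists2 x : cell R, cells e x & lab x.1 x.2 = l.

Definition kconnected {R : realType} : kvertex R -> kvertex R -> Prop :=
  Relation_Operators.clos_refl_sym_trans (kvertex R)
    (fun x y => exists e, joins e x y).

Definition kcomponent {R : realType} (K : set (kvertex R)) : Prop :=
  exists x : kvertex R, K = [set y | kconnected x y].

(* The standard chamber of [u], [v], [w]: the left one for [s = 'i], the right
   one for [s = - 'i]. *)
Definition standard_form {R : realType} (s : R[i]) (c : chamber R)
    (A B C D : 'I_4) (u v w : 'cV[R[i]]_2) : Prop :=
  [/\ uniq [:: A; B; C; D], u + v + w = 0,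
      [/\ representatives (lab c [set C; A]%SET) u,
          representatives (lab c [set A; B]%SET) v &
          representatives (lab c [set B; C]%SET) w] &
      [/\ representatives (lab c [set A; D]%SET) (u + s *: v),
          representatives (lab c [set B; D]%SET) (v + s *: w) &
          representatives (lab c [set C; D]%SET) (w + s *: u)]].

Definition chamber_vertex_label {R : realType} (c : chamber R) (k : 'I_4)
    (L : set (oriented_lattice R)) : Prop :=
  exists (s : R[i]) (A B C D : 'I_4) (u v w : 'cV[R[i]]_2),
    [/\ s = 'i%C \/ s = - 'i%C,
        standard_form s c A B C D u v w &
        [\/ k = A /\ L = lax_lattice u ('i%C *: v),
            k = B /\ L = lax_lattice v ('i%C *: w),
            k = C /\ L = lax_lattice w ('i%C *: u) |
            k = D /\
              (s = 'i%C /\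
                 L = lax_lattice (w - 'i%C *: v) ('i%C *: u - v) \/
               s = - 'i%C /\
                 L = lax_lattice (w + 'i%C *: v) ('i%C *: u + v))]].

Definition vertex_label {R : realType} (x : kvertex R)
    (L : set (oriented_lattice R)) : Prop :=
  exists (c : chamber R) (k : 'I_4),
    cells x (c, [set k]%SET) /\ chamber_vertex_label c k L.

(* [None] is the point at infinity. *)
Definition Cinf (R : realType) : Type := option R[i].

Definition ratio {R : realType} (z1 z2 : R[i]) : Cinf R :=
  if z2 == 0 then None else Some (z1 / z2).

Definition lax_point {R : realType} (l : laxvec R) (p : Cinf R) : Prop :=
  exists2 v, representatives l v & p = ratio (v 0 0) (v 1 0).

Definition mobius {R : realType} (M : 'M[R[i]]_2) (p : Cinf R) : Cinf R :=
  if p is Some z then ratio (M 0 0 * z + M 0 1) (M 1 0 * z + M 1 1)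
  else ratio (M 0 0) (M 1 0).

(* [Round c r ccw] has centre [c] and radius [r], and is travelled
   counterclockwise iff [ccw]. [Straight d s] is travelled in the direction of
   the unit vector [d] and consists of [oo] and of the points
   [t%:C * d + s%:C * 'i * d], t real; hence distinct terms denote distinct
   oriented circles. *)
Inductive ocircle (R : realType) :=
| Round (c : R[i]) (r : R) of 0 < r & bool
| Straight (d : R[i]) of `|d| == 1 & R.

Definition on_circle {R : realType} (K : ocircle R) : set (Cinf R) :=
  match K with
  | Round c r _ _ => [set p | if p is Some z then `|z - c| = r%:C%C else False]
  | Straight d _ s =>
      [set p | if p is Some z then Im (conjc d * z) = s else True]
  end.

(* The region on the right of the direction of travel. *)
Definition inside {R : realType} (K : ocircle R) : set (Cinf R) :=
  match K with
  | Round c r _ true =>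
      [set p | if p is Some z then r%:C%C < `|z - c| else True]
  | Round c r _ false =>
      [set p | if p is Some z then `|z - c| < r%:C%C else False]
  | Straight d _ s =>
      [set p | if p is Some z then Im (conjc d * z) < s else False]
  end.

(* The cyclic order of three points of the projective line [option R],
   travelled toward [+oo]. *)
Definition cyclic3 {R : realType} (t1 t2 t3 : option R) : Prop :=
  match t1, t2, t3 with
  | Some a, Some b, Some c => [|| a < b < c, b < c < a | c < a < b]
  | None, Some a, Some b | Some b, None, Some a | Some a, Some b, None => a < b
  | _, _, _ => False
  end.

(* Three distinct points of [K] are met in this cyclic order. *)
Definition travel {R : realType} (K : ocircle R) (p1 p2 p3 : Cinf R) : Prop :=
  [/\ on_circle K p1, on_circle K p2, on_circle K p3 &
  match K with
  | Round _ _ _ ccw =>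
      if (p1, p2, p3) is (Some z1, Some z2, Some z3) then
        let area := Im (conjc (z2 - z1) * (z3 - z1)) in
        if ccw then 0 < area else area < 0
      else False
  | Straight d _ _ =>
      let t := omap (fun z => Re (conjc d * z)) in cyclic3 (t p1) (t p2) (t p3)
  end].

Definition mobius_image {R : realType} (M : 'M[R[i]]_2) (K K' : ocircle R) :
    Prop :=
  on_circle K' = mobius M @` on_circle K /\
  forall p1 p2 p3, travel K p1 p2 p3 ->
    travel K' (mobius M p1) (mobius M p2) (mobius M p3).

Lemma norm1_unit (R : realType) : `|1 : R[i]| == 1.
Proof. by rewrite normr1. Qed.

Definition real_line {R : realType} : ocircle R := Straight (norm1_unit R) 0.

Definition gaussian_circle {R : realType} : set (ocircle R) :=
  [set K | exists M : 'M[R[i]]_2,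
     [/\ M \is a mxOver gaussInt, gauss_unit (\det M) &
         mobius_image M real_line K]].

(* Two circles of the sphere are tangent when they have exactly one common
   point, e.g., oo for two parallel lines. *)
Definition tangent_at {R : realType} (K K' : ocircle R) (p : Cinf R) : Prop :=
  on_circle K `&` on_circle K' = [set p].

Definition tangent {R : realType} (K K' : ocircle R) : Prop :=
  exists p, tangent_at K K' p.

Definition descartes {R : realType} (Q : set (ocircle R)) : Prop :=
  exists2 K : 'I_4 -> ocircle R, Q = range K &
    forall i j, i != j ->
      tangent (K i) (K j) /\ inside (K i) `&` inside (K j) = set0.

(* A triple that extends to a Descartes quadruple is one of mutually tangent
   circles with disjoint interiors. *)
Definition apollonian_step {R : realType} (S : set (ocircle R)) :
    set (ocircle R) :=
  S `|` [set K | exists A B C : ocircle R,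
           [/\ S A, S B, S C & descartes [set A; B; C; K]]].

Definition apollonian_packing {R : realType} (P : set (ocircle R)) : Prop :=
  exists2 Q : set (ocircle R), descartes Q &
    P = \bigcup_n iter n apollonian_step Q.

Definition is_Phi {R : realType} (Phi : kvertex R -> ocircle R) : Prop :=
  forall (x : kvertex R) (K : ocircle R),
    Phi x = K <->
    exists a b : 'cV[R[i]]_2,
      [/\ gauss_basis a b, vertex_label x (lax_lattice a b) &
          mobius_image (row_mx a b) real_line K].

(* Through [Phi], the full subgraph of the kingdom on [K] is the edge-labelled
   palace of the packing [P]. *)
Definition is_palace {R : realType} (Phi : kvertex R -> ocircle R)
    (K : set (kvertex R)) (P : set (ocircle R)) : Prop :=
  Phi @` K = P /\
  forall x y : kvertex R, K x -> K y ->
    [/\ (exists e, joins e x y) <-> tangent (Phi x) (Phi y),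
        forall e e', joins e x y -> joins e' x y -> e = e' &
        forall e l, joins e x y -> kedge_label e l ->
          exists2 p, tangent_at (Phi x) (Phi y) p & lax_point l p].

(* Main.v *)
(** An oriented circle of the Riemann sphere is the zero set of a real binary
    Hermitian form [h] of determinant [-1/4], its interior being [h < 0]. With
    respect to the polar form [bil] of [-4 det], such forms have norm 1, and two
    circles are tangent with disjoint interiors iff [h + h'] is the square
    [|det (v, .)|^2] of a vector [v] over the tangency point; then [bil h h' = -1].
    The circle of a lax lattice [(a, b)] is the real line written in the basis
    [a], [b].

    A chamber with edge labels [v_ij] carries four forms [h_i] with
    [h_i + h_j = |det (v_ij, .)|^2]; they are exactly the circles that [Phi]
    assigns to its vertices, and they form a Descartes quadruple. Crossing a wall
    replaces one form [h_k] by [2 (sum of the three others) - h_k].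

    The chambers around a vertex with lattice [L] correspond to the superbases
    of [L] over Z, so Euclid's algorithm in [L] connects them: a vertex is
    determined by its form. In the tree of Descartes quadruples, [- bil h_j h]
    for a fixed circle [h] of the initial quadruple grows along reduced words,
    so any two circles of a component satisfy [bil <= -1], with equality only if
    they lie in a common chamber; the same holds for triples of tangent circles.
    Hence a component is closed under completing triples. Finally the sum of
    two tangent Gaussian forms is an integral multiple [t |det (v, .)|^2], and
    for a Gaussian Descartes quadruple the Gram matrix forces [t = 1], whence a
    chamber. *)
From mathcomp Require Import all_boot all_order all_algebra all_fingroup.
From mathcomp Require Import all_classical reals.
From mathcomp Require Import ring lra zify.
Import Order.TTheory GRing.Theory Num.Theory.
From mathcomp Require Import complex.
Require Import Defs.

Set Implicit Arguments.
Unset Strict Implicit.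
Unset Printing Implicit Defensive.

Local Open Scope classical_set_scope.
Local Open Scope ring_scope.

(** * Real and imaginary parts of complex numbers *)

Section ComplexCoordinates.
Context {R : realType}.
Implicit Types (x y : R[i]) (k : R).

(** The vertices and edges of the kingdom are classes for the closure of wall gluings. Invariants of
    such classes are easy to find, but equality of two classes requires an explicit chain of walls.
    The form [cf c k] of a vertex is computed from the labels of any one wall at [k], hence gluing
    preserves it; the hard converse, that equal forms force a chain, reduces every later comparison
    of vertices to an equation in a real space of dimension four.

    Tangency in a palace means a single common point and says nothing about interiors, so circles
    touching from the inside ([bil = 1]) have to be ruled out. A common point only gives
    [bil >= -1], because [bil] is then the cosine of an angle. The growth along reduced words
    supplies the opposite inequality, and the case of equality puts both circles in one chamber.

    As a set of points a circle determines its form only up to sign. The sign carries the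
    orientation; it is read off from a Hermitian triple product, whose sign does not depend on the
    homogeneous coordinates chosen for three points. *)

Lemma cext x y : Re x = Re y -> Im x = Im y -> x = y.
Proof. by case: x y => [a b] [c d] /= -> ->. Qed.

Lemma Re_add x y : Re (x + y) = Re x + Re y. Proof. by case: x y => ? ? [? ?]. Qed.
Lemma Im_add x y : Im (x + y) = Im x + Im y. Proof. by case: x y => ? ? [? ?]. Qed.
Lemma Re_opp x : Re (- x) = - Re x. Proof. by case: x. Qed.
Lemma Im_opp x : Im (- x) = - Im x. Proof. by case: x. Qed.
Lemma Re_mul x y : Re (x * y) = Re x * Re y - Im x * Im y.
Proof. by case: x y => ? ? [? ?]. Qed.
Lemma Im_mul x y : Im (x * y) = Re x * Im y + Im x * Re y.
Proof. by case: x y => ? ? [? ?]. Qed.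
Lemma Re_conj x : Re (conjc x) = Re x. Proof. by case: x. Qed.
Lemma Im_conj x : Im (conjc x) = - Im x. Proof. by case: x. Qed.
Lemma Re_int (n : int) : Re (n%:~R : R[i]) = n%:~R.
Proof. by rewrite -(rmorph_int (real_complex R)). Qed.
Lemma Im_int (n : int) : Im (n%:~R : R[i]) = 0.
Proof. by rewrite -(rmorph_int (real_complex R)). Qed.

Lemma Re_complex a b : Re (Complex a b) = a :> R. Proof. by []. Qed.
Lemma Im_complex a b : Im (Complex a b) = b :> R. Proof. by []. Qed.
Lemma Re_real k : Re k%:C%C = k. Proof. by []. Qed.
Lemma Im_real k : Im k%:C%C = 0. Proof. by []. Qed.

Lemma Re_one : Re 1 = 1 :> R. Proof. by []. Qed.
Lemma Im_one : Im 1 = 0 :> R. Proof. by []. Qed.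
Lemma Re_zero : Re 0 = 0 :> R. Proof. by []. Qed.
Lemma Im_zero : Im 0 = 0 :> R. Proof. by []. Qed.

Definition cE := (Re_one, Im_one, Re_zero, Im_zero, Re_add, Im_add, Re_opp,
  Im_opp, Re_mul, Im_mul, Re_conj, Im_conj, Re_int, Im_int, Re_complex, Im_complex, Re_real, Im_real).

Lemma conjcM x y : conjc (x * y) = conjc x * conjc y.
Proof. by apply: cext; rewrite !cE; ring. Qed.
Lemma conjcD x y : conjc (x + y) = conjc x + conjc y.
Proof. by apply: cext; rewrite !cE; ring. Qed.
Lemma conjcN x : conjc (- x) = - conjc x.
Proof. by apply: cext; rewrite !cE; ring. Qed.
Definition conjE := (conjcM, conjcD, conjcN).

Definition sqn x : R := Re x ^+ 2 + Im x ^+ 2.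

Lemma sqn_ge0 x : 0 <= sqn x. Proof. by rewrite addr_ge0 ?sqr_ge0. Qed.

Lemma sqn_eq0 x : sqn x = 0 -> x = 0.
Proof.
move=> /eqP; rewrite paddr_eq0 ?sqr_ge0// !sqrf_eq0 => /andP[/eqP ? /eqP ?].
exact: cext.
Qed.

Lemma sqn_gt0 x : x != 0 -> 0 < sqn x.
Proof.
move=> x0; rewrite lt_neqAle sqn_ge0 andbT eq_sym.
by apply: contra_neqN x0 => /eqP/sqn_eq0.
Qed.

Lemma sqnM x y : sqn (x * y) = sqn x * sqn y.
Proof. by rewrite /sqn !cE; ring. Qed.

Lemma sqnN x : sqn (- x) = sqn x. Proof. by rewrite /sqn !cE; ring. Qed.

Lemma sqn_conj x : sqn (conjc x) = sqn x. Proof. by rewrite /sqn !cE; ring. Qed.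

Lemma mul_conj x : x * conjc x = (sqn x)%:C%C.
Proof. by apply: cext; rewrite !cE /= /sqn; ring. Qed.

Lemma sqn_norm x : `|x| = (Num.sqrt (sqn x))%:C%C.
Proof. by case: x. Qed.

End ComplexCoordinates.

(** * Binary Hermitian forms *)

Record hform (R : realType) := Form { fa : R; fd : R; fx : R; fy : R }.

Section Forms.
Context {R : realType}.
Implicit Types (h g : hform R) (p q z w : R[i]) (c : R).

Lemma form_ext h g : fa h = fa g -> fd h = fd g -> fx h = fx g -> fy h = fy g ->
  h = g.
Proof. by case: h g => ? ? ? ? [? ? ? ?] /= -> -> -> ->. Qed.

Definition fadd h g := Form (fa h + fa g) (fd h + fd g) (fx h + fx g) (fy h + fy g).
Definition fscale c h := Form (c * fa h) (c * fd h) (c * fx h) (c * fy h).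
Definition bil h g : R :=
  fx h * fx g + fy h * fy g - 2 * (fa h * fd g + fd h * fa g).

Lemma bilC h g : bil h g = bil g h. Proof. by rewrite /bil; ring. Qed.
Lemma bilDl h g k : bil (fadd h g) k = bil h k + bil g k.
Proof. by rewrite /bil /=; ring. Qed.
Lemma bilZl c h k : bil (fscale c h) k = c * bil h k.
Proof. by rewrite /bil /=; ring. Qed.
Lemma bilDr h g k : bil k (fadd h g) = bil k h + bil k g.
Proof. by rewrite /bil /=; ring. Qed.
Lemma bilZr c h k : bil k (fscale c h) = c * bil k h.
Proof. by rewrite /bil /=; ring. Qed.

Lemma fadd_inj h g k : fadd h g = fadd h k -> g = k.
Proof. by case=> /addrI e1 /addrI e2 /addrI e3 /addrI e4; apply: form_ext. Qed.

Lemma faddC h g : fadd h g = fadd g h.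
Proof. by apply: form_ext; rewrite /= addrC. Qed.

(** The Hermitian matrix behind this value has diagonal [fa], [fd] and off-diagonal entries half of
    [fx -+ i fy]; with these halves [-4 det] is [fx^2 + fy^2 - 4 fa fd]. *)
Definition feval h p q : R :=
  fa h * sqn p + fd h * sqn q + fx h * Re (p * conjc q) + fy h * Im (p * conjc q).

Lemma feval_ext h g : (forall p q, feval h p q = feval g p q) -> h = g.
Proof.
move=> E; move: (E 1 0) (E 0 1) (E 1 1) (E 'i%C 1).
by rewrite /feval /sqn !cE /= => E1 E2 E3 E4; apply: form_ext; lra.
Qed.

Lemma feval_scale h z p q : feval h (z * p) (z * q) = sqn z * feval h p q.
Proof. by rewrite /feval /sqn !cE; ring. Qed.

Lemma fevalD h g p q : feval (fadd h g) p q = feval h p q + feval g p q.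
Proof. by rewrite /feval /=; ring. Qed.

(* Twice the sesquilinear form polarizing [feval h]. *)
Definition herm h p q z w : R[i] :=
  (2 * fa h)%:C%C * (p * conjc z) + (2 * fd h)%:C%C * (q * conjc w)
  + Complex (fx h) (- fy h) * (p * conjc w) + Complex (fx h) (fy h) * (q * conjc z).

(** Coefficients of the degenerate form [|det ((p, q), .)|^2]. *)
Definition nullform p q := Form (sqn q) (sqn p) (- 2 * Re (p * conjc q)) (- 2 * Im (p * conjc q)).

Lemma feval_null p q z w : feval (nullform p q) z w = sqn (p * w - q * z).
Proof. by rewrite /feval /nullform /sqn /= !cE; ring. Qed.

Lemma nullform_scale z p q : nullform (z * p) (z * q) = fscale (sqn z) (nullform p q).
Proof. by apply: form_ext; rewrite /= /sqn !cE; ring. Qed.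

Lemma bil_null2 p q z w : bil (nullform p q) (nullform z w) = - 2 * sqn (p * w - q * z).
Proof. by rewrite /bil /sqn /= /sqn !cE; ring. Qed.

Lemma bil_null h p q : bil h (nullform p q) = - 2 * feval h p q.
Proof. by rewrite /bil /feval /sqn /= /sqn !cE; ring. Qed.

Lemma bil_nullnull p q : bil (nullform p q) (nullform p q) = 0.
Proof. by rewrite /bil /= /sqn !cE; ring. Qed.

(* Coefficients of [Im (det (z, b) * conjc (det (a, z)))]: the real line in the
   coordinates of the basis [a = (p, q)], [b = (z, w)]. *)
Definition basisform2 p q z w :=
  let g := w * conjc p - conjc z * q in
  Form (Im (q * conjc w)) (Im (p * conjc z)) (Im g) (Re g).

Lemma feval_basis2 p q z w s t : feval (basisform2 p q z w) s t
  = Im ((s * w - t * z) * conjc (p * t - q * s)).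
Proof. by rewrite /feval /sqn /= !cE; ring. Qed.

(** Rescaling one of the three vectors multiplies this triple product by a positive number, so its
    sign depends only on the three points. For points on the circle of [h] this sign is their cyclic
    order. *)
Definition theta h p q z w s t : R :=
  Im (herm h p q z w * herm h z w s t * herm h s t p q).

Lemma herm_scale h x y p q z w : herm h (x * p) (x * q) (y * z) (y * w)
  = x * conjc y * herm h p q z w.
Proof. by rewrite /herm !conjcM; ring. Qed.

Lemma Im_real_mul c z : Im (c%:C%C * z) = c * Im z.
Proof. by rewrite !cE /=; ring. Qed.

Lemma theta_scale h x1 x2 x3 p q z w s t :
  theta h (x1 * p) (x1 * q) (x2 * z) (x2 * w) (x3 * s) (x3 * t)
  = sqn x1 * sqn x2 * sqn x3 * theta h p q z w s t.
Proof.
rewrite /theta !herm_scale.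
set X := herm _ _ _ _ _; set Y := herm _ _ _ _ _; set Z := herm _ _ _ _ _.
rewrite -Im_real_mul !rmorphM /= -!mul_conj; congr (Im _); ring.
Qed.

Lemma herm_basis2E p q z w s t s' t' :
  herm (basisform2 p q z w) s t s' t'
  = - 'i%C * ((s * w - t * z) * conjc (p * t' - q * s')
              - conjc (s' * w - t' * z) * (p * t - q * s)).
Proof.
have -> : herm (basisform2 p q z w) s t s' t' =
  - 'i%C * ((q * conjc w - conjc q * w) * s * conjc s'
  + (p * conjc z - conjc p * z) * t * conjc t'
  + (w * conjc p - conjc z * q) * s * conjc t'
  - (conjc w * p - z * conjc q) * t * conjc s').
  rewrite /herm /=; set a := _%:C%C; set b := _%:C%C; set c := Complex _ _; set d := Complex _ _.
  have -> : a = - 'i%C * (q * conjc w - conjc q * w).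
    by apply: cext; rewrite !cE; ring.
  have -> : b = - 'i%C * (p * conjc z - conjc p * z).
    by apply: cext; rewrite !cE; ring.
  have -> : c = - 'i%C * (w * conjc p - conjc z * q).
    by apply: cext; rewrite !cE; ring.
  have -> : d = 'i%C * (conjc w * p - z * conjc q).
    by apply: cext; rewrite !cE; ring.
  ring.
by rewrite !conjE; ring.
Qed.

(** Each of the determinants in [herm_basis2E] picks up the factor [det], by Cramer's rule, and they
    occur in pairs of one determinant and one conjugate. *)
Lemma herm_basis2 p q z w s t s' t' :
  herm (basisform2 p q z w) (p * s + z * t) (q * s + w * t)
    (p * s' + z * t') (q * s' + w * t')
  = (sqn (p * w - q * z))%:C%C * herm (Form 0 0 0 1) s t s' t'.
Proof.
have -> : Form 0 0 0 1 = basisform2 1 0 0 1 :> hform R.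
  by apply: form_ext; cbn [fa fd fx fy basisform2]; rewrite ?cE; ring.
by rewrite !herm_basis2E -mul_conj !conjE; ring.
Qed.

Lemma theta_basis2 p q z w s t s' t' s2 t2 :
  theta (basisform2 p q z w) (p * s + z * t) (q * s + w * t)
    (p * s' + z * t') (q * s' + w * t') (p * s2 + z * t2) (q * s2 + w * t2)
  = (sqn (p * w - q * z)) ^+ 3 * theta (Form 0 0 0 1) s t s' t' s2 t2.
Proof.
rewrite /theta !herm_basis2.
set X := herm _ _ _ _ _; set Y := herm _ _ _ _ _; set Z := herm _ _ _ _ _.
by rewrite -Im_real_mul rmorphXn /=; congr (Im _); ring.
Qed.

Lemma bil_basis2 p q z w : bil (basisform2 p q z w) (basisform2 p q z w) = sqn (p * w - q * z).
Proof. by rewrite /bil /sqn /= !cE; ring. Qed.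

Lemma fevalherm h p q : herm h p q p q = (2 * feval h p q)%:C%C.
Proof. by apply: cext; rewrite /feval /sqn /= !cE /=; ring. Qed.

End Forms.

Ltac fsimp := cbn [fa fd fx fy fscale fadd nullform basisform2].

(** * Homogeneous coordinates on the Riemann sphere *)

Section Points.
Context {R : realType}.
Implicit Types (h : hform R) (P : Cinf R) (p q z w : R[i]).

Definition hom1 P : R[i] := if P is Some z then z else 1.
Definition hom2 P : R[i] := if P is Some _ then 1 else 0.

Lemma hom_neq0 P : (hom1 P != 0) || (hom2 P != 0).
Proof. by case: P => [z|] /=; rewrite oner_eq0 ?orbT. Qed.

Lemma ratioP p q : (p != 0) || (q != 0) ->
  exists2 l : R[i], l != 0 & hom1 (ratio p q) = l * p /\ hom2 (ratio p q) = l * q.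
Proof.
rewrite /ratio; have [->|q0 _] := eqVneq q 0.
  rewrite orbF => p0; exists p^-1; first by rewrite invr_eq0.
  by rewrite mulVf // mulr0.
by exists q^-1; rewrite ?invr_eq0 // mulVf // mulrC.
Qed.

Lemma ratio_hom P : ratio (hom1 P) (hom2 P) = P.
Proof. by case: P => [z|]; rewrite /ratio /= ?eqxx ?oner_eq0 ?divr1. Qed.

Lemma ratio_scale z p q : z != 0 -> ratio (z * p) (z * q) = ratio p q.
Proof.
move=> z0; rewrite /ratio mulf_eq0 (negbTE z0) /=.
by case: eqP => // /eqP q0; congr Some; field; rewrite z0 q0.
Qed.

Lemma ratio_det p q z w : (p != 0) || (q != 0) -> (z != 0) || (w != 0) ->
  p * w - q * z = 0 -> ratio p q = ratio z w.
Proof.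
move=> pq zw /eqP; rewrite subr_eq0 => /eqP E; rewrite /ratio.
have [q0|q0] := eqVneq q 0; have [w0|w0] := eqVneq w 0 => //.
- move: pq E; rewrite q0 eqxx orbF mul0r => p0 /eqP.
  by rewrite mulf_eq0 (negbTE p0) (negbTE w0).
- move: zw E; rewrite w0 eqxx orbF mulr0 => z0 /esym/eqP.
  by rewrite mulf_eq0 (negbTE z0) (negbTE q0).
congr Some; apply: (mulIf w0); apply: (mulIf q0).
rewrite mulrAC divfK // E; field; exact: w0.
Qed.

Definition peval h P := feval h (hom1 P) (hom2 P).

Lemma peval_ratio h p q : (p != 0) || (q != 0) ->
  exists2 k : R, 0 < k & peval h (ratio p q) = k * feval h p q.
Proof.
case/ratioP => l l0 [E1 E2]; exists (sqn l); first exact: sqn_gt0.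
by rewrite /peval E1 E2 feval_scale.
Qed.

Definition ptheta h P Q S :=
  theta h (hom1 P) (hom2 P) (hom1 Q) (hom2 Q) (hom1 S) (hom2 S).

Lemma mobiusE (M : 'M[R[i]]_2) P : mobius M P =
  ratio (M 0 0 * hom1 P + M 0 1 * hom2 P)%R (M 1 0 * hom1 P + M 1 1 * hom2 P)%R.
Proof. by case: P => [z|] /=; rewrite ?mulr1 // !mulr0 !addr0. Qed.

(** At a common zero the gradients [(X, Y)] and [(X', Y')] of the two forms are unit vectors, by
    norm 1, and [bil h g] is their scalar product. At infinity both leading coefficients vanish and
    the gradients are constant. *)
Lemma peval_cauchy h g P : bil h h = 1 -> bil g g = 1 ->
  peval h P = 0 -> peval g P = 0 -> -1 <= bil h g.
Proof.
case: P => [z|]; rewrite /peval /bil /feval /sqn; cbn [hom1 hom2]; rewrite !cE.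
  case: h g => a d x y [a' d' x' y'] /=.
  move: (Re z) (Im z) => s t h1 g1 h0 g0.
  pose X := 2 * a * s + x; pose Y := 2 * a * t + y.
  pose X' := 2 * a' * s + x'; pose Y' := 2 * a' * t + y'.
  have E1 : X ^+ 2 + Y ^+ 2 = 1.
    rewrite -h1 /X /Y; apply/eqP; rewrite -subr_eq0.
    rewrite -(mulr0 (4 * a)) -[X in _ == _ * X]h0; apply/eqP; ring.
  have E2 : X' ^+ 2 + Y' ^+ 2 = 1.
    rewrite -g1 /X' /Y'; apply/eqP; rewrite -subr_eq0.
    rewrite -(mulr0 (4 * a')) -[X in _ == _ * X]g0; apply/eqP; ring.
  have -> : x * x' + y * y' - 2 * (a * d' + d * a') = X * X' + Y * Y'.
    rewrite /X /X' /Y /Y'.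
    have := congr1 ( *%R (2 * a')) h0; have := congr1 ( *%R (2 * a)) g0; lra.
  have := addr_ge0 (sqr_ge0 (X + X')) (sqr_ge0 (Y + Y')); lra.
case: h g => a d x y [a' d' x' y'] /= h1 g1 h0 g0.
have a0 : a = 0 by lra.
have a'0 : a' = 0 by lra.
move: h1 g1; rewrite a0 a'0 => h1 g1.
have := addr_ge0 (sqr_ge0 (x + x')) (sqr_ge0 (y + y')); lra.
Qed.

End Points.

(** * Oriented circles as forms of norm 1 *)

Section CircleForms.
Context {R : realType}.
Implicit Types (K : ocircle R) (P : Cinf R) (h : hform R).

(** The denominator [2 r] normalizes [bil] to 1. The sign makes the form negative on the interior,
    which for counterclockwise travel is the outside of the disc. *)
Definition cform K : hform R :=
  match K with
  | Round c r _ ccw => fscale (if ccw then -1 else 1)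
      (Form (2 * r)^-1 ((sqn c - r ^+ 2) / (2 * r)) (- Re c / r) (- Im c / r))
  | Straight d _ s => Form 0 (- s) (- Im d) (Re d)
  end.

Lemma cform_real_line : cform (@real_line R) = Form 0 0 0 1.
Proof. by rewrite /= !oppr0. Qed.

Lemma peval_round c r r0 b z : peval (cform (@Round R c r r0 b)) (Some z)
  = (if b then -1 else 1) * ((sqn (z - c) - r ^+ 2) / (2 * r)).
Proof.
have rn0 : r != 0 by rewrite gt_eqF.
rewrite /peval /feval /sqn; cbn [hom1 hom2 cform]; fsimp; rewrite /sqn !cE.
by move: (if b then _ else _) => e; field.
Qed.

Lemma peval_straight d d1 s z : peval (cform (@Straight R d d1 s)) (Some z)
  = Im (conjc d * z) - s.
Proof. by rewrite /peval /feval /sqn; cbn [hom1 hom2 cform]; fsimp; rewrite !cE; ring. Qed.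

Lemma sqn_norm1 (d : R[i]) : `|d| == 1 -> sqn d = 1.
Proof.
rewrite sqn_norm eq_complex /= eqxx andbT => /eqP E.
by rewrite -(sqr_sqrtr (sqn_ge0 d)) E expr1n.
Qed.

Lemma bil_cform K : bil (cform K) (cform K) = 1.
Proof.
case: K => [c r r0 b|d d1 s]; rewrite /bil /=; last first.
  by rewrite -(sqn_norm1 d1) /sqn; ring.
have rn0 : r != 0 by rewrite gt_eqF.
by case: b; rewrite /sqn; field.
Qed.

Lemma norm_eq_sqn (z : R[i]) (r : R) : 0 < r -> (`|z| = r%:C%C) <-> (sqn z = r ^+ 2).
Proof.
move=> r0; rewrite sqn_norm; split => [[E]|->].
  by rewrite -(sqr_sqrtr (sqn_ge0 z)) E.
by rewrite sqrtr_sqr gtr0_norm.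
Qed.

Lemma norm_lt_sqn (z : R[i]) (r : R) : 0 < r -> (`|z| < r%:C%C) = (sqn z < r ^+ 2).
Proof.
move=> r0; rewrite sqn_norm ltcR -{1}(gtr0_norm r0) -sqrtr_sqr ltr_sqrt //.
by rewrite exprn_gt0.
Qed.

Lemma norm_gt_sqn (z : R[i]) (r : R) : 0 < r -> (r%:C%C < `|z|) = (r ^+ 2 < sqn z).
Proof.
move=> r0; rewrite sqn_norm ltcR.
rewrite -{1}(gtr0_norm r0) -sqrtr_sqr.
rewrite !ltNge ler_sqrt //; exact: sqr_ge0.
Qed.

Lemma on_circleE K P : on_circle K P <-> peval (cform K) P = 0.
Proof.
case: K => [c r r0 b|d d1 s]; case: P => [z|].
- have rn0 : r != 0 by rewrite gt_eqF.
  rewrite peval_round /= (norm_eq_sqn _ r0); split=> [->|/eqP].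
    by rewrite subrr mul0r mulr0.
  rewrite !mulf_eq0 invr_eq0 mulf_eq0 (negbTE rn0) subr_eq0.
  by case: b; rewrite ?oppr_eq0 oner_eq0 pnatr_eq0 /= orbF => /eqP.
- split=> //; rewrite /peval /feval /sqn; cbn [hom1 hom2 cform]; fsimp; rewrite /sqn !cE => /eqP.
  have rn0 : r != 0 by rewrite gt_eqF.
  set e := (if _ then _ else _).
  have -> : e * (2 * r)^-1 * (1 ^+ 2 + 0 ^+ 2)
    + e * ((Re c ^+ 2 + Im c ^+ 2 - r ^+ 2) / (2 * r)) * (0 ^+ 2 + 0 ^+ 2)
    + e * (- Re c / r) * (1 * 0 - 0 * - 0) + e * (- Im c / r) * (1 * - 0 + 0 * 0)
    = e * (2 * r)^-1 by ring.
  rewrite mulf_eq0 invr_eq0 mulf_eq0 (negbTE rn0) pnatr_eq0 /= orbF /e.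
  by case: ifP; rewrite ?oppr_eq0 oner_eq0.
- by rewrite peval_straight /=; split => [->|/eqP]; rewrite ?subrr // subr_eq0 => /eqP.
- by split=> //; rewrite /peval /feval /sqn; cbn [hom1 hom2 cform]; fsimp; rewrite !cE; lra.
Qed.

Lemma insideE K P : inside K P <-> peval (cform K) P < 0.
Proof.
case: K => [c r r0 b|d d1 s]; case: P => [z|].
- have k0 : 0 < (2 * r)^-1 by rewrite invr_gt0 mulr_gt0.
  rewrite peval_round; case: b => /=.
    by rewrite norm_gt_sqn // mulN1r oppr_lt0 pmulr_lgt0 // subr_gt0.
  by rewrite norm_lt_sqn // mul1r pmulr_llt0 // subr_lt0.
- have k0 : 0 < (2 * r)^-1 by rewrite invr_gt0 mulr_gt0.
  rewrite /peval /feval /sqn; cbn [hom1 hom2 cform]; fsimp; rewrite /sqn !cE.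
  by case: b; split=> //; lra.
- by rewrite peval_straight /= subr_lt0.
- split=> //; rewrite /peval /feval /sqn; cbn [hom1 hom2 cform]; fsimp; rewrite !cE; lra.
Qed.

Lemma cform_inj : injective cform.
Proof.
move=> [c r r0 b|d d1 s] [c' r' r0' b'|d' d1' s'] /= [].
- have rn0 : r != 0 by rewrite gt_eqF.
  have rn0' : r' != 0 by rewrite gt_eqF.
  move=> E1 _ E2 E3.
  have eb : b = b'.
    have k0 : 0 < (2 * r)^-1 by rewrite invr_gt0 mulr_gt0.
    have k0' : 0 < (2 * r')^-1 by rewrite invr_gt0 mulr_gt0.
    by move: E1; case: (b) (b') => [] [] //; lra.
  have er : r = r'.
    move: E1; rewrite eb => /(congr1 (fun x => x^-1)).
    rewrite !invfM !invrK; case: (b'); rewrite ?invrN invr1; lra.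
  subst r' b'.
  have ec : c = c'.
    apply: cext.
      apply/oppr_inj/(mulIf (invr_neq0 rn0)).
      by move: E2; case: (b); rewrite ?mulN1r ?mul1r // => /oppr_inj.
    apply/oppr_inj/(mulIf (invr_neq0 rn0)).
    by move: E3; case: (b); rewrite ?mulN1r ?mul1r // => /oppr_inj.
  by subst c'; congr Round; exact: eq_irrelevance.
- have k0 : 0 < (2 * r)^-1 by rewrite invr_gt0 mulr_gt0.
  by case: (b) => E; exfalso; lra.
- have k0 : 0 < (2 * r')^-1 by rewrite invr_gt0 mulr_gt0.
  by case: (b') => E; exfalso; lra.
move=> /oppr_inj es /oppr_inj ei er.
have ed : d = d' by apply: cext.
by subst d' s'; congr Straight; exact: eq_irrelevance.
Qed.

Lemma cform_surj h : bil h h = 1 -> exists K, cform K = h.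
Proof.
case: h => a d x y; rewrite /bil /= => E.
have [a0|a0|a0] := ltgtP a 0.
- have r0 : 0 < - (2 * a)^-1 by rewrite oppr_gt0 invr_lt0; lra.
  have an0 : a != 0 by rewrite lt_eqF.
  exists (Round (Complex (- x / (2 * a)) (- y / (2 * a))) r0 true).
  apply: form_ext; rewrite /= /sqn ?cE; try by field.
  have -> : d = (x ^+ 2 + y ^+ 2 - 1) / (4 * a)
    by have <- : 4 * a * d = x ^+ 2 + y ^+ 2 - 1; [lra|field].
  by field.
- have r0 : 0 < (2 * a)^-1 by rewrite invr_gt0; lra.
  have an0 : a != 0 by rewrite gt_eqF.
  exists (Round (Complex (- x / (2 * a)) (- y / (2 * a))) r0 false).
  apply: form_ext; rewrite /= /sqn ?cE; try by field.
  have -> : d = (x ^+ 2 + y ^+ 2 - 1) / (4 * a)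
    by have <- : 4 * a * d = x ^+ 2 + y ^+ 2 - 1; [lra|field].
  by field.
have d1 : `|Complex y (- x)| == 1.
  have -> : `|Complex y (- x)| = (1 : R)%:C%C.
    apply/norm_eq_sqn => //; rewrite /sqn !cE; move: E; rewrite a0; lra.
  by [].
by exists (Straight d1 (- d)); apply: form_ext; rewrite /= ?opprK // a0.
Qed.

(** The Vandermonde product is invariant under cyclic permutation and changes sign under
    transposition. *)
Lemma cyclic3E (a b c : R) :
  [|| a < b < c, b < c < a | c < a < b] = (0 < (b - a) * (c - b) * (c - a)).
Proof.
have pos3 (x y z : R) : 0 < x -> 0 < y -> 0 < z -> 0 < x * y * z.
  by move=> *; rewrite !mulr_gt0.
apply/idP/idP.
  case/or3P => /andP[u v].
  - by apply: pos3; lra.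
  - have := @pos3 (a - b) (c - b) (a - c); lra.
  - have := @pos3 (b - a) (b - c) (a - c); lra.
case: (ltgtP a b) => [u|u|->]; last by rewrite subrr !mul0r ltxx.
  case: (ltgtP b c) => [v|v|->]; last by rewrite subrr mulr0 mul0r ltxx.
    by [].
  case: (ltgtP c a) => [w|w|->]; last by rewrite subrr mulr0 ltxx.
    by [].
  have := @pos3 (b - a) (b - c) (c - a); lra.
case: (ltgtP b c) => [v|v|->]; last by rewrite subrr mulr0 mul0r ltxx.
  case: (ltgtP c a) => [w|w|->]; last by rewrite subrr mulr0 ltxx.
    by [].
  have := @pos3 (a - b) (c - b) (c - a); lra.
have := @pos3 (a - b) (b - c) (a - c); lra.
Qed.


Lemma herm_straight d d1 s z w : on_circle (@Straight R d d1 s) (Some z) ->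
  on_circle (@Straight R d d1 s) (Some w) ->
  herm (cform (@Straight R d d1 s)) z 1 w 1
  = 'i%C * (Re (conjc d * w) - Re (conjc d * z))%:C%C.
Proof.
rewrite /= /herm !cE => <- E.
by apply: cext; cbn [fa fd fx fy]; rewrite !cE; lra.
Qed.

Lemma herm_round c r r0 b z w :
  herm (cform (@Round R c r r0 b)) z 1 w 1
  = ((if b then -1 else 1) / r)%:C%C * ((z - c) * conjc (w - c) - (r ^+ 2)%:C%C).
Proof.
have rn0 : r != 0 by rewrite gt_eqF.
rewrite /herm; cbn [cform]; fsimp; rewrite /sqn.
by move: (if b then _ else _) => e; apply: cext; rewrite !cE; field.
Qed.

Lemma theta_round c r r0 b x y z : on_circle (@Round R c r r0 b) (Some x) ->
  on_circle (@Round R c r r0 b) (Some y) -> on_circle (@Round R c r r0 b) (Some z) ->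
  theta (cform (@Round R c r r0 b)) x 1 y 1 z 1
  = (if b then 1 else -1) * 2 * r * Im (conjc (y - x) * (z - x)).
Proof.
rewrite /on_circle /= => /(norm_eq_sqn _ r0) Ex /(norm_eq_sqn _ r0) Ey /(norm_eq_sqn _ r0) Ez.
rewrite /theta !(@herm_round c r r0); move: Ex Ey Ez.
have -> : Im (conjc (y - x) * (z - x)) =
  Im (conjc ((y - c) - (x - c)) * ((z - c) - (x - c))) by congr Im; congr (conjc _ * _); ring.
move: (x - c) (y - c) (z - c) => {}x {}y {}z.
rewrite -!Im_real_mul => Ex Ey Ez.
have rn0 : r != 0 by rewrite gt_eqF.
have mc (t : R[i]) : sqn t = r ^+ 2 -> t * conjc t = (r ^+ 2)%:C%C.
  by move=> <-; exact: mul_conj.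
move: (mc _ Ex) (mc _ Ey) (mc _ Ez); set s := (r ^+ 2)%:C%C => {}Ex {}Ey {}Ez.
set e := ((if b then -1 else 1) / r)%:C%C.
(* The expansion is grouped so that each [x * conjc x] can be replaced by [s = r^2]. What survives
   is a difference of conjugates, whose imaginary part is a multiple of the signed area. *)
have -> : e * (x * conjc y - s) * (e * (y * conjc z - s)) * (e * (z * conjc x - s))
  = e ^+ 3 * ((x * conjc x) * (y * conjc y) * (z * conjc z)
  - s * (x * conjc z * (y * conjc y) + y * conjc x * (z * conjc z) + z * conjc y * (x * conjc x))
  + s ^+ 2 * (x * conjc y + y * conjc z + z * conjc x) - s ^+ 3) by ring.
rewrite Ex Ey Ez.
have -> : s * s * s - s * (x * conjc z * s + y * conjc x * s + z * conjc y * s)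
  + s ^+ 2 * (x * conjc y + y * conjc z + z * conjc x) - s ^+ 3
  = s ^+ 2 * (x * conjc y + y * conjc z + z * conjc x - x * conjc z - y * conjc x - z * conjc y).
  by ring.
rewrite mulrA.
have -> : e ^+ 3 * s ^+ 2 = ((if b then -1 else 1) * r)%:C%C.
  rewrite -!rmorphXn -rmorphM /=; congr (_%:C%C); case: (b); field; exact: rn0.
by rewrite !Im_real_mul !cE; case: (b); ring.
Qed.

Lemma theta_rot (h : hform R) p q z w x y : theta h p q z w x y = theta h z w x y p q.
Proof. by rewrite /theta; congr Im; ring. Qed.

Lemma herm_straight_infl d d1 s w :
  herm (cform (@Straight R d d1 s)) 1 0 w 1 = - 'i%C * conjc d.
Proof. by rewrite /herm; cbn [cform]; fsimp; apply: cext; rewrite !cE; ring. Qed.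

Lemma herm_straight_infr d d1 s w :
  herm (cform (@Straight R d d1 s)) w 1 1 0 = 'i%C * d.
Proof. by rewrite /herm; cbn [cform]; fsimp; apply: cext; rewrite !cE; ring. Qed.

Lemma herm_straight_inf d d1 s :
  herm (cform (@Straight R d d1 s)) 1 0 1 0 = 0.
Proof. by rewrite /herm; cbn [cform]; fsimp; apply: cext; rewrite !cE; ring. Qed.

Lemma theta_straight_inf d d1 s z w : on_circle (@Straight R d d1 s) (Some z) ->
  on_circle (@Straight R d d1 s) (Some w) ->
  theta (cform (@Straight R d d1 s)) 1 0 z 1 w 1 = Re (conjc d * w) - Re (conjc d * z).
Proof.
move=> oz ow; rewrite /theta herm_straight_infl herm_straight_infr herm_straight //.
have := sqn_norm1 d1; rewrite /sqn; move: (Re _ - Re _) => t n1; rewrite !cE.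
by transitivity (t * (Re d ^+ 2 + Im d ^+ 2)); [ring | rewrite n1 mulr1].
Qed.

Lemma theta_straight d d1 s x z w : on_circle (@Straight R d d1 s) (Some x) ->
  on_circle (@Straight R d d1 s) (Some z) -> on_circle (@Straight R d d1 s) (Some w) ->
  let t u := Re (conjc d * u) in
  theta (cform (@Straight R d d1 s)) x 1 z 1 w 1 = (t z - t x) * (t w - t z) * (t w - t x).
Proof.
move=> ox oz ow t; rewrite /theta !herm_straight // /t.
by move: (Re _) (Re _) (Re _) => *; rewrite !cE; ring.
Qed.

(** All cases of the travel direction, finite or through infinity, become the sign of one quantity
    that behaves well under Möbius maps. *)
Lemma travelE K P Q S : travel K P Q S <->
  [/\ on_circle K P, on_circle K Q, on_circle K S & 0 < ptheta (cform K) P Q S].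
Proof.
suff E : on_circle K P -> on_circle K Q -> on_circle K S ->
    (match K with
     | Round _ _ _ ccw =>
        if (P, Q, S) is (Some z1, Some z2, Some z3) then
          let area := Im (conjc (z2 - z1) * (z3 - z1)) in
          is_true (if ccw then 0 < area else area < 0)
        else False
     | Straight d _ _ =>
        let t := omap (fun z => Re (conjc d * z)) in cyclic3 (t P) (t Q) (t S)
     end) <-> 0 < ptheta (cform K) P Q S.
  split=> -[oP oQ oS H]; split=> //.
    by apply/E => //; case: (K) H => // ? ? ? [].
  by move/E : H => /(_ oP oQ oS); case: (K) => // ? ? ? [].
rewrite /ptheta; case: K => [c r r0 b|d d1 s].
  case: P Q S => [x|] [y|] [z|] // oP oQ oS; cbn [hom1 hom2]; rewrite theta_round //.
  case: b {oP oQ oS}; cbv zeta; move: (Im _) => A; last first.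
    by rewrite -!mulrA mulN1r oppr_gt0 !pmulr_rlt0.
  by rewrite mul1r !pmulr_rgt0 // mulr_gt0.
case: P Q S => [x|] [y|] [z|] oP oQ oS; cbn [hom1 hom2 omap cyclic3]; cbv zeta;
  cbn [omap obind oapp]; rewrite /cyclic3.
- by rewrite cyclic3E theta_straight.
- by rewrite -theta_rot theta_straight_inf // subr_gt0.
- by rewrite theta_rot theta_straight_inf // subr_gt0.
- by rewrite /theta herm_straight_inf mulr0 mul0r /= ltxx.
- by rewrite theta_straight_inf // subr_gt0.
- by rewrite /theta herm_straight_inf mulr0 /= ltxx.
- by rewrite /theta herm_straight_inf !mul0r /= ltxx.
- by rewrite /theta herm_straight_inf !mul0r /= ltxx.
Qed.

(** A few sample points suffice: the four extreme points of a round circle, two finite points of a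
    line; the point at infinity tells the two kinds apart. *)
Lemma on_circle_opp K K' : on_circle K = on_circle K' ->
  cform K' = cform K \/ cform K' = fscale (-1) (cform K).
Proof.
case: K K' => [c r r0 b|d d1 s] [c' r' r0' b'|d' d1' s'] E.
- have on k l : sqn (Complex k l) = r ^+ 2 -> sqn (c + Complex k l - c') = r' ^+ 2.
    move=> H; apply/(norm_eq_sqn _ r0').
    have : on_circle (Round c r0 b) (Some (c + Complex k l)).
      by rewrite /= addrAC subrr add0r; apply/(norm_eq_sqn _ r0).
    by rewrite E.
  have := on r 0; have := on (- r) 0; have := on 0 r; have := on 0 (- r).
  rewrite /sqn !cE => /(_ ltac:(ring)) H1 /(_ ltac:(ring)) H2
    /(_ ltac:(ring)) H3 /(_ ltac:(ring)) H4.
  have e1 : Re c = Re c'.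
    apply/eqP; rewrite -subr_eq0 -(mulrI_eq0 _ (mulfI (lt0r_neq0 r0))); apply/eqP; lra.
  have e2 : Im c = Im c'.
    apply/eqP; rewrite -subr_eq0 -(mulrI_eq0 _ (mulfI (lt0r_neq0 r0))); apply/eqP; lra.
  have er : r = r'.
    apply/eqP; rewrite -(eqrXn2 (n := 2)) ?ltW //; apply/eqP; move: H1; rewrite e1 e2; lra.
  subst r'; rewrite /= /sqn -e1 -e2.
  case: (b) (b') => [] []; [by left| | | by left]; right; apply: form_ext; fsimp; ring.
- have : on_circle (Straight d1' s') None by [].
  by rewrite -E.
- have : on_circle (Straight d1 s) None by [].
  by rewrite E.
have on (t : R) : Im (conjc d' * (Complex t s * d)) = s'.
  have : on_circle (Straight d1 s) (Some (Complex t s * d)).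
    rewrite /= -[RHS]mulr1 -(sqn_norm1 d1) /sqn !cE; ring.
  by rewrite E.
have := on 0; have := on 1; rewrite !cE => H1 H0.
have n1 := sqn_norm1 d1; have n1' := sqn_norm1 d1'; rewrite /sqn in n1 n1'.
have I0 : Re d' * Im d - Im d' * Re d = 0 by lra.
have R1 : (Re d' * Re d + Im d' * Im d) ^+ 2 = 1.
  have : (Re d ^+ 2 + Im d ^+ 2) * (Re d' ^+ 2 + Im d' ^+ 2) = 1 by rewrite n1 n1' mulr1.
  have : (Re d' * Im d - Im d' * Re d) ^+ 2 = 0 by rewrite I0 expr0n.
  lra.
have E1 : Re d * (Re d' * Re d + Im d' * Im d) = Re d'.
  rewrite -[RHS]mulr1 -n1; have := congr1 ( *%R (Im d)) I0; lra.
have E2 : Im d * (Re d' * Re d + Im d' * Im d) = Im d'.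
  rewrite -[RHS]mulr1 -n1; have := congr1 ( *%R (Re d)) I0; lra.
have E3 : s * (Re d' * Re d + Im d' * Im d) = s' by lra.
move/eqP: R1; rewrite sqrf_eq1 => /orP[]/eqP R1; rewrite R1 in E1 E2 E3;
  [left|right]; apply: form_ext; cbn [cform]; fsimp; lra.
Qed.

(** * Möbius images of the real line *)

Section MobiusImage.
Variable M : 'M[R[i]]_2.
Hypothesis detM : sqn (M 0 0 * M 1 1 - M 1 0 * M 0 1) = 1.

Local Notation B := (basisform2 (M 0 0) (M 1 0) (M 0 1) (M 1 1)).
Local Notation L := (Form 0 0 0 1 : hform R).

Lemma feval_mobius z w :
  feval B (M 0 0 * z + M 0 1 * w) (M 1 0 * z + M 1 1 * w) = feval L z w.
Proof.
apply: (mulfI (_ : 2 != 0 :> R)); first by rewrite pnatr_eq0.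
have := fevalherm B (M 0 0 * z + M 0 1 * w) (M 1 0 * z + M 1 1 * w).
by rewrite herm_basis2 detM mul1r fevalherm => -[].
Qed.

Lemma mobius_image_nz z w : (z != 0) || (w != 0) ->
  (M 0 0 * z + M 0 1 * w != 0) || (M 1 0 * z + M 1 1 * w != 0).
Proof.
move=> zw; rewrite -negb_and; apply/negP => /andP[/eqP E1 /eqP E2].
have d0 : M 0 0 * M 1 1 - M 1 0 * M 0 1 != 0.
  by apply/eqP => E; move: detM; rewrite E /sqn !cE => /eqP; rewrite expr0n addr0 eq_sym oner_eq0.
have Ez : (M 0 0 * M 1 1 - M 1 0 * M 0 1) * z = 0.
  have -> : (M 0 0 * M 1 1 - M 1 0 * M 0 1) * z
    = M 1 1 * (M 0 0 * z + M 0 1 * w) - M 0 1 * (M 1 0 * z + M 1 1 * w) by ring.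
  by rewrite E1 E2 !mulr0 subrr.
have Ew : (M 0 0 * M 1 1 - M 1 0 * M 0 1) * w = 0.
  have -> : (M 0 0 * M 1 1 - M 1 0 * M 0 1) * w
    = M 0 0 * (M 1 0 * z + M 1 1 * w) - M 1 0 * (M 0 0 * z + M 0 1 * w) by ring.
  by rewrite E1 E2 !mulr0 subrr.
by move: zw; rewrite -(mulrI_eq0 z (mulfI d0)) -(mulrI_eq0 w (mulfI d0)) Ez Ew eqxx.
Qed.

Lemma mobius_image_cform K : cform K = B -> mobius_image M real_line K.
Proof.
have d0 : M 0 0 * M 1 1 - M 1 0 * M 0 1 != 0.
  by apply/eqP => E; move: detM; rewrite E /sqn !cE => /eqP; rewrite expr0n addr0 eq_sym oner_eq0.
move=> EK.
have onM P : on_circle real_line P -> on_circle K (mobius M P).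
  move=> /on_circleE; rewrite cform_real_line => HP; apply/on_circleE.
  rewrite EK mobiusE; have [k k0 ->] := peval_ratio B (mobius_image_nz (hom_neq0 P)).
  by rewrite feval_mobius -/(peval _ _) HP mulr0.
split.
  apply/seteqP; split=> [P oP|_ [P oP <-]]; last exact: onM.
  (* [(s, t)] is the adjugate of [M] applied to the coordinates of [P], that is, a preimage of [P]
     up to the factor [d]. *)
  pose s := M 1 1 * hom1 P - M 0 1 * hom2 P.
  pose t := - M 1 0 * hom1 P + M 0 0 * hom2 P.
  set d := M 0 0 * M 1 1 - M 1 0 * M 0 1 in d0.
  have E1 : M 0 0 * s + M 0 1 * t = d * hom1 P by rewrite /s /t /d; ring.
  have E2 : M 1 0 * s + M 1 1 * t = d * hom2 P by rewrite /s /t /d; ring.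
  have nz : (s != 0) || (t != 0).
    rewrite -negb_and; apply/negP => /andP[/eqP s0 /eqP t0].
    have := hom_neq0 P; rewrite -(mulrI_eq0 (hom1 P) (mulfI d0)).
    by rewrite -(mulrI_eq0 (hom2 P) (mulfI d0)) -E1 -E2 s0 t0 !mulr0 addr0 eqxx.
  have [l l0 [El1 El2]] := ratioP nz.
  exists (ratio s t).
    apply/on_circleE; rewrite cform_real_line.
    have [k k0 ->] := peval_ratio L nz.
    by rewrite -feval_mobius E1 E2 feval_scale -/(peval _ _) -EK (on_circleE K P).1 // !mulr0.
  rewrite mobiusE El1 El2.
  have -> : M 0 0 * (l * s) + M 0 1 * (l * t) = (l * d) * hom1 P.
    by rewrite -mulrA -E1; ring.
  have -> : M 1 0 * (l * s) + M 1 1 * (l * t) = (l * d) * hom2 P.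
    by rewrite -mulrA -E2; ring.
  by rewrite ratio_scale ?ratio_hom // mulf_neq0.
move=> P Q S /travelE [oP oQ oS H]; apply/travelE; split; [exact: onM..|].
rewrite EK /ptheta !mobiusE.
have [l l0 [-> ->]] := ratioP (mobius_image_nz (hom_neq0 P)).
have [m m0 [-> ->]] := ratioP (mobius_image_nz (hom_neq0 Q)).
have [n n0 [-> ->]] := ratioP (mobius_image_nz (hom_neq0 S)).
rewrite theta_scale theta_basis2 detM expr1n mul1r -cform_real_line.
by rewrite !mulr_gt0 // sqn_gt0.
Qed.

Lemma theta_opp (h : hform R) p q z w x y :
  theta (fscale (-1) h) p q z w x y = - theta h p q z w x y.
Proof.
have E p' q' z' w' : herm (fscale (-1) h) p' q' z' w' = - herm h p' q' z' w'.
  rewrite /herm; fsimp.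
  have -> : (2 * (-1 * fa h))%:C%C = - (2 * fa h)%:C%C by apply: cext; rewrite !cE; ring.
  have -> : (2 * (-1 * fd h))%:C%C = - (2 * fd h)%:C%C by apply: cext; rewrite !cE; ring.
  have -> : Complex (-1 * fx h) (- (-1 * fy h)) = - Complex (fx h) (- fy h).
    by apply: cext; rewrite !cE; ring.
  have -> : Complex (-1 * fx h) (-1 * fy h) = - Complex (fx h) (fy h).
    by apply: cext; rewrite !cE; ring.
  ring.
by rewrite /theta !E -Im_opp; congr Im; ring.
Qed.

(** The circle [K0] with form [B] is an image, so [K] has the same points and its form is [B] or its
    opposite. The opposite would reverse the order of the images of [0], [1] and infinity. *)
Lemma mobius_imageP K : mobius_image M real_line K <-> cform K = B.
Proof.
split; last exact: mobius_image_cform.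
move=> [oK tK].
have [K0 EK0] : exists K0, cform K0 = B by apply: cform_surj; rewrite bil_basis2.
have [oK0 tK0] := mobius_image_cform EK0.
have [|E|E] := @on_circle_opp K0 K; first by rewrite oK oK0.
  by rewrite E EK0.
have t01 : travel (@real_line R) (Some 0) (Some 1) None.
  split; rewrite /on_circle /= ?mulr0 ?mulr1 //= ?oppr0 ?addr0 //.
have /travelE[_ _ _] := tK _ _ _ t01; have /travelE[_ _ _] := tK0 _ _ _ t01.
by rewrite E /ptheta theta_opp oppr_gt0 => /lt_trans h /h; rewrite ltxx.
Qed.

End MobiusImage.


(** The two values at a point add up to a square: they are never both negative, and both vanish only
    where the square does. That this point lies on both circles follows from
    [bil h (h + h') = 1 - 1 = 0], since pairing with a null form is evaluation up to a factor. *)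
Lemma tangent_of_sum K K' (p q : R[i]) : (p != 0) || (q != 0) ->
  fadd (cform K) (cform K') = nullform p q ->
  tangent_at K K' (ratio p q) /\ inside K `&` inside K' = set0.
Proof.
move=> pq E.
have b1 : bil (cform K) (cform K') = -1.
  have := bil_nullnull p q; rewrite -E bilDl !bilDr !bil_cform (bilC (cform K')); lra.
have onP C : bil (cform C) (nullform p q) = 0 -> on_circle C (ratio p q).
  move=> H; apply/on_circleE; have [k k0 ->] := peval_ratio (cform C) pq.
  by move: H; rewrite bil_null => H; have -> : feval (cform C) p q = 0; [lra | rewrite mulr0].
have sum P : peval (cform K) P + peval (cform K') P = sqn (p * hom2 P - q * hom1 P).
  by rewrite /peval -fevalD E feval_null.
split.
  apply/seteqP; split=> [P [/on_circleE oK /on_circleE oK']|_ ->].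
    have := sum P; rewrite oK oK' addr0 => /esym/sqn_eq0 H.
    by rewrite -(ratio_hom P); apply/esym/ratio_det => //; exact: hom_neq0.
  split; apply: onP; rewrite -E bilDr bil_cform ?b1 ?(bilC (cform K')) ?b1; lra.
rewrite -subset0 => P [/insideE iK /insideE iK'].
have := sum P; have := sqn_ge0 (p * hom2 P - q * hom1 P); rewrite /set0 /=; lra.
Qed.

Lemma no_self_tangent K : ~ tangent K K.
Proof.
case=> P; rewrite /tangent_at setIid => E.
have [Q [S [oQ oS]]] : exists Q S, [/\ on_circle K Q, on_circle K S & Q <> S].
  case: K {E} => [c r r0 b|d d1 s].
    exists (Some (c + r%:C%C)), (Some (c - r%:C%C)); split.
    - by rewrite /= addrAC subrr add0r; apply/(norm_eq_sqn _ r0); rewrite /sqn !cE; ring.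
    - by rewrite /= addrAC subrr add0r; apply/(norm_eq_sqn _ r0); rewrite /sqn !cE; ring.
    by case=> /(congr1 (@Re R)); rewrite !cE; lra.
  exists None, (Some (Complex 0 s * d)); split => //.
  rewrite /= !cE; have := sqn_norm1 d1; rewrite /sqn => n1.
  by transitivity (s * (Re d ^+ 2 + Im d ^+ 2)); [ring | rewrite n1 mulr1].
by apply; move: oQ oS; rewrite E => -> ->.
Qed.

(* In coordinates where [P] is at infinity, two forms vanishing at [P] are the
   affine functions [u + Re (t * e)], [u' + Re (t * e')]. *)
Lemma tangent_affine (u u' x y x' y' : R) : x ^+ 2 + y ^+ 2 = 1 -> x' ^+ 2 + y' ^+ 2 = 1 ->
  ~ (exists s t, u + x * s + y * t = 0 /\ u' + x' * s + y' * t = 0) ->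
  ~ (exists s t, u + x * s + y * t < 0 /\ u' + x' * s + y' * t < 0) ->
  [/\ x' = - x, y' = - y & 0 < u + u'].
Proof.
move=> n n' noz nos.
have I0 : x * y' - x' * y = 0.
  apply/eqP/negPn/negP => D0; apply: noz.
  exists ((- u * y' + u' * y) / (x * y' - x' * y)), ((- u' * x + u * x') / (x * y' - x' * y)).
  by split; field.
have R1 : (x * x' + y * y') ^+ 2 = 1.
  have : (x ^+ 2 + y ^+ 2) * (x' ^+ 2 + y' ^+ 2) = 1 by rewrite n n' mulr1.
  have : (x * y' - x' * y) ^+ 2 = 0 by rewrite I0 expr0n.
  lra.
have E1 : x * (x * x' + y * y') = x'.
  rewrite -[RHS]mulr1 -n; have := congr1 ( *%R y) I0; lra.
have E2 : y * (x * x' + y * y') = y'.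
  rewrite -[RHS]mulr1 -n; have := congr1 ( *%R x) I0; lra.
have sq t : x * (t * x) + y * (t * y) = t.
  by transitivity (t * (x ^+ 2 + y ^+ 2)); [ring | rewrite n mulr1].
move/eqP: R1; rewrite sqrf_eq1 => /orP[]/eqP R1; rewrite R1 in E1 E2.
  (* With equal gradients, moving far enough against them makes both functions negative; [t]
     outweighs both constant terms. *)
  exfalso; apply: nos; pose t := - (1 + `|u| + `|u'|); exists (t * x), (t * y).
  have := sq t; rewrite -E1 -E2 !mulr1 => st.
  have := ler_norm u; have := ler_norm u'; rewrite /t in st *.
  have := normr_ge0 u; have := normr_ge0 u'; split; lra.
split; [lra | lra |].
have ex : x' = - x by lra.
have ey : y' = - y by lra.
case: (ltgtP 0 (u + u')) => // H; exfalso.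
  (* Halfway between the two parallel lines both functions take the value [(u + u') / 2]. *)
  apply: nos; exists (((u' - u) / 2) * x), (((u' - u) / 2) * y).
  have := sq ((u' - u) / 2); rewrite ex ey => st; split; lra.
apply: noz; exists (- u * x), (- u * y).
have := sq (- u); rewrite ex ey => st; split; lra.
Qed.

Lemma sum_of_tangent K K' P : tangent_at K K' P -> inside K `&` inside K' = set0 ->
  exists2 k : R, 0 < k &
    fadd (cform K) (cform K') = fscale k (nullform (hom1 P) (hom2 P)).
Proof.
move=> T D.
have [oK oK'] : (on_circle K `&` on_circle K') P by rewrite T.
have noz Q : peval (cform K) Q = 0 -> peval (cform K') Q = 0 -> Q = P.
  move=> /on_circleE q /on_circleE q'.
  by have : (on_circle K `&` on_circle K') Q by []; rewrite T.
have nos Q : peval (cform K) Q < 0 -> peval (cform K') Q < 0 -> False.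
  move=> /insideE q /insideE q'.
  by have : (inside K `&` inside K') Q by []; rewrite D.
move/on_circleE : oK; move/on_circleE : oK' => {T D}.
have := bil_cform K; have := bil_cform K'; move: noz nos.
case: (cform K) (cform K') => a d x y [a' d' x' y'].
case: P => [z|] noz nos; rewrite /bil /peval /feval; cbn [fa fd fx fy hom1 hom2];
  rewrite /sqn !cE => n' n o' o.
- set X := 2 * a * Re z + x; set Y := 2 * a * Im z + y.
  set X' := 2 * a' * Re z + x'; set Y' := 2 * a' * Im z + y'.
  have E1 : X ^+ 2 + Y ^+ 2 = 1 by rewrite /X /Y; have := congr1 ( *%R (4 * a)) o; lra.
  have E1' : X' ^+ 2 + Y' ^+ 2 = 1 by rewrite /X' /Y'; have := congr1 ( *%R (4 * a')) o'; lra.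
  (* The point with coordinates [(1 + w z, w)] is [z + 1 / w]. In the chart [w] the tangency point
     is at infinity, and both forms become affine with constant terms [a] and [a'], whose sum will
     be the factor [k]. *)
  have nz (w : R[i]) : (1 + w * z != 0) || (w != 0).
    by have [->|] := eqVneq w 0; rewrite ?orbT // mul0r addr0 oner_eq0.
  have v1 (s t : R) : feval (Form a d x y) (1 + Complex s t * z) (Complex s t) = a + X * s - Y * t.
    rewrite /feval /X /Y /sqn !cE; cbn [fa fd fx fy].
    by have := congr1 ( *%R (s ^+ 2 + t ^+ 2)) o; lra.
  have v1' (s t : R) :
      feval (Form a' d' x' y') (1 + Complex s t * z) (Complex s t) = a' + X' * s - Y' * t.
    rewrite /feval /X' /Y' /sqn !cE; cbn [fa fd fx fy].
    by have := congr1 ( *%R (s ^+ 2 + t ^+ 2)) o'; lra.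
  have [||eX eY k0] := @tangent_affine a a' X Y X' Y' E1 E1'.
  - case=> s [t [h1 h2]].
    have [k k0 e] := peval_ratio (Form a d x y) (nz (Complex s (- t))).
    have [k' k0' e'] := peval_ratio (Form a' d' x' y') (nz (Complex s (- t))).
    have : ratio (1 + Complex s (- t) * z) (Complex s (- t)) = Some z.
      apply: noz; [rewrite e v1 | rewrite e' v1'].
        by have -> : a + X * s - Y * - t = 0; [lra | rewrite mulr0].
      by have -> : a' + X' * s - Y' * - t = 0; [lra | rewrite mulr0].
    rewrite /ratio; case: eqP => // /eqP w0 [] /(congr1 ( *%R^~ (Complex s (- t)))).
    rewrite divfK // => /eqP; rewrite mulrC -subr_eq0 addrK.
    by rewrite oner_eq0.
  - case=> s [t [h1 h2]].
    have [k k0 e] := peval_ratio (Form a d x y) (nz (Complex s (- t))).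
    have [k' k0' e'] := peval_ratio (Form a' d' x' y') (nz (Complex s (- t))).
    apply: (nos (ratio (1 + Complex s (- t) * z) (Complex s (- t)))).
      rewrite e v1 pmulr_rlt0 //; lra.
    rewrite e' v1' pmulr_rlt0 //; lra.
  exists (a + a') => //; rewrite /X /X' /Y /Y' in eX eY.
  apply: form_ext; fsimp; rewrite /sqn ?(Re_mul, Im_mul, Re_conj, Im_conj) ?(Re_one, Im_one).
  + ring.
  + have := congr1 ( *%R (Re z)) eX; have := congr1 ( *%R (Im z)) eY; lra.
  + lra.
  + lra.
have a0 : a = 0 by lra.
have a0' : a' = 0 by lra.
have E1 : x ^+ 2 + y ^+ 2 = 1 by move: n; rewrite a0; lra.
have E1' : x' ^+ 2 + y' ^+ 2 = 1 by move: n'; rewrite a0'; lra.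
have v1 (s t : R) : peval (Form a d x y) (Some (Complex s t)) = d + x * s + y * t.
  by rewrite /peval /feval /sqn a0; cbn [fa fd fx fy hom1 hom2]; rewrite !cE; ring.
have v1' (s t : R) : peval (Form a' d' x' y') (Some (Complex s t)) = d' + x' * s + y' * t.
  by rewrite /peval /feval /sqn a0'; cbn [fa fd fx fy hom1 hom2]; rewrite !cE; ring.
have [||eX eY k0] := @tangent_affine d d' x y x' y' E1 E1'.
- by case=> s [t [h1 h2]]; have := noz (Some (Complex s t)); rewrite v1 v1' => /(_ h1 h2).
- by case=> s [t [h1 h2]]; apply: (nos (Some (Complex s t))); rewrite ?v1 ?v1'.
by exists (d + d') => //; apply: form_ext; fsimp; rewrite ?a0 ?a0' ?eX ?eY;
  rewrite /sqn ?(Re_mul, Im_mul, Re_conj, Im_conj) ?(Re_one, Im_one, Re_zero, Im_zero); ring.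
Qed.

End CircleForms.

(** * Gaussian integers and their units *)

Section GaussianIntegers.
Context {R : realType}.
Implicit Types (x y z e : R[i]).

Lemma gaussIntE z : (z \is a gaussInt) = (Re z \is a Num.int) && (Im z \is a Num.int).
Proof. by rewrite qualifE. Qed.

Lemma gaussD x y : x \is a gaussInt -> y \is a gaussInt -> x + y \is a gaussInt.
Proof.
by rewrite !gaussIntE => /andP[? ?] /andP[? ?]; rewrite !cE !rpredD.
Qed.

Lemma gaussN x : x \is a gaussInt -> - x \is a gaussInt.
Proof. by rewrite !gaussIntE => /andP[? ?]; rewrite !cE !rpredN; apply/andP. Qed.

Lemma gaussB x y : x \is a gaussInt -> y \is a gaussInt -> x - y \is a gaussInt.
Proof. by move=> ? /gaussN; exact: gaussD. Qed.

Lemma gaussM x y : x \is a gaussInt -> y \is a gaussInt -> x * y \is a gaussInt.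
Proof.
by rewrite !gaussIntE => /andP[? ?] /andP[? ?]; rewrite !cE rpredB ?rpredD ?rpredM.
Qed.

Lemma gauss_conj x : x \is a gaussInt -> conjc x \is a gaussInt.
Proof. by rewrite !gaussIntE => /andP[? ?]; rewrite !cE rpredN; apply/andP. Qed.

Lemma gauss1 : 1 \is a @gaussInt R.
Proof. by rewrite gaussIntE !cE rpred0 rpred1. Qed.

Lemma gauss0 : 0 \is a @gaussInt R.
Proof. by rewrite gaussIntE !cE rpred0. Qed.

Lemma gaussi : 'i%C \is a @gaussInt R.
Proof. by rewrite gaussIntE !cE rpred0 rpred1. Qed.

Lemma gauss_int (n : int) : n%:~R \is a @gaussInt R.
Proof. by rewrite gaussIntE !cE rpred0 rpred_int. Qed.

Lemma sqn_gauss z : z \is a gaussInt -> exists n : nat, sqn z = n%:R.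
Proof.
rewrite gaussIntE => /andP[/intrP[m Em] /intrP[n En]].
exists (absz (m ^+ 2 + n ^+ 2)); rewrite natr_absz ger0_norm ?addr_ge0 ?sqr_ge0 //.
by rewrite /sqn Em En rmorphD !rmorphXn.
Qed.

Lemma gauss_unitP e : gauss_unit e <-> e \is a gaussInt /\ sqn e = 1.
Proof.
split.
  move=> [[[]|]|] ->; split; rewrite ?gaussN ?gauss1 ?gaussi //;
    by rewrite /sqn !cE; ring.
rewrite gaussIntE => -[/andP[/intrP[m Em] /intrP[n En]]].
rewrite /sqn Em En -!rmorphXn -rmorphD /= => /eqP.
rewrite -[1]/(1%:~R) eqr_int => /eqP mn.
have [[m0 n0]|[[m0 n0]|[[m0 n0]|[m0 n0]]]] :
  (m = 1 /\ n = 0) \/ ((m = -1 /\ n = 0) \/ ((m = 0 /\ n = 1) \/ (m = 0 /\ n = -1))).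
- have : (-1 <= m <= 1) by nia.
  have : (-1 <= n <= 1) by nia.
  move=> h1 h2; have : m * m + n * n = 1 by lia.
  have : m = -1 \/ m = 0 \/ m = 1 by lia.
  have : n = -1 \/ n = 0 \/ n = 1 by lia.
  by case=> [->|[]->] [->|[]->] //=; lia.
- by left; left; left; apply: cext; rewrite ?Em ?En ?m0 ?n0 !cE.
- by left; left; right; apply: cext; rewrite ?Em ?En ?m0 ?n0 !cE ?oppr0.
- by left; right; apply: cext; rewrite ?Em ?En ?m0 ?n0 !cE.
- by right; apply: cext; rewrite ?Em ?En ?m0 ?n0 !cE ?oppr0.
Qed.

Lemma gauss_unit_conj e : gauss_unit e -> gauss_unit (conjc e).
Proof.
by move=> /gauss_unitP[? ?]; apply/gauss_unitP; rewrite sqn_conj; split=> //; exact: gauss_conj.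
Qed.

Lemma gauss_unitM e f : gauss_unit e -> gauss_unit f -> gauss_unit (e * f).
Proof.
move=> /gauss_unitP[? ?] /gauss_unitP[? ?]; apply/gauss_unitP.
by rewrite sqnM; split; [exact: gaussM | nra].
Qed.

Lemma gauss_unitN e : gauss_unit e -> gauss_unit (- e).
Proof.
by move=> /gauss_unitP[? ?]; apply/gauss_unitP; rewrite sqnN; split=> //; exact: gaussN.
Qed.

Lemma gauss_unit1 : gauss_unit (1 : R[i]). Proof. by left; left; left. Qed.
Lemma gauss_uniti : gauss_unit ('i%C : R[i]). Proof. by left; right. Qed.

Lemma sqn1_conj e : sqn e = 1 -> e * conjc e = 1.
Proof. by move=> E; rewrite mul_conj E. Qed.

Lemma gauss_factor1 x y : x \is a gaussInt -> y \is a gaussInt ->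
  sqn (x * y) = 1 -> sqn x = 1.
Proof.
move=> /sqn_gauss[m Em] /sqn_gauss[n En]; rewrite sqnM Em En -natrM.
move=> /eqP; rewrite -[1]/(1%:R) eqr_nat muln_eq1 => /andP[/eqP -> _] //.
Qed.

End GaussianIntegers.

(** * Lax vectors, unimodular pairs and their forms *)

Section LaxVectors.
Context {R : realType}.
Local Notation vec := 'cV[R[i]]_2.
Implicit Types (a b u v w x : vec) (l m : laxvec R) (e : R[i]).

Lemma ord2P (i : 'I_2) : i = 0 \/ i = 1.
Proof. by case: i => [[|[|//]] H]; [left|right]; apply: val_inj. Qed.

Lemma vec_ext u v : u 0 0 = v 0 0 -> u 1 0 = v 1 0 -> u = v.
Proof. by move=> E0 E1; apply/matrixP => i j; rewrite ord1; case: (ord2P i) => ->. Qed.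

Definition dt u v : R[i] := u 0 0 * v 1 0 - u 1 0 * v 0 0.

Definition gvec v := v 0 0 \is a gaussInt /\ v 1 0 \is a gaussInt.

Lemma gvecP v : v \is a mxOver gaussInt <-> gvec v.
Proof.
split=> [/mxOverP H|[H0 H1]]; first by split; apply: H.
by apply/mxOverP => i j; rewrite ord1; case: (ord2P i) => ->.
Qed.

Lemma gvecZ e v : e \is a gaussInt -> gvec v -> gvec (e *: v).
Proof. by move=> He [? ?]; split; rewrite !mxE gaussM. Qed.

Lemma gvecD u v : gvec u -> gvec v -> gvec (u + v).
Proof. by move=> [? ?] [? ?]; split; rewrite !mxE gaussD. Qed.

Lemma gauss_dt u v : gvec u -> gvec v -> dt u v \is a gaussInt.
Proof. by move=> [? ?] [? ?]; rewrite gaussB // gaussM. Qed.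

Lemma dt_comb u v p q r s :
  dt (p *: u + q *: v) (r *: u + s *: v) = (p * s - q * r) * dt u v.
Proof. by rewrite /dt !mxE; ring. Qed.

Lemma dtC u v : dt u v = - dt v u. Proof. by rewrite /dt; ring. Qed.

Lemma dtZl e u v : dt (e *: u) v = e * dt u v. Proof. by rewrite /dt !mxE; ring. Qed.
Lemma dtZr e u v : dt u (e *: v) = e * dt u v. Proof. by rewrite /dt !mxE; ring. Qed.

Lemma dt_decomp a b x : sqn (dt a b) = 1 ->
  x = (dt x b * conjc (dt a b)) *: a + (dt a x * conjc (dt a b)) *: b.
Proof.
move=> /sqn1_conj E; apply: vec_ext; rewrite !mxE -[LHS]mulr1 -E;
  move: (conjc _) => d; rewrite /dt; ring.
Qed.

Definition unimod a b := [/\ gvec a, gvec b & sqn (dt a b) = 1].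

Lemma unimodC a b : unimod a b -> unimod b a.
Proof. by case=> ? ? ?; split=> //; rewrite dtC sqnN. Qed.

Lemma unimodZ a b e f : gauss_unit e -> gauss_unit f -> unimod a b -> unimod (e *: a) (f *: b).
Proof.
move=> /gauss_unitP[ge e1] /gauss_unitP[gf f1] [? ? D].
by split; [exact: gvecZ..|rewrite dtZl dtZr !sqnM e1 f1 D !mul1r].
Qed.

(** A basis expresses the two standard vectors, so its determinant divides 1. Conversely Cramer's
    rule, with the conjugate as inverse of the determinant, gives unique integral coordinates. *)
Lemma gauss_basisP a b : gauss_basis a b <-> unimod a b.
Proof.
split.
  move=> [/gvecP ga /gvecP gb H]; split=> //.
  have ge (k : 'I_2) : (\col_i (i == k)%:R : vec) \is a mxOver gaussInt.
    by apply/mxOverP => i j; rewrite mxE; case: (_ == _); [exact: gauss1|exact: gauss0].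
  have [[p q] /= [[gp gq E0] _]] := H _ (ge 0).
  have [[r s] /= [[gr gs E1] _]] := H _ (ge 1).
  have : dt (\col_i (i == 0)%:R) (\col_i (i == 1)%:R) = 1 by rewrite /dt !mxE /=; ring.
  rewrite E0 E1 dt_comb mulrC => D.
  apply: (@gauss_factor1 _ _ (p * s - q * r)); first exact: gauss_dt.
    by rewrite gaussB // gaussM.
  by rewrite D /sqn !cE; ring.
move=> [ga gb D]; split; [exact/gvecP..|move=> x /gvecP gx].
exists (dt x b * conjc (dt a b), dt a x * conjc (dt a b)); split.
  split=> /=; last exact: dt_decomp.
    by apply/gaussM; [exact: gauss_dt|exact/gauss_conj/gauss_dt].
  by apply/gaussM; [exact: gauss_dt|exact/gauss_conj/gauss_dt].
move=> [m n] /= [_ _ ->]; move/sqn1_conj : D => D.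
have E1 : dt (m *: a + n *: b) b = m * dt a b by rewrite /dt !mxE; ring.
have E2 : dt a (m *: a + n *: b) = n * dt a b by rewrite /dt !mxE; ring.
by rewrite E1 E2 -!mulrA D !mulr1.
Qed.

Lemma unimod_primitive a b : unimod a b -> primitive a.
Proof.
move=> [ga gb D]; split; first exact/gvecP.
move=> d gd H; apply/gauss_unitP; split => //.
have [p gp Ep] := H 0; have [q gq Eq] := H 1.
apply: (@gauss_factor1 _ _ (p * b 1 0 - q * b 0 0)) => //.
  by case: gb => ? ?; rewrite gaussB // gaussM.
by rewrite -D /dt Ep Eq; congr sqn; ring.
Qed.

Lemma rep_ex l : exists a, representatives l a.
Proof.
have [a pa E] := laxvecP l; exists a; rewrite E.
by exists 1; rewrite ?scale1r //; exact: gauss_unit1.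
Qed.

Lemma rep_same l a b : representatives l a -> representatives l b ->
  exists2 e, gauss_unit e & b = e *: a.
Proof.
have [v pv ->] := laxvecP l => -[e ue ->] [f uf ->].
exists (f * conjc e); first by apply: gauss_unitM => //; exact: gauss_unit_conj.
case/gauss_unitP: ue => _ /sqn1_conj E.
by rewrite scalerA -mulrA (mulrC _ e) E mulr1.
Qed.

Lemma rep_unit l a e : gauss_unit e -> representatives l a -> representatives l (e *: a).
Proof.
have [v pv ->] := laxvecP l => ue [f uf ->]; exists (e * f); last by rewrite scalerA.
exact: gauss_unitM.
Qed.

Lemma rep_opp l a : representatives l a -> representatives l (- a).
Proof. by rewrite -scaleN1r; apply: rep_unit; left; left; right. Qed.

Lemma rep_gvec l a : representatives l a -> gvec a.
Proof.
have [v [/gvecP gv _] ->] := laxvecP l => -[e /gauss_unitP[ge _] ->]; exact: gvecZ.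
Qed.

Lemma lax_eq l m a : representatives l a -> representatives m a -> l = m.
Proof.
move=> la ma; suff E : representatives l = representatives m.
  case: l m E {la ma} => [r p] [r' p'] /= E; subst r'; congr LaxVec.
  exact: Prop_irrelevance.
apply/seteqP; split=> b.
  by move=> /(rep_same la)[e ue ->]; exact: rep_unit.
by move=> /(rep_same ma)[e ue ->]; exact: rep_unit.
Qed.

Lemma lax_exists a : primitive a -> exists l, representatives l a.
Proof.
move=> pa; exists (@LaxVec R (unit_multiples a) (ex_intro2 _ _ a pa erefl)) => /=.
by exists 1; rewrite ?scale1r //; exact: gauss_unit1.
Qed.

Lemma lax_basisP l m a b : representatives l a -> representatives m b ->
  lax_basis l m <-> unimod a b.
Proof.
move=> la mb; split; last by move=> ab; exists a, b; split=> //; apply/gauss_basisP.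
move=> [a' [b' [la' mb' /gauss_basisP]]].
have [e ue ->] := rep_same la' la; have [f uf ->] := rep_same mb' mb.
exact: unimodZ.
Qed.

Definition nform v : hform R := nullform (v 0 0) (v 1 0).
Definition basisform a b : hform R := basisform2 (a 0 0) (a 1 0) (b 0 0) (b 1 0).

Lemma nformZ e v : sqn e = 1 -> nform (e *: v) = nform v.
Proof.
move=> e1; rewrite /nform !mxE nullform_scale e1.
by apply: form_ext; rewrite /fscale; cbn [fa fd fx fy]; rewrite mul1r.
Qed.

Definition laxform l := nform (sval (cid (rep_ex l))).

Lemma laxformE l a : representatives l a -> laxform l = nform a.
Proof.
rewrite /laxform; case: (cid _) => b /= lb la.
by have [e /gauss_unitP[_ ue] ->] := rep_same lb la; rewrite nformZ.
Qed.

Lemma bil_nform a b : bil (nform a) (nform b) = - 2 * sqn (dt a b).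
Proof. by rewrite /nform bil_null2. Qed.

(** Equal null forms are orthogonal, so [dt a a' = 0] and [a' = e a]. The partner [b] shows that [e]
    is a Gaussian integer, and pairing with [nform b] that its norm is 1. *)
Lemma nform_inj l m a a' b : representatives l a -> representatives m a' -> unimod a b ->
  nform a = nform a' -> l = m.
Proof.
move=> la ma' [ga gb D] E.
have d0 : dt a a' = 0.
  apply: sqn_eq0; apply: (mulfI (_ : - 2 != 0 :> R)); first by rewrite oppr_eq0 pnatr_eq0.
  have z : dt a' a' = 0 by rewrite /dt; ring.
  by rewrite -bil_nform E bil_nform z /sqn !cE; ring.
have := dt_decomp a' D; rewrite d0 mul0r scale0r addr0.
set e := _ * _ => Ea'.
suff ue : gauss_unit e by apply: (@lax_eq _ _ a') => //; rewrite Ea'; exact: rep_unit.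
apply/gauss_unitP; split.
  by apply: gaussM; [|apply: gauss_conj]; apply: gauss_dt => //; exact: rep_gvec ma'.
have : bil (nform a') (nform b) = bil (nform a) (nform b) by rewrite E.
rewrite !bil_nform Ea' dtZl sqnM D; lra.
Qed.

Lemma bil_basisform a b : bil (basisform a b) (basisform a b) = sqn (dt a b).
Proof. exact: bil_basis2. Qed.

Lemma basisform_comb a b (p q r s : R) :
  basisform (p%:C%C *: a + q%:C%C *: b) (r%:C%C *: a + s%:C%C *: b)
  = fscale (p * s - q * r) (basisform a b).
Proof. by rewrite /basisform !mxE; apply: form_ext; fsimp; rewrite !cE; ring. Qed.

Lemma basisform_scale a b e : sqn e = 1 -> basisform (e *: a) (e *: b) = basisform a b.
Proof.
move=> e1; rewrite /basisform !mxE.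
transitivity (fscale (sqn e) (basisform a b)).
  by rewrite /basisform; apply: form_ext; fsimp; rewrite !cE /sqn; ring.
by rewrite e1; apply: form_ext; rewrite /fscale; cbn [fa fd fx fy]; rewrite mul1r.
Qed.

Lemma realint (n : int) : (n%:~R : R)%:C%C = n%:~R :> R[i].
Proof. by rewrite rmorph_int. Qed.

Lemma basisform_SL a b (p q r s : int) : p * s - q * r = 1 ->
  basisform (p%:~R *: a + q%:~R *: b) (r%:~R *: a + s%:~R *: b) = basisform a b.
Proof.
move=> D; rewrite -!realint basisform_comb -!rmorphM -rmorphB D.
by apply: form_ext; rewrite /fscale; cbn [fa fd fx fy]; rewrite mul1r.
Qed.

Lemma orientation_refl a b : orientation a b (a, b).
Proof.
exists 1, 0, 0, 1; split; rewrite /= ?mulr1 ?mulr0 ?subr0 //.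
  by rewrite mulr1z mulr0z scale1r scale0r addr0.
by rewrite mulr1z mulr0z scale1r scale0r add0r.
Qed.

(** The form is invariant under integral base changes of determinant 1 and under multiplication by
    [i], so it does not matter which of the two oriented lattices matches. This makes the circle of
    a lax lattice well defined. *)
Lemma lax_lattice_form a b a' b' : lax_lattice a b = lax_lattice a' b' ->
  basisform a b = basisform a' b'.
Proof.
move=> E; have : lax_lattice a b (olattice a b) by left.
have i1 : sqn ('i%C : R[i]) = 1 by rewrite /sqn !cE; ring.
rewrite E => -[] [_ Eo]; have := orientation_refl a b; rewrite Eo.
  by move=> [p [q [r [s [D /= -> ->]]]]]; exact: basisform_SL.
by move=> [p [q [r [s [D /= -> ->]]]]]; rewrite basisform_SL // basisform_scale.
Qed.

End LaxVectors.

(** * Vertices, edges and walls of a tetrahedron *)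

Section Ord4.

Definition o0 : 'I_4 := Ordinal (isT : 0 < 4)%N.
Definition o1 : 'I_4 := Ordinal (isT : 1 < 4)%N.
Definition o2 : 'I_4 := Ordinal (isT : 2 < 4)%N.
Definition o3 : 'I_4 := Ordinal (isT : 3 < 4)%N.

Lemma ord4P (i : 'I_4) : [\/ i = o0, i = o1, i = o2 | i = o3].
Proof.
by case: i => [[|[|[|[|//]]]] H]; [constructor 1|constructor 2|constructor 3|constructor 4];
  apply: val_inj.
Qed.

Lemma fourth (i j k : 'I_4) : uniq [:: i; j; k] -> exists d, uniq [:: i; j; k; d].
Proof.
by case: (ord4P i) => ->; case: (ord4P j) => ->; case: (ord4P k) => -> // _;
  first [by exists o0 | by exists o1 | by exists o2 | by exists o3].
Qed.

Lemma ord4_third (i j : 'I_4) : i != j -> exists k, uniq [:: i; j; k].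
Proof.
by case: (ord4P i) => ->; case: (ord4P j) => -> // _;
  first [by exists o0 | by exists o1 | by exists o2].
Qed.

Lemma others (i : 'I_4) : exists j k d, uniq [:: i; j; k; d].
Proof.
case: (ord4P i) => ->.
- by exists o1, o2, o3.
- by exists o0, o2, o3.
- by exists o0, o1, o3.
- by exists o0, o1, o2.
Qed.

Lemma uniq4_cover (i j k d x : 'I_4) : uniq [:: i; j; k; d] ->
  [\/ x = i, x = j, x = k | x = d].
Proof.
case: (ord4P i) => ->; case: (ord4P j) => -> //; case: (ord4P k) => -> //;
  case: (ord4P d) => -> // _; case: (ord4P x) => ->;
  first [by constructor 1|by constructor 2|by constructor 3|by constructor 4].
Qed.

Lemma uniq3E (T : eqType) (i j k : T) : uniq [:: i; j; k] = [&& i != j, i != k & j != k].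
Proof. by rewrite /= !inE negb_or andbT andbA. Qed.

Lemma setUC2 (i j : 'I_4) : ([set i; j] = [set j; i])%SET.
Proof. by rewrite finset.setUC. Qed.

Lemma perm3 (i j k i' j' k' : 'I_4) : uniq [:: i; j; k] -> uniq [:: i'; j'; k'] ->
  exists p : {perm 'I_4}, [/\ p i = i', p j = j' & p k = k'].
Proof.
rewrite !uniq3E => /and3P[ij ik jk] /and3P[ij' ik' jk'].
pose p1 := tperm i i'; pose p2 := tperm (p1 j) j'.
pose p3 := tperm (p2 (p1 k)) k'.
have e1 : p1 i = i' by rewrite tpermL.
have e2 : p2 i' = i'.
  by rewrite tpermD // -?e1 ?(inj_eq perm_inj) // eq_sym // e1.
have e2' : p2 (p1 j) = j' by rewrite tpermL.
have ki : p2 (p1 k) != i' by rewrite -e2 -e1 !(inj_eq perm_inj) eq_sym.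
have kj : p2 (p1 k) != j' by rewrite -e2' !(inj_eq perm_inj) eq_sym.
exists (p1 * p2 * p3)%g; rewrite !permM e1 e2 e2' /p3 tpermL.
by split=> //; rewrite tpermD // eq_sym.
Qed.

Lemma card2P (e : {set 'I_4}) : #|e| = 2%N -> exists i j, i != j /\ e = [set i; j]%SET.
Proof. by move=> /eqP/cards2P[i [j [ij ->]]]; exists i, j. Qed.

Lemma card2_cases (e : {set 'I_4}) : #|e| = 2%N ->
  e \in [:: [set o0; o1]; [set o0; o2]; [set o0; o3]; [set o1; o2]; [set o1; o3]; [set o2; o3]]%SET.
Proof.
move=> /card2P[i [j [ij ->]]]; move: ij.
by case: (ord4P i) => ->; case: (ord4P j) => -> // _;
  rewrite ?(setUC2 o1 o0) ?(setUC2 o2 o0) ?(setUC2 o3 o0) ?(setUC2 o2 o1)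
    ?(setUC2 o3 o1) ?(setUC2 o3 o2) !in_cons eqxx ?orbT.
Qed.

Lemma card2_wall (i j k d : 'I_4) (e : {set 'I_4}) : uniq [:: i; j; k; d] ->
  #|e| = 2%N -> d \notin e ->
  [\/ e = [set i; j]%SET, e = [set i; k]%SET | e = [set j; k]%SET].
Proof.
move=> U /card2P[x [y [xy ->]]]; rewrite !inE negb_or => /andP[dx dy].
case: (uniq4_cover x U) xy dx => -> xy dx; case: (uniq4_cover y U) xy dy => -> xy dy;
  rewrite ?eqxx // in xy dx dy *;
  first [by constructor 1|by constructor 2|by constructor 3
        |by constructor 1; rewrite setUC2|by constructor 2; rewrite setUC2
        |by constructor 3; rewrite setUC2].
Qed.

End Ord4.

(** * Standard form and the four forms of a chamber *)

Section ChamberForms.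
Context {R : realType}.
Local Notation vec := 'cV[R[i]]_2.
Implicit Types (c : chamber R) (a b u v w x : vec) (e s t : R[i]).

Lemma chamber_adj c i j k a b : uniq [:: i; j; k] ->
  representatives (lab c [set i; j]%SET) a -> representatives (lab c [set j; k]%SET) b ->
  unimod a b.
Proof. by move=> U ra rb; have [H _ _] := lab_wall c U; exact/(lax_basisP ra rb). Qed.

(** Both coordinates of [x] in the basis [u], [v] are quotients of unit determinants, hence units;
    [e] is the inverse of the first one. *)
Lemma third_edge u v x : unimod u v -> unimod u x -> unimod v x ->
  exists e t, [/\ gauss_unit e, gauss_unit t & e *: x = u + t *: v].
Proof.
move=> [gu gv D] [_ gx Dux] [_ _ Dvx].
set d := dt u v in D.
have unit1 y : y \is a gaussInt -> sqn y = 1 -> gauss_unit (y * conjc d).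
  move=> gy y1; apply: gauss_unitM; first exact/gauss_unitP.
  by apply/gauss_unit_conj/gauss_unitP; split=> //; exact: gauss_dt.
have ua := unit1 (dt x v) (gauss_dt gx gv).
rewrite dtC sqnN in ua; have {}ua := ua Dvx.
have ub := unit1 (dt u x) (gauss_dt gu gx) Dux.
exists (conjc (- dt v x * conjc d)), (dt u x * conjc d * conjc (- dt v x * conjc d)).
have uc := gauss_unit_conj ua.
split=> //; first exact: gauss_unitM.
transitivity (conjc (- dt v x * conjc d) *: ((dt x v * conjc d) *: u + (dt u x * conjc d) *: v)).
  by rewrite -dt_decomp.
rewrite scalerDr !scalerA (dtC x v).
have /gauss_unitP[_ /sqn1_conj E] := ua.
by rewrite mulrC E scale1r (mulrC (conjc _) (dt u x * _)).
Qed.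

(** Here [u + p v], [v + q w], [w + r u] label the edges at the fourth vertex, and the equations say
    that they are pairwise unimodular. Of the 27 choices without a value 1 only the constant [i] and
    the constant [- i] survive: the left and the right chamber. *)
Lemma turn_constraint (p q r : R[i]) : gauss_unit p -> gauss_unit q -> gauss_unit r ->
  p <> 1 -> q <> 1 -> r <> 1 -> sqn (1 - q + p * q) = 1 -> sqn (1 - r + q * r) = 1 ->
  sqn (1 - p + r * p) = 1 -> (p = 'i%C \/ p = - 'i%C) /\ (q = p /\ r = p).
Proof.
move=> [[[]|]|] -> [[[]|]|] -> [[[]|]|] -> // _ _ _;
  rewrite /sqn !cE => h1 h2 h3;
  first [by split; [left|] | by split; [right|] | exfalso; lra].
Qed.

Lemma chamber_std c A B C D : uniq [:: A; B; C; D] ->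
  exists s u v w, (s = 'i%C \/ s = - 'i%C) /\ standard_form s c A B C D u v w.
Proof.
move=> U.
have [u0 ru0] := rep_ex (lab c [set C; A]%SET).
have [v0 rv0] := rep_ex (lab c [set A; B]%SET).
have [w rw] := rep_ex (lab c [set B; C]%SET).
have [x0 rx0] := rep_ex (lab c [set A; D]%SET).
have [y0 ry0] := rep_ex (lab c [set B; D]%SET).
have [z0 rz0] := rep_ex (lab c [set C; D]%SET).
have : uniq [:: A; B; C; D] by [].
rewrite /= !inE !negb_or => /andP[/and3P[AB AC AD] /andP[/andP[BC BD] /andP[CD _]]].
have un i j k : i != j -> i != k -> j != k -> uniq [:: i; j; k].
  by move=> *; rewrite uniq3E; apply/and3P.
(* Some unit multiple of [w] is [u0 + t v0]; moving the units onto [u0] and [v0] makes the sum of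
   the wall zero. *)
have [u [v [ru rv uvw]]] : exists u v, [/\ representatives (lab c [set C; A]%SET) u,
    representatives (lab c [set A; B]%SET) v & u + v + w = 0].
  have uv0 : unimod u0 v0 by apply: chamber_adj ru0 rv0; apply: un; rewrite // eq_sym.
  have vw0 : unimod v0 w by apply: chamber_adj rv0 rw; apply: un.
  have wu0 : unimod w u0 by apply: chamber_adj rw ru0; apply: un; rewrite // eq_sym.
  have [e [t [ue ut E]]] := third_edge uv0 (unimodC wu0) vw0.
  exists (- conjc e *: u0), (- (conjc e * t) *: v0); split.
  - by apply: rep_unit => //; exact/gauss_unitN/gauss_unit_conj.
  - by apply: rep_unit => //; apply/gauss_unitN/gauss_unitM => //; exact: gauss_unit_conj.
  case/gauss_unitP: ue => _ /sqn1_conj ee.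
  have -> : w = conjc e *: (e *: w) by rewrite scalerA mulrC ee scale1r.
  by rewrite E scalerDr scalerA !scaleNr -opprD addNr.
have Ew : w = - (u + v) by apply/eqP; rewrite -addr_eq0 addrC uvw.
have uv : unimod u v by apply: chamber_adj ru rv; apply: un; rewrite // eq_sym.
have vw : unimod v w by apply: chamber_adj rv rw; apply: un.
have wu : unimod w u by apply: chamber_adj rw ru; apply: un; rewrite // eq_sym.
have ux : unimod u x0 by apply: chamber_adj ru rx0; apply: un; rewrite // eq_sym.
have vx : unimod v x0.
  by apply: (@chamber_adj c B A D) => //; [apply: un; rewrite // eq_sym|rewrite setUC2].
have vy : unimod v y0 by apply: chamber_adj rv ry0; apply: un.
have wy : unimod w y0.
  by apply: (@chamber_adj c C B D) => //; [apply: un; rewrite // eq_sym|rewrite setUC2].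
have wz : unimod w z0 by apply: chamber_adj rw rz0; apply: un.
have uz : unimod u z0.
  by apply: (@chamber_adj c A C D) => //; [apply: un; rewrite // eq_sym|rewrite setUC2].
have [e1 [p [ue1 up Ep]]] := third_edge uv ux vx.
have [e2 [q [ue2 uq Eq]]] := third_edge vw vy wy.
have [e3 [r [ue3 ur Er]]] := third_edge wu wz uz.
have rx := rep_unit ue1 rx0; have ry := rep_unit ue2 ry0; have rz := rep_unit ue3 rz0.
rewrite Ep in rx; rewrite Eq in ry; rewrite Er in rz.
have lab_neq i j k l x : i != j -> k != l -> i != k -> i != l ->
    representatives (lab c [set i; j]%SET) x ->
    ~ representatives (lab c [set k; l]%SET) (- x).
  move=> ij kl ik il rij /rep_opp; rewrite opprK => rkl.
  have /setP/(_ i) : ([set i; j] = [set k; l])%SET.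
    by apply: (@lab_inj _ c); rewrite ?cards2 ?ij ?kl //; exact: lax_eq rij rkl.
  by rewrite !inE eqxx (negbTE ik) (negbTE il).
(* A turn equal to 1 gives [u + v = - w], so two opposite edges would carry the same label. *)
have p1 : p <> 1.
  move=> E; apply: (@lab_neq A D B C (u + v)); rewrite // -?Ew //.
  by move: rx; rewrite E scale1r.
have q1 : q <> 1.
  move=> E; apply: (@lab_neq B D C A (v + w)); rewrite // ?[B == A]eq_sym // ?[C == A]eq_sym //.
    by move: ry; rewrite E scale1r.
  by have -> : - (v + w) = u; [apply/eqP; rewrite eq_sym -addr_eq0 addrA uvw |].
have r1 : r <> 1.
  move=> E; apply: (@lab_neq C D A B (w + u)); rewrite // ?[C == A]eq_sym // ?[C == B]eq_sym //.
    by move: rz; rewrite E scale1r.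
  by have -> : - (w + u) = v; [apply/eqP; rewrite eq_sym -addr_eq0 addrC -addrA addrC uvw |].
have c1 : sqn (1 - q + p * q) = 1.
  have [_ _] : unimod (u + p *: v) (v + q *: w).
    by apply: (@chamber_adj c A D B); [apply: un; rewrite // eq_sym| |rewrite setUC2].
  have -> : dt (u + p *: v) (v + q *: w) = (1 - q + p * q) * dt u v.
    by rewrite Ew /dt !mxE; ring.
  by rewrite sqnM; case: uv => _ _ ->; rewrite mulr1.
have c2 : sqn (1 - r + q * r) = 1.
  have [_ _] : unimod (v + q *: w) (w + r *: u).
    by apply: (@chamber_adj c B D C); [apply: un; rewrite // eq_sym| |rewrite setUC2].
  have -> : dt (v + q *: w) (w + r *: u) = (1 - r + q * r) * dt u v.
    by rewrite Ew /dt !mxE; ring.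
  by rewrite sqnM; case: uv => _ _ ->; rewrite mulr1.
have c3 : sqn (1 - p + r * p) = 1.
  have [_ _] : unimod (w + r *: u) (u + p *: v).
    by apply: (@chamber_adj c C D A); [apply: un; rewrite // eq_sym| |rewrite setUC2].
  have -> : dt (w + r *: u) (u + p *: v) = (1 - p + r * p) * dt u v.
    by rewrite Ew /dt !mxE; ring.
  by rewrite sqnM; case: uv => _ _ ->; rewrite mulr1.
have [sp [eq er]] := turn_constraint up uq ur p1 q1 r1 c1 c2 c3.
rewrite eq in ry; rewrite er in rz.
by exists p, u, v, w; split.
Qed.

Definition half_sum (f g h : hform R) : hform R :=
  fscale 2^-1 (fadd (fadd f g) (fscale (-1) h)).

Lemma half_sumP (f g h F G H : hform R) : fadd f g = F -> fadd f h = G -> fadd g h = H ->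
  f = half_sum F G H.
Proof.
by move=> <- <- <-; apply: form_ext; rewrite /half_sum; fsimp; field.
Qed.

(** There are six equations for four forms. The wall [A B C] determines three of them and the edge
    [A D] the fourth; on the edges [B D] and [C D] the equations become identities between squares,
    true for [s = i] and [s = - i]. *)
Lemma chamber_forms c : exists f : 'I_4 -> hform R, forall i j, i != j ->
  fadd (f i) (f j) = laxform (lab c [set i; j]%SET).
Proof.
have [s [u [v [w [si [_ uvw [ru rv rw] [rx ry rz]]]]]]] := @chamber_std c o0 o1 o2 o3 isT.
have Ew : w = - (u + v) by apply/eqP; rewrite -addr_eq0 addrC uvw.
pose fA := half_sum (nform u) (nform v) (nform w).
pose fB := half_sum (nform v) (nform w) (nform u).
pose fC := half_sum (nform w) (nform u) (nform v).
pose fD := fadd (nform (u + s *: v)) (fscale (-1) fA).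
exists (fun i => nth fA [:: fA; fB; fC; fD] i).
have kE : fadd fB fD = nform (v + s *: w).
  transitivity (fadd (nform (u + s *: v)) (fadd (nform w) (fscale (-1) (nform u)))).
    by apply: form_ext; rewrite /fD /fB /fA /half_sum; fsimp; field.
  rewrite Ew /nform !mxE.
  by apply: form_ext; fsimp; case: si => ->; rewrite /sqn !cE; ring.
have kF : fadd fC fD = nform (w + s *: u).
  transitivity (fadd (nform (u + s *: v)) (fadd (nform w) (fscale (-1) (nform v)))).
    by apply: form_ext; rewrite /fD /fC /fA /half_sum; fsimp; field.
  rewrite Ew /nform !mxE.
  by apply: form_ext; fsimp; case: si => ->; rewrite /sqn !cE; ring.
have kA : fadd fA fB = nform v.
  by apply: form_ext; rewrite /fA /fB /half_sum; fsimp; field.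
have kB : fadd fB fC = nform w.
  by apply: form_ext; rewrite /fC /fB /half_sum; fsimp; field.
have kC : fadd fC fA = nform u.
  by apply: form_ext; rewrite /fC /fA /half_sum; fsimp; field.
have kD : fadd fA fD = nform (u + s *: v).
  by apply: form_ext; rewrite /fD; fsimp; ring.
move=> i j; case: (ord4P i) => ->; case: (ord4P j) => -> // _; cbn [nth o0 o1 o2 o3 nat_of_ord];
  first [ by rewrite (laxformE rx) | by rewrite (laxformE ry) | by rewrite (laxformE rz)
  | by rewrite (laxformE ru) | by rewrite (laxformE rv) | by rewrite (laxformE rw)
  | rewrite setUC2 faddC; first [ by rewrite (laxformE rx) | by rewrite (laxformE ry)
  | by rewrite (laxformE rz)
  | by rewrite (laxformE ru) | by rewrite (laxformE rv) | by rewrite (laxformE rw)]].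
Qed.

Definition cf c : 'I_4 -> hform R := sval (cid (chamber_forms c)).

Lemma cfP c i j : i != j -> fadd (cf c i) (cf c j) = laxform (lab c [set i; j]%SET).
Proof. by rewrite /cf; case: (cid _) => f /= H; exact: H. Qed.

Lemma cf_half c i j k : uniq [:: i; j; k] -> cf c i =
  half_sum (laxform (lab c [set i; j]%SET)) (laxform (lab c [set i; k]%SET))
           (laxform (lab c [set j; k]%SET)).
Proof. by rewrite uniq3E => /and3P[ij ik jk]; apply: half_sumP; exact: cfP. Qed.

(** Null forms are isotropic and those of a unimodular pair have [bil = -2], so the norm of the half
    sum is [(-4 + 4 + 4) / 4]. *)
Lemma cf_norm c i : bil (cf c i) (cf c i) = 1.
Proof.
have [j [k [d]]] := others i; rewrite (cat_uniq [:: i; j; k] [:: d]) => /andP[U _].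
rewrite (cf_half c U).
have [a ra] := rep_ex (lab c [set i; j]%SET).
have [b rb] := rep_ex (lab c [set i; k]%SET).
have [w rw] := rep_ex (lab c [set j; k]%SET).
rewrite (laxformE ra) (laxformE rb) (laxformE rw).
have un := U; move: un; rewrite uniq3E => /and3P[ij ik jk].
have [_ _ D1] : unimod a b.
  apply: (@chamber_adj c j i k) => //; last by rewrite setUC2.
  by rewrite uniq3E jk ik eq_sym ij.
have [_ _ D2] : unimod a w by apply: (@chamber_adj c i j k).
have [_ _ D3] : unimod b w.
  apply: (@chamber_adj c i k j) => //; last by rewrite setUC2.
  by rewrite uniq3E ij ik eq_sym jk.
have z (y : vec) : sqn (dt y y) = 0 by rewrite /dt /sqn !cE; ring.
rewrite /half_sum !(bilDl, bilDr, bilZl, bilZr) !bil_nform !z.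
by rewrite (dtC b a) (dtC w a) (dtC w b) !sqnN D1 D2 D3; field.
Qed.

Lemma cf_bil c i j : i != j -> bil (cf c i) (cf c j) = -1.
Proof.
move=> ij; have [a ra] := rep_ex (lab c [set i; j]%SET).
have := bil_nullnull (a 0 0) (a 1 0); rewrite -/(nform a) -(laxformE ra) -cfP //.
by rewrite bilDl !bilDr !cf_norm (bilC (cf c j)); lra.
Qed.

(** This ties the vertex labels to the forms, independently of the standard form chosen. The last
    vertex is reached through the edge [A D], and its label depends on the side. *)
Lemma std_cf s c A B C D u v w : standard_form s c A B C D u v w ->
  [/\ cf c A = basisform u ('i%C *: v), cf c B = basisform v ('i%C *: w),
      cf c C = basisform w ('i%C *: u),
      s = 'i%C -> cf c D = basisform (w - 'i%C *: v) ('i%C *: u - v) &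
      s = - 'i%C -> cf c D = basisform (w + 'i%C *: v) ('i%C *: u + v)].
Proof.
move=> [U uvw [ru rv rw] [rx ry rz]].
have Ew : w = - (u + v) by apply/eqP; rewrite -addr_eq0 addrC uvw.
move: U; rewrite /= !inE !negb_or => /andP[/and3P[AB AC AD] /andP[/andP[BC BD] /andP[CD _]]].
have eA : cf c A = half_sum (nform v) (nform u) (nform w).
  rewrite (@cf_half c A B C) ?uniq3E ?AB ?AC ?BC //.
  by rewrite (laxformE rv) (setUC2 A C) (laxformE ru) (laxformE rw).
have eB : cf c B = half_sum (nform v) (nform w) (nform u).
  rewrite (@cf_half c B A C) ?uniq3E ?AC ?BC 1?eq_sym ?AB //.
  by rewrite (setUC2 B A) (laxformE rv) (laxformE rw) (setUC2 A C) (laxformE ru).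
have eC : cf c C = half_sum (nform u) (nform w) (nform v).
  rewrite (@cf_half c C A B) ?uniq3E ?AB 1?eq_sym ?AC 1?eq_sym ?BC //.
  by rewrite (laxformE ru) (setUC2 C B) (laxformE rw) (laxformE rv).
have eD : fadd (cf c A) (cf c D) = nform (u + s *: v) by rewrite cfP // (laxformE rx).
split.
- rewrite eA Ew /half_sum /nform /basisform !mxE.
  by apply: form_ext; fsimp; rewrite /sqn !cE; field.
- rewrite eB Ew /half_sum /nform /basisform !mxE.
  by apply: form_ext; fsimp; rewrite /sqn !cE; field.
- rewrite eC Ew /half_sum /nform /basisform !mxE.
  by apply: form_ext; fsimp; rewrite /sqn !cE; field.
- move=> Es; apply: (@fadd_inj _ (cf c A)); rewrite eD eA Es Ew /half_sum /nform /basisform !mxE.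
  by apply: form_ext; fsimp; rewrite /sqn !cE; field.
- move=> Es; apply: (@fadd_inj _ (cf c A)); rewrite eD eA Es Ew /half_sum /nform /basisform !mxE.
  by apply: form_ext; fsimp; rewrite /sqn !cE; field.
Qed.

End ChamberForms.

(** * Construction of left standard chambers *)

Section StandardChamber.
Context {R : realType}.
Local Notation vec := 'cV[R[i]]_2.
Implicit Types (e f : {set 'I_4}) (u v : vec).

(* Coordinates in the basis [u], [v] of the edge labels of the left standard
   chamber, with [w = - u - v]. *)
Definition edge_coord e : R[i] * R[i] :=
  if o0 \in e then
    if o1 \in e then (0, 1) else if o2 \in e then (1, 0) else (1, 'i%C)
  else if o1 \in e then
    if o2 \in e then (-1, -1) else (- 'i%C, 1 - 'i%C)
  else ('i%C - 1, -1).

Lemma edge_coordE :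
  [/\ edge_coord [set o0; o1]%SET = (0, 1), edge_coord [set o0; o2]%SET = (1, 0),
      edge_coord [set o0; o3]%SET = (1, 'i%C) &
  [/\ edge_coord [set o1; o2]%SET = (-1, -1),
      edge_coord [set o1; o3]%SET = (- 'i%C, 1 - 'i%C) &
      edge_coord [set o2; o3]%SET = ('i%C - 1, -1)]].
Proof. by split; [..|split]; rewrite /edge_coord !inE. Qed.

Definition cdet (p q : R[i] * R[i]) := p.1 * q.2 - p.2 * q.1.

Lemma edge_coord_adj i j k : uniq [:: i; j; k] ->
  sqn (cdet (edge_coord [set i; j]%SET) (edge_coord [set j; k]%SET)) = 1.
Proof.
have [E1 E2 E3 [E4 E5 E6]] := edge_coordE.
case: (ord4P i) => ->; case: (ord4P j) => ->; case: (ord4P k) => -> // _;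
  rewrite ?(setUC2 o1 o0) ?(setUC2 o2 o0) ?(setUC2 o3 o0) ?(setUC2 o2 o1)
    ?(setUC2 o3 o1) ?(setUC2 o3 o2) ?E1 ?E2 ?E3 ?E4 ?E5 ?E6 /cdet;
  cbn [fst snd]; rewrite /sqn !cE; ring.
Qed.

Lemma edge_coord_inj e f : #|e| = 2%N -> #|f| = 2%N ->
  cdet (edge_coord e) (edge_coord f) = 0 -> e = f.
Proof.
have [E1 E2 E3 [E4 E5 E6]] := edge_coordE.
have nz (x : R[i]) : 0 < sqn x -> x = 0 -> False.
  by move=> /[swap] ->; rewrite /sqn !cE expr0n addr0 ltxx.
move=> /card2_cases He /card2_cases; move: He; rewrite !inE.
by move=> /or4P[/eqP->|/eqP->|/eqP->|/or3P[]/eqP->] /or4P[/eqP->|/eqP->|/eqP->|/or3P[]/eqP->] //;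
  rewrite ?E1 ?E2 ?E3 ?E4 ?E5 ?E6 /cdet; cbn [fst snd] => /nz []; rewrite /sqn !cE; lra.
Qed.

Lemma edge_coord_gauss e : (edge_coord e).1 \is a gaussInt /\ (edge_coord e).2 \is a gaussInt.
Proof.
have g1 := @gauss1 R; have g0 := @gauss0 R; have gi := @gaussi R.
by rewrite /edge_coord; case: (o0 \in e); case: (o1 \in e); case: (o2 \in e);
  split; rewrite ?gaussB ?gaussN.
Qed.

(** Every coordinate pair has an entry that is a unit, so one of the standard vectors completes it.
    Edge labels are primitive for this reason. *)
Lemma edge_coord_partner e : exists p q : R[i], [/\ p \is a gaussInt, q \is a gaussInt &
  sqn (cdet (edge_coord e) (p, q)) = 1].
Proof.
have g1 := @gauss1 R; have g0 := @gauss0 R.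
rewrite /edge_coord /cdet; do ![case: (_ \in _)]; cbn [fst snd];
  first [exists 0, 1; split=> //; rewrite /sqn !cE; ring
        |exists 1, 0; split=> //; rewrite /sqn !cE; ring].
Qed.

Definition edge_vec u v e : vec := (edge_coord e).1 *: u + (edge_coord e).2 *: v.

Lemma edge_vec_gvec u v e : gvec u -> gvec v -> gvec (edge_vec u v e).
Proof. by move=> gu gv; have [? ?] := edge_coord_gauss e; apply: gvecD; exact: gvecZ. Qed.

Lemma edge_vec_primitive u v e : unimod u v -> primitive (edge_vec u v e).
Proof.
move=> [gu gv D]; have [p [q [gp gq H]]] := edge_coord_partner e.
apply: (@unimod_primitive _ _ (p *: u + q *: v)); split.
- exact: edge_vec_gvec.
- by apply: gvecD; exact: gvecZ.
- by rewrite /edge_vec dt_comb sqnM D mulr1.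
Qed.

(** Left chambers suffice: the chamber across a wall is the left chamber of another basis, as
    [neighbor] shows. *)
Lemma standard_chamber u v : unimod u v ->
  exists c : chamber R, standard_form 'i%C c o0 o1 o2 o3 u v (- (u + v)).
Proof.
move=> uv.
have [L HL] : exists L : {set 'I_4} -> laxvec R, forall e, representatives (L e) (edge_vec u v e).
  exists (fun e => sval (cid (lax_exists (edge_vec_primitive e uv)))) => e.
  exact: (svalP (cid (lax_exists (edge_vec_primitive e uv)))).
have inj e f : #|e| = 2%N -> #|f| = 2%N -> L e = L f -> e = f.
  move=> ce cf E; apply: edge_coord_inj => //.
  have := HL f; rewrite -E => /(rep_same (HL e))[t ut Et].
  have : dt (edge_vec u v e) (edge_vec u v f) = 0.
    by rewrite Et /dt !mxE; ring.
  rewrite /edge_vec dt_comb => /eqP; rewrite mulf_eq0 => /orP[/eqP //|/eqP d0].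
  by case: uv => _ _; rewrite d0 /sqn !cE expr0n addr0 => /eqP; rewrite eq_sym oner_eq0.
have adj i j k : uniq [:: i; j; k] -> lax_basis (L [set i; j]%SET) (L [set j; k]%SET).
  move=> U; apply/(lax_basisP (HL _) (HL _)); case: uv => gu gv D.
  by split; [exact: edge_vec_gvec..|rewrite dt_comb sqnM D mulr1; exact: edge_coord_adj].
have wall i j k : uniq [:: i; j; k] ->
    superbasis (L [set i; j]%SET) (L [set j; k]%SET) (L [set i; k]%SET).
  move=> U; have := U; rewrite uniq3E => /and3P[ij ik jk]; split; first exact: adj.
    by rewrite (setUC2 i k); apply: adj; rewrite uniq3E jk ![_ == i]eq_sym ij ik.
  by rewrite (setUC2 i j); apply: adj; rewrite uniq3E jk eq_sym ij ik.
exists (Chamber inj wall); split=> //=; first by rewrite addrN.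
  rewrite (setUC2 o2 o0).
  have [E1 E2 E3 [E4 E5 E6]] := edge_coordE.
  split; [have := HL [set o0; o2]%SET|have := HL [set o0; o1]%SET|have := HL [set o1; o2]%SET];
    rewrite /edge_vec ?E1 ?E2 ?E4 /= ?scale1r ?scale0r ?addr0 ?add0r // !scaleN1r.
  by rewrite opprD.
have [E1 E2 E3 [E4 E5 E6]] := edge_coordE.
split; [have := HL [set o0; o3]%SET|have := HL [set o1; o3]%SET|have := HL [set o2; o3]%SET];
  rewrite /edge_vec ?E3 ?E5 ?E6 /= ?scale1r //.
  congr (representatives _ _); apply: vec_ext; rewrite !mxE; ring.
congr (representatives _ _); apply: vec_ext; rewrite !mxE; ring.
Qed.

End StandardChamber.

(** * Gluing of chambers around a vertex *)

Section Gluing.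
Context {R : realType}.
Local Notation vec := 'cV[R[i]]_2.
Implicit Types (c : chamber R) (a b u v w x : vec) (i j k l d : 'I_4).

(** The representatives [a], [b] of two edges at [k] form an oriented basis of the lattice of [k].
    The condition on the form fixes the unit of [b] relative to [a], which the lax labels leave
    open. *)
Definition flag c k j l a b :=
  [/\ uniq [:: k; j; l], representatives (lab c [set k; j]%SET) a,
      representatives (lab c [set k; l]%SET) b & cf c k = basisform a b].

Lemma flag_exists c k j l : uniq [:: k; j; l] -> exists a b, flag c k j l a b.
Proof.
move=> U; have [d Ud] := fourth U.
have U' : uniq [:: k; l; j; d].
  move: Ud; rewrite /= !inE !negb_or => /andP[/and3P[-> -> ->] /andP[/andP[jl ->] /andP[-> _]]].
  by rewrite eq_sym jl.
have [s [u [v [w [_ std]]]]] := chamber_std c U'.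
have [EA _ _ _ _] := std_cf std.
case: std => _ _ [ru rv _] _; exists u, ('i%C *: v); split=> //.
  by rewrite setUC2.
by apply: rep_unit => //; exact: gauss_uniti.
Qed.

Lemma flag_unimod c k j l a b : flag c k j l a b -> unimod a b.
Proof.
case; rewrite uniq3E => /and3P[kj kl jl] ra rb _.
by apply: (@chamber_adj _ c j k l) => //; [rewrite uniq3E eq_sym kj jl kl|rewrite setUC2].
Qed.

Lemma flag_swap c k j l a b : flag c k j l a b -> flag c k l j b (- a).
Proof.
move=> [U ra rb E]; split => //.
- by move: U; rewrite !uniq3E (eq_sym l j) => /and3P[-> -> ->].
- exact: rep_opp.
rewrite E /basisform; apply: form_ext; fsimp; rewrite !mxE !cE; ring.
Qed.

Lemma flag_scale c k j l a b e : gauss_unit e -> flag c k j l a b ->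
  flag c k j l (e *: a) (e *: b).
Proof.
move=> ue [U ra rb E]; split=> //; [exact: rep_unit..|].
by rewrite E basisform_scale //; case/gauss_unitP: ue.
Qed.

Lemma basisform_addl a b : basisform a (b + a) = basisform a b.
Proof. by rewrite /basisform; apply: form_ext; fsimp; rewrite !mxE !cE; ring. Qed.

(** In the left chamber of [u = a], [v = - i b] the edges at one vertex carry [a], [b] and [a + b],
    a superbasis of the lattice. Its wall through [m] is what allows a shear from [b] to [b + a]. *)
Lemma flag_construct a b : unimod a b -> exists c k j l m,
  [/\ uniq [:: k; j; l; m], flag c k j l a b & flag c k j m a (b + a)].
Proof.
move=> ab; have [ga gb D] := ab.
have uv : unimod a (- 'i%C *: b).
  rewrite -[a]scale1r; apply: unimodZ => //; first exact: gauss_unit1.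
  exact/gauss_unitN/gauss_uniti.
have [c std] := standard_chamber uv; exists c, o0, o2, o1, o3.
have [EA _ _ _ _] := std_cf std.
have ii : 'i%C *: (- 'i%C *: b) = b.
  rewrite scalerA -[RHS]scale1r; congr (_ *: _); apply: cext; rewrite !cE; ring.
case: std => _ _ [ru rv rw] [rx ry rz]; rewrite ii in EA rx.
split=> //; split=> //; rewrite ?basisform_addl //.
- by rewrite setUC2.
- by rewrite -ii; apply: rep_unit => //; exact: gauss_uniti.
- by rewrite setUC2.
- by rewrite addrC.
Qed.

(* The label of the edge [j l] is determined by the form of the vertex [k] and
   the labels of [k j] and [k l]: all the gluings below are found this way. *)
Lemma flag_glue c k j l a b c' k' j' l' : flag c k j l a b -> flag c' k' j' l' a b ->
  exists (p : {perm 'I_4}) (d : 'I_4),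
    [/\ uniq [:: k; j; l; d], [/\ p k = k', p j = j' & p l = l'] &
    forall e : {set 'I_4}, #|e| = 2%N -> d \notin e -> lab c e = lab c' (p @: e)].
Proof.
move=> F F'; have ab := flag_unimod F.
case: F F' => U ra rb E [U' ra' rb' E'].
have [p [pk pj pl]] := perm3 U U'; have [d Ud] := fourth U.
exists p, d; split=> // e ce de.
have im (x y : 'I_4) : p @: [set x; y]%SET = [set p x; p y]%SET by rewrite imsetU1 imset_set1.
case: (card2_wall Ud ce de) => ->; rewrite im ?pk ?pj ?pl.
- exact: lax_eq ra ra'.
- exact: lax_eq rb rb'.
have [g rg] := rep_ex (lab c [set j; l]%SET).
have [g' rg'] := rep_ex (lab c' [set j'; l']%SET).
have ga : unimod g a.
  apply/unimodC; apply: (@chamber_adj _ c k j l) => //.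
apply: (nform_inj rg rg' ga).
have h := cf_half c U; have h' := cf_half c' U'.
move: h; rewrite E -E' h' (laxformE ra) (laxformE rb) (laxformE rg).
rewrite (laxformE ra') (laxformE rb') (laxformE rg') /half_sum.
case: (nform g) (nform g') => ? ? ? ? [? ? ? ?] [] *; apply: form_ext => /=; lra.
Qed.

Lemma flag_glued c k j l a b c' k' j' l' : flag c k j l a b -> flag c' k' j' l' a b ->
  glued (c, [set k]%SET) (c', [set k']%SET) /\
  glued (c, [set k; j]%SET) (c', [set k'; j']%SET).
Proof.
move=> F F'; have [p [d [U [pk pj pl] H]]] := flag_glue F F'.
have : uniq [:: k; j; l; d] by [].
rewrite /= !inE !negb_or => /andP[/and3P[kj kl kd] /andP[/andP[jl jd] /andP[ld _]]].
split; apply: Relation_Operators.rst_step; exists p, d; split=> //=.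
- by rewrite inE eq_sym.
- by rewrite imset_set1 pk.
- by rewrite !inE negb_or ![d == _]eq_sym kd jd.
- by rewrite imsetU1 imset_set1 pk pj.
Qed.

Lemma glued_sym (x y : cell R) : glued x y -> glued y x.
Proof. exact: Relation_Operators.rst_sym. Qed.

Lemma glued_trans (x y z : cell R) : glued x y -> glued y z -> glued x z.
Proof. exact: Relation_Operators.rst_trans. Qed.

Lemma glued_refl (x : cell R) : glued x x.
Proof. exact: Relation_Operators.rst_refl. Qed.

(** This turns around the edge labelled [a]: every chamber on the way replaces [b] by [b + a] and
    keeps both the vertex and the edge. *)
Lemma flag_chain_nat (n : nat) c k j l c' k' j' l' a b :
  flag c k j l a b -> flag c' k' j' l' a (b + n%:R *: a) ->
  glued (c, [set k]%SET) (c', [set k']%SET) /\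
  glued (c, [set k; j]%SET) (c', [set k'; j']%SET).
Proof.
elim: n c k j l b => [|n IH] c k j l b F F'.
  by rewrite scale0r addr0 in F'; exact: flag_glued F F'.
have [c1 [k1 [j1 [l1 [m1 [_ F1 F2]]]]]] := flag_construct (flag_unimod F).
have [g1 g2] := flag_glued F F1.
have E : b + n.+1%:R *: a = (b + a) + n%:R *: a.
  by rewrite -nat1r scalerDl scale1r addrA.
rewrite E in F'; have [h1 h2] := IH _ _ _ _ _ F2 F'.
by split; [exact: glued_trans g1 h1|exact: glued_trans g2 h2].
Qed.

Lemma flag_chain (n : int) c k j l c' k' j' l' a b :
  flag c k j l a b -> flag c' k' j' l' a (b + n%:~R *: a) ->
  glued (c, [set k]%SET) (c', [set k']%SET) /\
  glued (c, [set k; j]%SET) (c', [set k'; j']%SET).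
Proof.
case: n => n F F'; first exact: flag_chain_nat F F'.
have E : b = (b + (Negz n)%:~R *: a) + n.+1%:R *: a.
  by rewrite -addrA -scalerDl NegzE mulrNz pmulrn addNr scale0r addr0.
rewrite E in F; have [h1 h2] := flag_chain_nat F' F.
by split; apply: glued_sym.
Qed.

(** With [b' = x a + y b], comparing the forms at [b], [a + b] and [i a + b] gives in turn
    [Im x = 0], [Im y = 0] and [Re y = 1]; integrality of [b'] makes [x] an integer. *)
Lemma basisform_eq a b b' : unimod a b -> unimod a b' -> basisform a b = basisform a b' ->
  exists n : int, b' = b + n%:~R *: a.
Proof.
move=> [ga gb D] [_ gb' D'] E.
have d0 : dt a b * conjc (dt a b) = 1 by exact: sqn1_conj.
have := dt_decomp b' D; set x := dt b' b * _; set y := dt a b' * _ => Eb.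
have gx : x \is a gaussInt.
  by apply: gaussM; [|apply: gauss_conj]; exact: gauss_dt.
clearbody x y; have ev (z : vec) : Im (dt z b * conjc (dt a z)) = Im (dt z b' * conjc (dt a z)).
  by rewrite -!feval_basis2 -!/(basisform _ _) E.
have E1 : Im x = 0.
  have := ev b; rewrite Eb.
  have -> : dt b (x *: a + y *: b) = - x * dt a b by rewrite /dt !mxE; ring.
  have -> : dt b b = 0 by rewrite /dt; ring.
  by rewrite -mulrA d0 mulr1 mul0r !cE; lra.
have E2 : Im y = 0.
  have := ev (a + b); rewrite Eb.
  have -> : dt (a + b) (x *: a + y *: b) = (y - x) * dt a b by rewrite /dt !mxE; ring.
  have -> : dt a (a + b) = dt a b by rewrite /dt !mxE; ring.
  have -> : dt (a + b) b = dt a b by rewrite /dt !mxE; ring.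
  by rewrite -mulrA d0 mulr1 !cE; lra.
have E3 : Re y = 1.
  have := ev ('i%C *: a + b); rewrite Eb.
  have -> : dt ('i%C *: a + b) (x *: a + y *: b) = ('i%C * y - x) * dt a b.
    by rewrite /dt !mxE; ring.
  have -> : dt a ('i%C *: a + b) = dt a b by rewrite /dt !mxE; ring.
  have -> : dt ('i%C *: a + b) b = 'i%C * dt a b by rewrite /dt !mxE; ring.
  by rewrite -!mulrA d0 !mulr1 !cE; lra.
rewrite Eb; have -> : y = 1 by apply: cext; rewrite !cE.
move: gx; rewrite gaussIntE => /andP[/intrP[n En] _]; exists n.
rewrite scale1r addrC; congr (_ + _ *: _).
by apply: cext; rewrite ?En ?E1 !cE.
Qed.

(** After rescaling one flag by a unit both begin with the same vector, and the equal forms leave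
    only a shear between them. *)
Lemma same_edge_glued c k j c' k' j' : k != j -> k' != j' -> cf c k = cf c' k' ->
  lab c [set k; j]%SET = lab c' [set k'; j']%SET ->
  glued (c, [set k]%SET) (c', [set k']%SET) /\
  glued (c, [set k; j]%SET) (c', [set k'; j']%SET).
Proof.
move=> kj kj' Ef El.
have [l U] := ord4_third kj; have [l' U'] := ord4_third kj'.
have [a [b F]] := flag_exists c U; have [a' [b' F']] := flag_exists c' U'.
have [_ ra _ Ea] := F; have [_ ra' _ Ea'] := F'.
rewrite -El in ra'; have [e ue Ee] := rep_same ra' ra.
have {}F' := flag_scale ue F'; rewrite -Ee in F'.
have [_ _ _ Eb'] := F'.
have [n En] := basisform_eq (flag_unimod F) (flag_unimod F') (etrans (esym Ea) (etrans Ef Eb')).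
by rewrite En in F'; exact: flag_chain F F'.
Qed.

(** Euclid's algorithm on [(p, r)]: a quotient is a chain of shears around the edge [a], and
    [flag_swap] exchanges the two vectors. The relation [p x + r y = 1] is the carried proof of
    coprimality. *)
Lemma flag_euclid (p r : int) (x y : int) c k j l a b : p * x + r * y = 1 ->
  flag c k j l a b -> exists c' k' j' l' b',
    flag c' k' j' l' (p%:~R *: a + r%:~R *: b) b' /\ glued (c, [set k]%SET) (c', [set k']%SET).
Proof.
have [n] := ubnP `|r|%N; elim: n p r x y c k j l a b => // n IH p r x y c k j l a b rn D F.
have [r0|r0] := eqVneq r 0.
  rewrite r0 scale0r addr0.
  have p1 : p = 1 \/ p = -1.
    have : (`|p| * `|x|)%N = 1%N by rewrite -abszM; move: D; rewrite r0 mul0r addr0 => ->.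
    by move=> /eqP; rewrite muln_eq1 => /andP[/eqP h _]; lia.
  exists c, k, j, l; case: p1 => ->.
    by exists b; rewrite mulr1z scale1r; split=> //; exact: glued_refl.
  exists (- b); rewrite mulrN1z scaleN1r; split; last exact: glued_refl.
  by rewrite -scaleN1r -(scaleN1r b); apply: flag_scale => //; left; left; right.
set q := (p %/ r)%Z; set s := (p %% r)%Z.
have Ep : p = q * r + s by exact: divz_eq.
have [ga gb Dab] := flag_unimod F.
have ab' : unimod a (b + q%:~R *: a).
  split=> //; first by apply: gvecD => //; apply: gvecZ => //; exact: gauss_int.
  rewrite -Dab; congr sqn; rewrite /dt !mxE; ring.
have [c1 [k1 [j1 [l1 [_ [_ F1 _]]]]]] := flag_construct ab'.
have [g1 _] := flag_chain F F1.
(* The remainder enters with a minus sign because [flag_swap] turns [a] into [- a]. *)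
have sn : (`|(- s)%R| < n)%N.
  have h : (0 <= s < `|r|)%R by rewrite modz_ge0 // ltz_mod.
  lia.
have D' : r * (q * x + y) + (- s) * (- x) = 1.
  by rewrite -D {1}Ep; ring.
have [c2 [k2 [j2 [l2 [b2 [F2 g2]]]]]] := IH _ _ _ _ _ _ _ _ _ _ sn D' (flag_swap F1).
exists c2, k2, j2, l2, b2; split; last exact: glued_trans g1 g2.
have -> : p%:~R *: a + r%:~R *: b = r%:~R *: (b + q%:~R *: a) + (- s)%:~R *: - a; last by [].
rewrite {1}Ep; apply: vec_ext; rewrite !mxE intrD intrM mulrNz; ring.
Qed.

(** A primitive Gaussian vector on the real line is a unit times a primitive integer vector. The
    ratio of [al] and [be] being real, conjugation multiplies both by one unit [nu]: for [nu = 1] or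
    [-1] they are real up to the unit 1 or [i], and [nu = i] or [- i] contradicts primitivity. *)
Lemma gauss_real_combination (al be ga de : R[i]) : al \is a gaussInt -> be \is a gaussInt ->
  ga \is a gaussInt -> de \is a gaussInt -> sqn (al * de - be * ga) = 1 ->
  Im (al * conjc be) = 0 -> exists e (p r x y : int),
  [/\ gauss_unit e, e * al = p%:~R, e * be = r%:~R & p * x + r * y = 1].
Proof.
move=> gal gbe gga gde D I0.
have E0 : al * conjc be = conjc al * be by apply: cext; move: I0; rewrite !cE; lra.
set t := al * de - be * ga in D.
set mu := conjc al * de - conjc be * ga.
have Ea : conjc al * t = al * mu.
  rewrite /t /mu !mulrBr !mulrA; congr (_ - _); first by ring.
  by rewrite -E0; ring.
have Eb : conjc be * t = be * mu.
  rewrite /t /mu !mulrBr !mulrA; congr (_ - _); last by ring.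
  by rewrite (mulrC _ al) E0; ring.
have gmu : mu \is a gaussInt by rewrite gaussB // gaussM // gauss_conj.
have gt : t \is a gaussInt by rewrite gaussB // gaussM.
have nz : (al != 0) || (be != 0).
  rewrite -negb_and; apply/negP => /andP[/eqP a0 /eqP b0]; move: D.
  by rewrite /t a0 b0 !mul0r subrr /sqn !cE expr0n addr0 => /eqP; rewrite eq_sym oner_eq0.
have mu1 : sqn mu = 1.
  case/orP: nz => h.
    have := congr1 sqn Ea; rewrite !sqnM sqn_conj D => /(mulfI (lt0r_neq0 (sqn_gt0 h))).
    by [].
  have := congr1 sqn Eb; rewrite !sqnM sqn_conj D => /(mulfI (lt0r_neq0 (sqn_gt0 h))).
  by [].
set nu := mu * conjc t.
have unu : gauss_unit nu.
  by apply: gauss_unitM; [|apply: gauss_unit_conj]; apply/gauss_unitP.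
have Ea' : conjc al = nu * al.
  rewrite /nu -[LHS]mulr1 -(sqn1_conj D) mulrA Ea; ring.
have Eb' : conjc be = nu * be.
  rewrite /nu -[LHS]mulr1 -(sqn1_conj D) mulrA Eb; ring.
have real e : gauss_unit e -> Im (e * al) = 0 -> Im (e * be) = 0 ->
    exists e (p r x y : int),
  [/\ gauss_unit e, e * al = p%:~R, e * be = r%:~R & p * x + r * y = 1].
  move=> ue ia ib; have [ge e1] := (gauss_unitP e).1 ue.
  have := gaussM ge gal; rewrite gaussIntE => /andP[/intrP[p Ep] _].
  have := gaussM ge gbe; rewrite gaussIntE => /andP[/intrP[r Er] _].
  have Epc : e * al = p%:~R by apply: cext; rewrite !(Re_int, Im_int) ?Ep ?ia.
  have Erc : e * be = r%:~R by apply: cext; rewrite !(Re_int, Im_int) ?Er ?ib.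
  (* The real part of a Bezout identity over Z[i] is one over Z. *)
  pose z := conjc (e * t) * de; pose z' := - conjc (e * t) * ga.
  have : z * (e * al) + z' * (e * be) = 1.
    have <- : (e * t) * conjc (e * t) = 1 by apply: sqn1_conj; rewrite sqnM e1 D mulr1.
    by rewrite /z /z' /t; ring.
  have gz : z \is a gaussInt by rewrite gaussM // gauss_conj // gaussM.
  have gz' : z' \is a gaussInt by rewrite gaussM // gaussN // gauss_conj // gaussM.
  move: gz gz'; rewrite !gaussIntE => /andP[/intrP[x Ex] _] /andP[/intrP[y Ey] _].
  clearbody z z'; rewrite Epc Erc => /(congr1 (@Re R)); rewrite !cE Ex Ey !mulr0 !subr0 => /eqP.
  rewrite -!intrM -intrD -[1]/(1%:~R) eqr_int => /eqP xy.
  by exists e, p, r, x, y; split=> //; rewrite -xy; ring.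
(* For [nu = i] or [- i] both entries are real multiples of [1 - i] or [1 + i], of norm 2, so the
   determinant would have even norm. *)
have odd f : f \is a gaussInt -> sqn f = 2 -> al = f * (Re al)%:C%C ->
    be = f * (Re be)%:C%C -> False.
  move=> gf f2 Eal Ebe.
  have gr (x : R[i]) : x \is a gaussInt -> (Re x)%:C%C \is a @gaussInt R.
    by rewrite !gaussIntE => /andP[h _]; rewrite !cE h rpred0.
  have [n En] := sqn_gauss (gaussB (gaussM (gr _ gal) gde) (gaussM (gr _ gbe) gga)).
  have : sqn (f * ((Re al)%:C%C * de - (Re be)%:C%C * ga)) = 1.
    by rewrite -D /t {2}Eal {2}Ebe; congr sqn; ring.
  rewrite sqnM f2 En -natrM => /eqP; rewrite -[1]/(1%:R) eqr_nat => /eqP; lia.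
case: unu => [[[]|]|] Enu.
- apply: (real 1); first exact: gauss_unit1.
    by move: Ea' => /(congr1 (@Im R)); rewrite Enu !mul1r !cE; lra.
  by move: Eb' => /(congr1 (@Im R)); rewrite Enu !mul1r !cE; lra.
- apply: (real 'i%C); first exact: gauss_uniti.
    by move: Ea' => /(congr1 (@Re R)); rewrite Enu !cE; lra.
  by move: Eb' => /(congr1 (@Re R)); rewrite Enu !cE; lra.
- exfalso; apply: (@odd (1 - 'i%C)).
  + by rewrite gaussB ?gauss1 ?gaussi.
  + by rewrite /sqn !cE; ring.
  + by move: Ea' => /(congr1 (@Re R)); rewrite Enu !cE => h; apply: cext; rewrite !cE; lra.
  + by move: Eb' => /(congr1 (@Re R)); rewrite Enu !cE => h; apply: cext; rewrite !cE; lra.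
- exfalso; apply: (@odd (1 + 'i%C)).
  + by rewrite gaussD ?gauss1 ?gaussi.
  + by rewrite /sqn !cE; ring.
  + by move: Ea' => /(congr1 (@Re R)); rewrite Enu !cE => h; apply: cext; rewrite !cE; lra.
  + by move: Eb' => /(congr1 (@Re R)); rewrite Enu !cE => h; apply: cext; rewrite !cE; lra.
Qed.

Definition cellform (x : cell R) : option (hform R) :=
  omap (cf x.1) [pick k | x.2 == [set k]%SET].

Lemma cellform1 c k : cellform (c, [set k]%SET) = Some (cf c k).
Proof.
rewrite /cellform /=; case: pickP => [i /eqP/finset.set1_inj -> //|/(_ k)].
by rewrite eqxx.
Qed.

(** By [cf_half] the form at a vertex of a wall depends only on the three labels of that wall. *)
Lemma wall_cf c c' (p : {perm 'I_4}) d :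
  (forall e : {set 'I_4}, #|e| = 2%N -> d \notin e -> lab c e = lab c' (p @: e)) ->
  forall i, i != d -> cf c i = cf c' (p i).
Proof.
move=> H i id.
have [j U] := ord4_third id.
have [l] := fourth U.
rewrite /= !inE !negb_or => /andP[/and3P[_ ij il] /andP[/andP[dj dl] /andP[jl _]]].
have U3 : uniq [:: i; j; l] by rewrite uniq3E ij il jl.
have U3' : uniq [:: p i; p j; p l].
  by rewrite uniq3E !(inj_eq perm_inj) -uniq3E.
have im (x y : 'I_4) : [set p x; p y]%SET = p @: [set x; y]%SET by rewrite imsetU1 imset_set1.
have cd (x y : 'I_4) : x != y -> x != d -> y != d ->
    lab c [set x; y]%SET = lab c' [set p x; p y]%SET.
  move=> xy xd yd; rewrite im; apply: H; first by rewrite cards2 xy.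
  by rewrite !inE negb_or ![d == _]eq_sym xd yd.
rewrite (cf_half c U3) (cf_half c' U3') -!cd // eq_sym //.
Qed.

Lemma glue_cellform (x y : cell R) : glue x y -> cellform x = cellform y.
Proof.
case: x y => c e [c' e'] [p [d [/= H de ->]]].
have [/cards1P[i Ei]|ne] := boolP (#|e| == 1%N).
  rewrite Ei imset_set1 !cellform1 (wall_cf H) //.
  by move: de; rewrite Ei inE eq_sym.
have none (b : chamber R) (f : {set 'I_4}) : #|f| != 1%N -> cellform (b, f) = None.
  by rewrite /cellform /=; case: pickP => //= i /eqP ->; rewrite cards1.
by rewrite !none // card_imset //; exact: perm_inj.
Qed.

Lemma glued_invariant (T : Type) (F : cell R -> T) :
  (forall x y : cell R, glue x y -> F x = F y) ->
  forall x y : cell R, glued x y -> F x = F y.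
Proof. by move=> H x y; elim=> {x y} [x y /H|x|x y _ ->|x y z _ -> _ ->]. Qed.

Lemma glued_cf c k c' k' : glued (c, [set k]%SET) (c', [set k']%SET) -> cf c k = cf c' k'.
Proof. by move=> /(glued_invariant glue_cellform); rewrite !cellform1 => -[]. Qed.

Lemma glued_card (x y : cell R) : glued x y -> #|x.2| = #|y.2|.
Proof.
apply: (glued_invariant (F := fun x : cell R => #|x.2|)) => -[c e] [c' e'] [p [d [_ _ /= ->]]].
by rewrite card_imset //; exact: perm_inj.
Qed.

Lemma glued_lab (x y : cell R) : #|x.2| = 2%N -> glued x y -> lab x.1 x.2 = lab y.1 y.2.
Proof.
move=> cx xy; have cy := glued_card xy.
pose F (x : cell R) := if #|x.2| == 2%N then Some (lab x.1 x.2) else None.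
have : F x = F y.
  apply: (glued_invariant (F := F)) xy => -[c e] [c' e'] [p [d [/= H de ->]]].
  rewrite /F /= card_imset; last exact: perm_inj.
  by case: eqP => // ce; rewrite H.
by rewrite /F -cy cx /= => -[].
Qed.

(** The first vector [a'] of a flag at [k'] is isotropic for the common form, so up to a unit it is
    a primitive integer combination of [a] and [b]. Euclid's algorithm leads from [k] to a chamber
    having this edge, where [same_edge_glued] concludes. *)
Lemma same_form_glued c k c' k' : cf c k = cf c' k' ->
  glued (c, [set k]%SET) (c', [set k']%SET).
Proof.
move=> E.
have ex i : exists x y : 'I_4, uniq [:: i; x; y].
  have [x [y [d]]] := others i.
  by rewrite (cat_uniq [:: i; x; y] [:: d]) => /andP[U _]; exists x, y.
have [j [l U]] := ex k; have [j' [l' U']] := ex k'.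
have [a [b F]] := flag_exists c U; have [a' [b' F']] := flag_exists c' U'.
have [_ _ _ Ea] := F; have [_ _ _ Ea'] := F'.
have [ga gb D] := flag_unimod F; have [ga' gb' D'] := flag_unimod F'.
have := dt_decomp a' D; set al := _ * _; set be := dt a a' * _ => Ea1.
have := dt_decomp b' D; set gm := _ * _; set de := dt a b' * _ => Eb1.
have gg (x y : vec) : gvec x -> gvec y -> dt x y * conjc (dt a b) \is a gaussInt.
  by move=> gx gy; apply: gaussM; [|apply: gauss_conj]; exact: gauss_dt.
have gal : al \is a gaussInt by exact: gg.
have gbe : be \is a gaussInt by exact: gg.
have ggm : gm \is a gaussInt by exact: gg.
have gde : de \is a gaussInt by exact: gg.
clearbody al be gm de.
have D2 : sqn (al * de - be * gm) = 1.
  by have := D'; rewrite Ea1 Eb1 dt_comb sqnM D mulr1.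
have I0 : Im (al * conjc be) = 0.
  have : feval (basisform a' b') (a' 0 0) (a' 1 0) = 0.
    rewrite feval_basis2 [a' 0 0 * a' 1 0]mulrC subrr.
    by rewrite !cE; ring.
  rewrite -Ea' -E Ea feval_basis2 -!/(dt _ _) Ea1.
  have -> : dt (al *: a + be *: b) b = al * dt a b by rewrite /dt !mxE; ring.
  have -> : dt a (al *: a + be *: b) = be * dt a b by rewrite /dt !mxE; ring.
  by rewrite conjcM mulrACA (sqn1_conj D) mulr1.
have [e [p [r [x [y [ue Ep Er xy]]]]]] := gauss_real_combination gal gbe ggm gde D2 I0.
have [c1 [k1 [j1 [l1 [b1 [F1 g1]]]]]] := flag_euclid xy F.
apply: (glued_trans g1).
have Eea : p%:~R *: a + r%:~R *: b = e *: a' by rewrite Ea1 scalerDr !scalerA Ep Er.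
rewrite Eea in F1.
have F2 := flag_scale ue F'.
have U1 : k1 != j1 by case: F1; rewrite uniq3E => /and3P[].
have U2 : k' != j' by case: F2; rewrite uniq3E => /and3P[].
suff : cf c1 k1 = cf c' k'.
  move=> Ec; have [] // := same_edge_glued U1 U2 Ec.
  by case: F1 F2 => _ r1 _ _ [_ r2 _ _]; exact: lax_eq r1 r2.
by rewrite -E (glued_cf g1).
Qed.

End Gluing.

(** * Descartes quadruples of forms and reduced words of swaps *)

Section Quadruples.
Context {R : realType}.
Implicit Types (f g : 'I_4 -> hform R) (h y z : hform R) (i j k : 'I_4).

Definition gram f := forall i j, bil (f i) (f j) = if i == j then 1 else -1.

Lemma sum4 (F : 'I_4 -> R) i j k d : uniq [:: i; j; k; d] ->
  \sum_l F l = F i + F j + F k + F d.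
Proof.
have -> : \sum_l F l = F o0 + F o1 + F o2 + F o3.
  rewrite !big_ord_recl big_ord0 addr0 !addrA.
  by congr (F _ + F _ + F _ + F _); apply: val_inj.
by case: (ord4P i) => ->; case: (ord4P j) => -> //; case: (ord4P k) => -> //;
  case: (ord4P d) => -> // _; ring.
Qed.

Lemma sum4E (F : 'I_4 -> R) : \sum_l F l = F o0 + F o1 + F o2 + F o3.
Proof. exact: sum4. Qed.

Definition coords h : 'rV[R]_4 := \row_j nth 0 [:: fa h; fd h; fx h; fy h] j.
Definition dual_coords h : 'cV[R]_4 :=
  \col_j nth 0 [:: - 2 * fd h; - 2 * fa h; fx h; fy h] j.

Lemma bil_coords h y : (coords h *m dual_coords y) 0 0 = bil h y.
Proof. by rewrite mxE sum4E !mxE /= /bil; ring. Qed.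

Lemma gram_nondeg f z : gram f -> (forall i, bil z (f i) = 0) -> z = Form 0 0 0 0.
Proof.
move=> G Z.
pose F : 'M[R]_4 := \matrix_(i, j) coords (f i) 0 j.
pose D : 'M[R]_4 := \matrix_(j, i) dual_coords (f i) j 0.
(* The Gram matrix is [2 I - J] with [J] the all-ones matrix; as [J^2 = 4 J], its inverse is
   [I / 2 - J / 4]. *)
pose H : 'M[R]_4 := \matrix_(i, j) ((i == j)%:R / 2 - 1 / 4).
have FD i j : (F *m D) i j = if i == j then 1 else -1.
  by rewrite -G -bil_coords !mxE; apply: eq_bigr => l _; rewrite !mxE.
have HFD : H *m F *m D = 1%:M.
  rewrite -mulmxA; apply/matrixP => i j; rewrite mxE sum4E !FD !mxE.
  by case: (ord4P i) => ->; case: (ord4P j) => -> /=; field.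
have zD : coords z *m D = 0.
  apply/matrixP => i j; rewrite ord1 [RHS]mxE -(Z j) -bil_coords !mxE.
  by apply: eq_bigr => l _; rewrite !mxE.
have [_ uD] := mulmx1_unit HFD.
have z0 : coords z = 0 by rewrite -(mulmxK uD (coords z)) zD mul0mx.
have c i : coords z 0 i = 0 by rewrite z0 mxE.
apply: form_ext; [have := c o0|have := c o1|have := c o2|have := c o3]; by rewrite mxE.
Qed.

Lemma gram_ext f y z : gram f -> (forall i, bil y (f i) = bil z (f i)) -> y = z.
Proof.
move=> G E.
have : fadd y (fscale (-1) z) = Form 0 0 0 0.
  by apply: (gram_nondeg G) => i; rewrite bilDl bilZl E; ring.
by case=> *; apply: form_ext; lra.
Qed.

Definition fsum f : hform R :=
  Form (\sum_i fa (f i)) (\sum_i fd (f i)) (\sum_i fx (f i)) (\sum_i fy (f i)).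

Lemma bil_fsum f h : bil (fsum f) h = \sum_i bil (f i) h.
Proof. by rewrite /bil /= !sum4E; ring. Qed.

(* The other circle tangent to the three circles [f i], [i != k]. *)
Definition swapf k f : 'I_4 -> hform R :=
  fun j => if j == k then fadd (fscale 2 (fsum f)) (fscale (-3) (f k)) else f j.

Lemma swapf_neq k f j : j != k -> swapf k f j = f j.
Proof. by rewrite /swapf => /negbTE ->. Qed.

Lemma bil_swapf k f h : bil (swapf k f k) h = 2 * \sum_i bil (f i) h - 3 * bil (f k) h.
Proof. by rewrite /swapf eqxx bilDl !bilZl bil_fsum; ring. Qed.

Lemma gram_sum f j : gram f -> \sum_i bil (f i) (f j) = -2.
Proof. by move=> G; rewrite sum4E !G; case: (ord4P j) => -> /=; ring. Qed.

Lemma gram_swapf k f : gram f -> gram (swapf k f).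
Proof.
move=> G i j.
have off l : l != k -> bil (swapf k f k) (f l) = -1.
  by move=> lk; rewrite bil_swapf gram_sum // G eq_sym (negbTE lk); ring.
have diag : bil (swapf k f k) (swapf k f k) = 1.
  rewrite bil_swapf.
  have e l : bil (f l) (swapf k f k) = 2 * (-2) - 3 * bil (f l) (f k).
    by rewrite bilC bil_swapf gram_sum // (bilC (f k)).
  by rewrite sum4E !e !G; case: (ord4P k) => -> /=; ring.
have [->|ik] := eqVneq i k; have [->|jk] := eqVneq j k; rewrite ?eqxx //.
- by rewrite (swapf_neq f jk) off // eq_sym (negbTE jk).
- by rewrite (swapf_neq f ik) bilC off // (negbTE ik).
- by rewrite !swapf_neq.
Qed.

Lemma swapfK k f : swapf k (swapf k f) = f.
Proof.
apply/funext => j; rewrite {1}/swapf; case: eqP => [->|/eqP jk]; last by rewrite swapf_neq.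
apply: form_ext; rewrite /fsum /swapf; fsimp; rewrite !sum4E;
  case: (ord4P k) => -> /=; fsimp; rewrite ?sum4E; ring.
Qed.

Lemma swapf_perm k f (s : {perm 'I_4}) j :
  swapf k (fun i => f (s i)) j = swapf (s k) f (s j).
Proof.
rewrite /swapf (inj_eq perm_inj); case: eqP => // _; congr (fadd (fscale 2 _) _).
by rewrite /fsum; congr Form; rewrite [RHS](reindex_inj (@perm_inj _ s)).
Qed.

(** Prescribing [bil] with three forms confines [y] to the line through the two candidates, and norm
    1 then reads [16 t (t - 1) = 0]. *)
Lemma gram_complete f k y : gram f -> bil y y = 1 ->
  (forall j, j != k -> bil y (f j) = -1) -> y = f k \/ y = swapf k f k.
Proof.
move=> G y1 yf.
(* Pairing with [f k] gives 1 at [f k] and [-7] at the swapped form, hence [1 - 8 t] in between. *)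
pose t := (1 - bil y (f k)) / 8.
have Ey : y = fadd (fscale (1 - t) (f k)) (fscale t (swapf k f k)).
  apply: (gram_ext G) => j; rewrite bilDl !bilZl bil_swapf gram_sum // G.
  by have [<-|kj] := eqVneq k j; [rewrite /t; field|rewrite yf 1?eq_sym //; field].
have : t * (t - 1) = 0.
  have := y1; rewrite Ey bilDl !bilDr !bilZl !bilZr.
  have G' := gram_swapf k G.
  have e : bil (f k) (swapf k f k) = -7.
    by rewrite bilC bil_swapf gram_sum // G eqxx; ring.
  rewrite (bilC (swapf k f k) (f k)) e G G' eqxx; lra.
move=> /eqP; rewrite mulf_eq0 subr_eq0 => /orP[]/eqP Et; [left|right];
  by rewrite Ey Et; apply: form_ext; fsimp; ring.
Qed.

(* Quadruples reached by a reduced word of swaps; the option is its last letter. *)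
Inductive red (f0 : 'I_4 -> hform R) : ('I_4 -> hform R) -> option 'I_4 -> Prop :=
| red0 : red f0 f0 None
| redS f o k : red f0 f o -> o <> Some k -> red f0 (swapf k f) (Some k).

(** A repeated letter cancels, since a swap is an involution. *)
Lemma red_swap f0 f o k : red f0 f o -> exists o', red f0 (swapf k f) o'.
Proof.
move=> H; have [ok|ok] := pselect (o = Some k); last by exists (Some k); apply: redS H ok.
case: H ok => [//|f1 o1 k1 H1 _ [->]].
by exists o1; rewrite swapfK.
Qed.

Lemma red_gram f0 f o : gram f0 -> red f0 f o -> gram f.
Proof. by move=> G; elim=> {f o} // f o k _ IH _; exact: gram_swapf. Qed.

Section Growth.
Variable f0 : 'I_4 -> hform R.
Hypothesis G : gram f0.
Variable i : 'I_4.

Let b f j := - bil (f j) (f0 i).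

(** The clause on pairs tolerates the value [-1], taken by [f0 i] itself, as long as it occurs once
    and the other values are at least 1. The last letter holds the maximum. *)
Definition growth f o : Prop :=
  if o is Some m then
    [/\ forall j, b f j <= b f m, 1 <= b f m,
        forall j j', j != j' -> 0 <= b f j + b f j' &
        forall j, f j = f0 i \/ 1 <= b f j]
  else f = f0.

Lemma b_swap k f : b (swapf k f) k = 2 * \sum_l b f l - 3 * b f k.
Proof. by rewrite /b bil_swapf sumrN; ring. Qed.

Lemma b0 j : b f0 j = if j == i then -1 else 1.
Proof. by rewrite /b G; case: eqP => // _; rewrite opprK. Qed.

Lemma b_neq k f j : j != k -> b (swapf k f) j = b f j.
Proof. by rewrite /b => /(swapf_neq f) ->. Qed.

Lemma ord4_pair k m : m != k -> exists p q, uniq [:: k; m; p; q].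
Proof.
rewrite eq_sym => /ord4_third[p U].
by have [q] := fourth U; exists p, q.
Qed.

(** The next letter [k] differs from the last letter [m], so the new value
    [2 (b_m + b_p + b_q) - b_k] is at least [b_m], by [b_p + b_q >= 0] and [b_k <= b_m]. From the
    start, with values [-1, 1, 1, 1], the first swap yields 7 if it replaces [f0 i] and 1
    otherwise. *)
Lemma growthP f o : red f0 f o -> growth f o.
Proof.
elim=> {f o} // f [m|] k _; last first.
  move=> /= Ef _; rewrite Ef {f Ef}.
  have bk : b (swapf k f0) k = if k == i then 7 else 1.
    rewrite b_swap sum4E !b0; case: (ord4P k) (ord4P i) => -> [] -> /=; ring.
  have bj j : j != k -> b (swapf k f0) j = if j == i then -1 else 1.
    by move=> jk; rewrite b_neq // b0.
  have v j : b (swapf k f0) j = if j == k then (if k == i then 7 else 1) else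
     if j == i then -1 else 1 by case: eqP => [->|/eqP/bj].
  split.
  - move=> j; rewrite !v eqxx; do ![case: eqP => _]; lra.
  - rewrite !v eqxx; do ![case: eqP => _]; lra.
  - move=> j j' jj'; rewrite !v; have [Ej|_] := eqVneq j k; have [Ej'|_] := eqVneq j' k.
    + by move: jj'; rewrite Ej Ej' eqxx.
    + by do ![case: eqP => _]; lra.
    + by do ![case: eqP => _]; lra.
    + have [Ei|_] := eqVneq j i; have [Ei'|_] := eqVneq j' i; try lra.
      by move: jj'; rewrite Ei Ei' eqxx.
  - move=> j; have [->|jk] := eqVneq j k; first by right; rewrite bk; case: eqP => _; lra.
    have [ji|ji] := eqVneq j i; first by left; rewrite swapf_neq // ji.
    by right; rewrite bj // (negbTE ji).
move=> [le m1 pairs dich] mk.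
have {}mk : m != k by apply/eqP => E; apply: mk; rewrite E.
have [p [q U]] := ord4_pair mk.
have pq : 0 <= b f p + b f q.
  apply: pairs; move: U; rewrite /= !inE !negb_or.
  by move=> /andP[_ /andP[_ /andP[-> _]]].
have bk : b (swapf k f) k = 2 * (b f m + b f p + b f q) - b f k.
  by rewrite b_swap (sum4 _ U); ring.
have lek := le k.
have km : b f m <= b (swapf k f) k by rewrite bk; lra.
split.
- move=> j; have [->//|jk] := eqVneq j k.
  by rewrite b_neq //; apply: le_trans km.
- exact: le_trans km.
- move=> j j' jj'; wlog jk : j j' jj' / j' != k.
    move=> W; have [E|] := eqVneq j' k; last exact: W.
    rewrite addrC; apply: W; first by rewrite eq_sym.
    by rewrite -E.
  rewrite (b_neq f jk); have [->|jk'] := eqVneq j k; last by rewrite b_neq // pairs.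
  have [->|jm] := eqVneq j' m; first by lra.
  by have := pairs _ _ jm; lra.
- move=> j; have [->|jk] := eqVneq j k; first by right; lra.
  by rewrite b_neq // swapf_neq.
Qed.

Lemma red_separated f o j : red f0 f o -> f j = f0 i \/ bil (f j) (f0 i) <= -1.
Proof.
move=> /growthP; case: o => [m [_ _ _ /(_ j)]|/= ->]; rewrite /b.
  by case=> [->|]; [left|right; lra].
have [->|ji] := eqVneq j i; first by left.
by right; rewrite G (negbTE ji).
Qed.

(* The value [-1] is attained by a new circle only if [f0 i] is one of the
   three circles it is tangent to. *)
Lemma red_new_tangent f o k : red f0 f o -> o <> Some k ->
  bil (swapf k f k) (f0 i) = -1 -> exists2 p, p != k & f p = f0 i.
Proof.
move=> /growthP; case: o => [m [le m1 pairs dich] mk|/= -> _]; last first.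
  have [->|ki] := eqVneq k i; last by exists i; rewrite // eq_sym.
  by rewrite bil_swapf gram_sum // G eqxx; lra.
have {}mk : m != k by apply/eqP => E; apply: mk; rewrite E.
have [p [q U]] := ord4_pair mk.
move=> E; have bk : b (swapf k f) k = 1 by rewrite /b E opprK.
move: bk; rewrite b_swap (sum4 _ U) => bk; have lek := le k.
have : uniq [:: k; m; p; q] by [].
rewrite /= !inE !negb_or => /andP[/and3P[_ kp kq] /andP[_ /andP[npq _]]].
have pq := pairs _ _ npq.
case: (dich p) => [Ep|p1]; first by exists p; rewrite // eq_sym.
case: (dich q) => [Eq|q1]; first by exists q; rewrite // eq_sym.
lra.
Qed.

End Growth.

(** At the moment when [f j] was created, [red_new_tangent] finds [f0 i0] and [f0 i1] among the
    three forms left in place. The case [i0 = i1] serves for pairs. *)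
Lemma red_tangent_triple f0 f o i0 i1 j : gram f0 -> red f0 f o ->
  bil (f j) (f0 i0) = -1 -> bil (f j) (f0 i1) = -1 ->
  exists f' o' j0 j1 j2, [/\ red f0 f' o', f' j0 = f0 i0, f' j1 = f0 i1 & f' j2 = f j].
Proof.
move=> G; elim=> {f o} [|f o k H IH ok] E0 E1.
  by exists f0, None, i0, i1, j; split=> //; exact: red0.
have [Ej|jk] := eqVneq j k; last by move: E0 E1; rewrite !swapf_neq //; exact: IH.
rewrite Ej in E0 E1 *.
have [p0 p0k Ep0] := red_new_tangent G H ok E0.
have [p1 p1k Ep1] := red_new_tangent G H ok E1.
exists (swapf k f), (Some k), p0, p1, k; split=> //; [exact: (redS H ok)|by rewrite swapf_neq..].
Qed.

End Quadruples.

(** * Components of the kingdom and the map to circles *)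

Section Kingdom.
Context {R : realType}.
Implicit Types (c : chamber R) (i j k d : 'I_4) (x y : kvertex R).

Lemma kcell_ext n (x y : kcell R n) : cells x = cells y -> x = y.
Proof.
case: x y => [s p] [s' p'] /= E; subst s'; congr KCell; exact: Prop_irrelevance.
Qed.

Definition vtx c k : kvertex R :=
  KCell (ex_intro2 _ _ (c, [set k]%SET) (cards1 k) erefl).

Lemma vtxP x : exists c k, x = vtx c k.
Proof.
have [[c e] /= /eqP/cards1P[k ->] E] := kcellP x.
by exists c, k; apply: kcell_ext.
Qed.

Lemma cells_vtx c k c' k' : cells (vtx c k) (c', [set k']%SET) <->
  vtx c' k' = vtx c k.
Proof.
split=> [g|E]; last first.
  have : cells (vtx c' k') (c', [set k']%SET) by exact: glued_refl.
  by rewrite E.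
apply: kcell_ext; apply/seteqP; split=> z /= h; first exact: glued_trans g h.
exact: glued_trans (glued_sym g) h.
Qed.

(** Vertices are compared through their forms from here on. *)
Lemma vtx_eq c k c' k' : vtx c k = vtx c' k' <-> cf c k = cf c' k'.
Proof.
split=> [/cells_vtx h|E]; first exact/esym/(glued_cf h).
exact/cells_vtx/same_form_glued/esym.
Qed.

Lemma chamber_joins c i j : i != j -> exists e, joins e (vtx c i) (vtx c j).
Proof.
move=> ij; have c2 : #|[set i; j]%SET| = 2%N by rewrite cards2 ij.
exists (KCell (ex_intro2 _ _ (c, [set i; j]%SET) c2 erefl)), c, i, j.
by split=> //=; exact: glued_refl.
Qed.

Lemma chamber_kconnected c i j : kconnected (vtx c i) (vtx c j).
Proof.
have [->|ij] := eqVneq i j; first exact: Relation_Operators.rst_refl.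
exact/Relation_Operators.rst_step/chamber_joins.
Qed.

Lemma kconnected_trans x y (z : kvertex R) :
  kconnected x y -> kconnected y z -> kconnected x z.
Proof. exact: Relation_Operators.rst_trans. Qed.

Lemma cf_gram c : gram (cf c).
Proof.
move=> i j; have [->|ij] := eqVneq i j; first exact: cf_norm.
exact: cf_bil.
Qed.

(** An invariant of connectedness: the quadruple of [c'] is, up to the numbering [s] of its
    vertices, obtained from that of [c] by a reduced word. *)
Definition reach c c' := exists f o (s : {perm 'I_4}),
  red (cf c) f o /\ forall i, cf c' i = f (s i).

Lemma reach_refl c : reach c c.
Proof. by exists (cf c), None, 1%g; split=> [|i]; [exact: red0|rewrite perm1]. Qed.

(** Three forms are shared, so by [gram_complete] the fourth is either the same, when the quadruples
    agree, or the swapped one. *)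
Lemma reach_wall c c1 c2 (p : {perm 'I_4}) d : reach c c1 ->
  (forall e : {set 'I_4}, #|e| = 2%N -> d \notin e -> lab c1 e = lab c2 (p @: e)) ->
  reach c c2.
Proof.
move=> [f [o [s [H E]]]] /wall_cf W.
have G := red_gram (cf_gram c) H.
have E2 m : m != p d -> cf c2 m = f (s (p^-1 m))%g.
  move=> md; rewrite -E W ?permKV //; apply: contra md => /eqP <-.
  by rewrite permKV.
have := @gram_complete _ f (s d) (cf c2 (p d)) G (cf_norm _ _).
case=> [j jd|Ed|Ed].
- have -> : f j = cf c2 (p (s^-1 j)%g).
    by rewrite E2 ?permK ?permKV // (inj_eq perm_inj); apply: contra jd => /eqP <-; rewrite permKV.
  apply: cf_bil; rewrite (inj_eq perm_inj); apply: contra jd => /eqP ->; by rewrite permKV.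
- exists f, o, (p^-1 * s)%g; split=> // m; rewrite permM.
  by have [->|md] := eqVneq m (p d); [rewrite permK|exact: E2].
have [o' H'] := red_swap (s d) H.
exists (swapf (s d) f), o', (p^-1 * s)%g; split=> // m; rewrite permM.
have [->|md] := eqVneq m (p d); first by rewrite permK.
rewrite swapf_neq ?E2 // (inj_eq perm_inj); apply: contra md => /eqP <-; by rewrite permKV.
Qed.

Lemma wall_sym c1 c2 (p : {perm 'I_4}) d :
  (forall e : {set 'I_4}, #|e| = 2%N -> d \notin e -> lab c1 e = lab c2 (p @: e)) ->
  forall e : {set 'I_4}, #|e| = 2%N -> p d \notin e -> lab c2 e = lab c1 (p^-1%g @: e).
Proof.
move=> H e ce de; rewrite H; first 1 last.
- by rewrite card_imset //; exact: perm_inj.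
- apply: contra de => /imsetP[z ze ->]; by rewrite permKV.
by rewrite -imset_comp (eq_imset _ (permKV p)) imset_id.
Qed.

Lemma glued_reach c (x y : cell R) : glued x y -> reach c x.1 = reach c y.1.
Proof.
apply: (glued_invariant (F := fun x : cell R => reach c x.1)).
move=> {x y} [c1 e1] [c2 e2] [p [d [/= H _ _]]]; apply/propext; split=> h.
  exact: reach_wall h H.
exact: reach_wall h (wall_sym H).
Qed.

Lemma kconnected_reach c k c' k' : kconnected (vtx c k) (vtx c' k') -> reach c c'.
Proof.
(* Quantifying over all chambers at [x] makes the predicate independent of the chamber that
   represents [x]. *)
pose G x := forall c1 k1, cells x (c1, [set k1]%SET) -> reach c c1.
suff inv x y : kconnected x y -> G x = G y.
  move=> /inv E; have : G (vtx c k).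
    by move=> c1 k1 /(glued_reach c) /= <-; exact: reach_refl.
  by rewrite E => /(_ c' k'); apply; exact: glued_refl.
elim=> {x y} [x y [e [c1 [i [j [ij _ xi yj]]]]]|x|x y _ ->|x y z _ -> _ ->] //.
have one z m : cells z (c1, [set m]%SET) -> G z = reach c c1.
  have [c2 [m2 ->]] := vtxP z => h; apply/propext; split=> [g|r c3 k3 h3]; first exact: g h.
  rewrite -(glued_reach c (glued_trans (glued_sym h) h3)) //.
by rewrite (one _ _ xi) (one _ _ yj).
Qed.

Lemma flag_match c k j l d a b c' k' j' l' d' : flag c k j l a b -> flag c' k' j' l' a b ->
  uniq [:: k; j; l; d] -> uniq [:: k'; j'; l'; d'] ->
  exists p : {perm 'I_4}, [/\ [/\ p k = k', p j = j', p l = l' & p d = d'],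
    forall i, i != d -> cf c i = cf c' (p i) & forall i, i != d -> vtx c i = vtx c' (p i)].
Proof.
move=> F F' U U'; have [p [d1 [U1 [pk pj pl] H]]] := flag_glue F F'.
have Ed : d1 = d.
  move: U; rewrite /= !inE !negb_or => /andP[/and3P[_ _ kd] /andP[/andP[_ jd] /andP[ld _]]].
  case: (uniq4_cover d U1) => E //; first by rewrite E eqxx in kd.
    by rewrite E eqxx in jd.
  by rewrite E eqxx in ld.
subst d1; have W := wall_cf H.
exists p; split=> // [|i id]; last by apply/vtx_eq; exact: W.
split=> //; move: U; rewrite /= !inE !negb_or.
move=> /andP[/and3P[_ _ kd] /andP[/andP[_ jd] /andP[ld _]]].
case: (uniq4_cover (p d) U') => //.
- by rewrite -pk => /perm_inj E; rewrite E eqxx in kd.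
- by rewrite -pj => /perm_inj E; rewrite E eqxx in jd.
- by rewrite -pl => /perm_inj E; rewrite E eqxx in ld.
Qed.

(** The flags [(a, b)] and [(b, - a)] each give a left chamber on the wall opposite to [d]. If both
    had the old fourth form, then [|det (a + b, .)|^2] and [|det (b - a, .)|^2] would agree, but the
    determinant of these vectors has norm 4. *)
Lemma neighbor c d : exists c' (p : {perm 'I_4}),
  (forall i, i != d -> vtx c i = vtx c' (p i)) /\
  (forall i, cf c' (p i) = swapf d (cf c) i).
Proof.
have [k [j [l U0]]] := others d.
have U : uniq [:: k; j; l; d].
  by rewrite -(rot_uniq 1) in U0.
have U3 : uniq [:: k; j; l] by move: U; rewrite (cat_uniq [:: k; j; l] [:: d]) => /andP[].
have [a [b F]] := flag_exists c U3; have ab := flag_unimod F.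
have [c1 [k1 [j1 [l1 [m1 [U1 F1 F1']]]]]] := flag_construct ab.
have ba : unimod b (- a).
  rewrite -scaleN1r -[b]scale1r; apply: unimodZ; last exact: unimodC.
    exact: gauss_unit1.
  by left; left; right.
have [c2 [k2 [j2 [l2 [m2 [U2 F2 F2']]]]]] := flag_construct ba.
have {}F2 : flag c2 k2 l2 j2 a b.
  have /flag_swap := F2 => /(flag_scale (gauss_unitN (gauss_unit1 (R := R)))).
  by rewrite !scaleN1r !opprK.
have {}U2 : uniq [:: k2; l2; j2; m2].
  move: U2; rewrite /= !inE !negb_or (eq_sym l2 j2).
  by move=> /andP[/and3P[-> -> ->] /andP[/andP[-> ->] /andP[-> _]]].
have [p1 [[pk1 _ _ pd1] W1 V1]] := flag_match F F1 U U1.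
have [p2 [[pk2 _ _ pd2] W2 V2]] := flag_match F F2 U U2.
have comp c' (p : {perm 'I_4}) : (forall i, i != d -> cf c i = cf c' (p i)) ->
    cf c' (p d) = cf c d \/ cf c' (p d) = swapf d (cf c) d.
  move=> W; apply: gram_complete; [exact: cf_gram|exact: cf_norm|].
  by move=> i id; rewrite W // cf_bil // (inj_eq perm_inj) eq_sym.
have fin c' (p : {perm 'I_4}) : (forall i, i != d -> cf c i = cf c' (p i)) ->
    cf c' (p d) = swapf d (cf c) d -> forall i, cf c' (p i) = swapf d (cf c) i.
  by move=> W Ed i; have [->//|id] := eqVneq i d; rewrite swapf_neq // W.
case: (comp _ _ W1) => E1; last by exists c1, p1; split=> //; exact: fin.
case: (comp _ _ W2) => E2; last by exists c2, p2; split=> //; exact: fin.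
exfalso.
have kd : k != d.
  by move: U; rewrite /= !inE !negb_or => /andP[/and3P[_ _ ->]].
have s1 : fadd (cf c k) (cf c d) = nform (b + a).
  rewrite -E1 W1 // cfP ?(inj_eq perm_inj) // pk1 pd1.
  by case: F1' => _ _ h _; exact: laxformE.
have s2 : fadd (cf c k) (cf c d) = nform (- a + b).
  rewrite -E2 W2 // cfP ?(inj_eq perm_inj) // pk2 pd2.
  by case: F2' => _ _ h _; exact: laxformE.
have : bil (nform (b + a)) (nform (- a + b)) = 0 by rewrite -s2 s1 bil_nullnull.
rewrite bil_nform; have -> : dt (b + a) (- a + b) = 2 * dt a b by rewrite /dt !mxE; ring.
rewrite sqnM; case: ab => _ _ ->.
have -> : sqn (2 : R[i]) = 4 by rewrite -[2]/(1 + 1) /sqn !cE; ring.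
lra.
Qed.

(** Each letter crosses one wall, and the three vertices of that wall keep the walk in one
    component. *)
Lemma red_realized c f o : red (cf c) f o -> exists c' (s : {perm 'I_4}),
  (forall i, cf c' i = f (s i)) /\ forall i j, kconnected (vtx c i) (vtx c' j).
Proof.
elim=> {f o} [|f o k _ [c' [s [E K]]] _].
  by exists c, 1%g; split=> [i|i j]; [rewrite perm1|exact: chamber_kconnected].
have [c2 [p [V S]]] := neighbor c' (s^-1 k)%g.
exists c2, (p^-1 * s)%g; split=> [i|i j].
  rewrite permM -{1}(permKV p i) S.
  have -> : cf c' = fun i => f (s i) by apply/funext.
  by rewrite swapf_perm permKV.
have [m md] : exists m, m != (s^-1 k)%g.
  have [m [? [? /= /andP[h _]]]] := others (s^-1 k)%g.
  by exists m; move: h; rewrite !inE !negb_or eq_sym => /andP[].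
apply: (kconnected_trans (K i m)); rewrite V //; exact: chamber_kconnected.
Qed.

Lemma vtx_form_ex x : exists K : ocircle R, exists c k, x = vtx c k /\ cform K = cf c k.
Proof.
have [c [k ->]] := vtxP x; have [K EK] := cform_surj (cf_norm c k).
by exists K, c, k.
Qed.

Definition kphi x : ocircle R := sval (cid (vtx_form_ex x)).

Lemma kphiE c k : cform (kphi (vtx c k)) = cf c k.
Proof.
rewrite /kphi; case: (cid _) => K /= [c' [k' [E ->]]].
exact/esym/vtx_eq.
Qed.

Lemma kphi_inj : injective kphi.
Proof.
move=> x y; have [c [k ->]] := vtxP x; have [c' [k' ->]] := vtxP y => E.
by apply/vtx_eq; rewrite -!kphiE E.
Qed.

Lemma row_mx_col0 (a b : 'cV[R[i]]_2) (i : 'I_2) : (row_mx a b : 'M[R[i]]_2) i 0 = a i 0.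
Proof.
have -> : (0 : 'I_2) = lshift 1 (0 : 'I_1) by apply: val_inj.
exact: (row_mxEl a b i 0).
Qed.

Lemma row_mx_col1 (a b : 'cV[R[i]]_2) (i : 'I_2) : (row_mx a b : 'M[R[i]]_2) i 1 = b i 0.
Proof.
have -> : (1 : 'I_2) = rshift 1 (0 : 'I_1) by apply: val_inj.
exact: (row_mxEr a b i 0).
Qed.

Lemma mobius_basis (a b : 'cV[R[i]]_2) K : unimod a b ->
  mobius_image (row_mx a b) real_line K <-> cform K = basisform a b.
Proof.
move=> [_ _ D].
have := @mobius_imageP R (row_mx a b) _ K.
by rewrite !row_mx_col0 !row_mx_col1; apply.
Qed.

Lemma chamber_vertex_label_form c k a b : chamber_vertex_label c k (lax_lattice a b) ->
  cf c k = basisform a b.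
Proof.
move=> [s [A [B [C [D [u [v [w [_ std H]]]]]]]]].
have [EA EB EC ED ED'] := std_cf std.
case: H => [[-> /lax_lattice_form ->]|[-> /lax_lattice_form ->]|[-> /lax_lattice_form ->]|] //.
by case=> -> [[/ED -> /lax_lattice_form ->]|[/ED' -> /lax_lattice_form ->]].
Qed.

Lemma kphi_is_Phi : is_Phi kphi.
Proof.
move=> x K; split=> [<-|[a [b [/gauss_basisP ab [c [k [xck /chamber_vertex_label_form E]]]]]]].
  have [c [k ->]] := vtxP x.
  have [j [l [d U]]] := others k.
  have [s [u [v [w [si std]]]]] := chamber_std c U.
  have [EA _ _ _ _] := std_cf std.
  have uv : unimod u ('i%C *: v).
    case: (std) => U4 _ [ru rv _] _.
    rewrite -[u]scale1r; apply: unimodZ; [exact: gauss_unit1|exact: gauss_uniti|].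
    apply: chamber_adj ru rv; move: U4.
    by rewrite uniq3E /= !inE !negb_or => /andP[/and3P[kj kl kd] /andP[/andP[jl jd] _]];
      rewrite eq_sym kl eq_sym jl.
  exists u, ('i%C *: v); split; first exact/gauss_basisP.
    exists c, k; split; first exact: glued_refl.
    by exists s, k, j, l, d, u, v, w; split=> //; constructor 1.
  by apply/mobius_basis => //; rewrite kphiE.
move=> /(mobius_basis K ab) EK.
apply: cform_inj; rewrite EK -E.
have [c0 [k0 Ex]] := vtxP x; rewrite Ex in xck *.
by rewrite kphiE; apply/vtx_eq/esym/cells_vtx.
Qed.

Lemma det_mx2 (M : 'M[R[i]]_2) : \det M = M 0 0 * M 1 1 - M 1 0 * M 0 1.
Proof.
rewrite (expand_det_row _ 0) !big_ord_recl big_ord0 addr0 /cofactor !det_mx11 !mxE /=.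
rewrite expr0 expr1 mul1r mulN1r mulrN [M 1 0 * _]mulrC.
by congr (_ * M _ _ - M _ _ * M _ _); apply: val_inj.
Qed.

Lemma gaussian_circleP (K : ocircle R) : gaussian_circle K <->
  exists a b, unimod a b /\ cform K = basisform a b.
Proof.
split=> [[M [/mxOverP gM uM mK]]|[a [b [ab EK]]]].
  have Ed : \det M = M 0 0 * M 1 1 - M 1 0 * M 0 1 by exact: det_mx2.
  have D : sqn (M 0 0 * M 1 1 - M 1 0 * M 0 1) = 1.
    by rewrite -Ed; case/gauss_unitP: uM.
  exists (\col_i M i 0), (\col_i M i 1).
  rewrite /unimod /gvec /dt /basisform !mxE; split; first by split; [split; exact: gM..|].
  exact/(mobius_imageP D).
have [[ga1 ga2] [gb1 gb2] D] := ab.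
exists (row_mx a b); split; last exact/mobius_basis.
  apply/mxOverP => i j; case: (ord2P i) => ->; case: (ord2P j) => ->;
    by rewrite ?row_mx_col0 ?row_mx_col1.
apply/gauss_unitP; rewrite det_mx2 !row_mx_col0 !row_mx_col1; split.
  by rewrite gaussB // gaussM.
by rewrite -D /dt; congr sqn; ring.
Qed.

Lemma kphi_bij : set_bij [set: kvertex R] gaussian_circle kphi.
Proof.
split.
- move=> x _; have [c [k ->]] := vtxP x.
  have [j [l [d]]] := others k; rewrite (cat_uniq [:: k; j; l] [:: d]) => /andP[U _].
  have [a [b F]] := flag_exists c U; apply/gaussian_circleP; exists a, b.
  by split; [exact: flag_unimod F|rewrite kphiE; case: F].
- by move=> x y _ _; exact: kphi_inj.
move=> K /gaussian_circleP[a [b [ab EK]]].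
have [c [k [j [l [m [_ F _]]]]]] := flag_construct ab.
exists (vtx c k) => //; apply: cform_inj; rewrite kphiE EK; by case: F.
Qed.

End Kingdom.

(** * Packings, palaces and Gaussian quadruples *)

Section Packings.
Context {R : realType}.
Implicit Types (c : chamber R) (i j k d : 'I_4) (A B C D K : ocircle R).

Definition circ c k := kphi (vtx c k).

Lemma cform_circ c k : cform (circ c k) = cf c k. Proof. exact: kphiE. Qed.

Lemma unimod_neq0 (a b : 'cV[R[i]]_2) : unimod a b -> (a 0 0 != 0) || (a 1 0 != 0).
Proof.
move=> [_ _ H]; rewrite -negb_and; apply/negP => /andP[/eqP a0 /eqP a1]; move: H.
by rewrite /dt a0 a1 !mul0r subrr /sqn !cE expr0n addr0 => /eqP; rewrite eq_sym oner_eq0.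
Qed.

Lemma edge_unimod c i j a : i != j -> representatives (lab c [set i; j]%SET) a ->
  exists b, unimod a b.
Proof.
move=> ij ra; have [k U] := ord4_third ij.
have [b rb] := rep_ex (lab c [set j; k]%SET).
by exists b; exact: chamber_adj U ra rb.
Qed.

Lemma circ_tangent c i j a : i != j -> representatives (lab c [set i; j]%SET) a ->
  tangent_at (circ c i) (circ c j) (ratio (a 0 0) (a 1 0)) /\
  inside (circ c i) `&` inside (circ c j) = set0.
Proof.
move=> ij ra; have [b ab] := edge_unimod ij ra.
apply: tangent_of_sum; first exact: unimod_neq0 ab.
by rewrite !cform_circ cfP // (laxformE ra).
Qed.

Definition ext_tangent A B := tangent A B /\ inside A `&` inside B = set0.

Lemma circ_ext_tangent c i j : i != j -> ext_tangent (circ c i) (circ c j).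
Proof.
move=> ij; have [a ra] := rep_ex (lab c [set i; j]%SET).
by have [t s] := circ_tangent ij ra; split=> //; exists (ratio (a 0 0) (a 1 0)).
Qed.

Lemma ext_tangent_bil A B : ext_tangent A B -> bil (cform A) (cform B) = -1.
Proof.
move=> [[P /sum_of_tangent H] /H[k k0 E]].
have : bil (fadd (cform A) (cform B)) (fadd (cform A) (cform B)) = 0.
  by rewrite E bilZl bilZr bil_nullnull !mulr0.
by rewrite bilDl !bilDr !bil_cform (bilC (cform B)); lra.
Qed.

Lemma range4 (T : Type) (F : 'I_4 -> T) i j k d : uniq [:: i; j; k; d] ->
  range F = [set F i; F j; F k; F d].
Proof.
move=> U; apply/seteqP; split=> [_ [x _ <-]|_ [[[]|]|] ->];
  try by [exists i|exists j|exists k|exists d].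
by case: (uniq4_cover x U) => ->; [left; left; left|left; left; right|left; right|right].
Qed.

Lemma descartes_set A B C D : descartes [set A; B; C; D] ->
  [/\ ext_tangent A B, ext_tangent A C, ext_tangent B C &
  [/\ ext_tangent D A, ext_tangent D B & ext_tangent D C]].
Proof.
move=> [K E T].
have inj i j : K i = K j -> i = j.
  move=> Eij; apply/eqP/negPn/negP => /T[]; rewrite Eij => /no_self_tangent //.
have ex X : [set A; B; C; D] X -> exists i, K i = X.
  by rewrite E => -[i _ <-]; exists i.
have [a Ea] : exists i, K i = A by apply: ex; left; left; left.
have [b Eb] : exists i, K i = B by apply: ex; left; left; right.
have [c Ec] : exists i, K i = C by apply: ex; left; right.
have [d Ed] : exists i, K i = D by apply: ex; right.
(* The four indices exhaust ['I_4] because [K] is injective, no circle being tangent to itself;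
   hence they are distinct. *)
have U : uniq [:: a; b; c; d].
  apply/card_uniqP; transitivity #|'I_4|; last by rewrite card_ord.
  apply: eq_card => i.
  rewrite !inE; have : range K (K i) by exists i.
  rewrite -E -Ea -Eb -Ec -Ed => -[[[]|]|] /inj ->; by rewrite eqxx ?orbT.
move: U; rewrite /= !inE !negb_or => /andP[/and3P[ab ac ad] /andP[/andP[bc bd] /andP[cd _]]].
by rewrite -Ea -Eb -Ec -Ed; split; [..|split]; apply: T; rewrite // eq_sym.
Qed.

Lemma circ_descartes c : descartes (range (circ c)).
Proof. by exists (circ c) => // i j; exact: circ_ext_tangent. Qed.

Definition packing (Q : set (ocircle R)) := \bigcup_n iter n apollonian_step Q.

Lemma iter_step_mono Q n m : (n <= m)%N ->
  iter n apollonian_step Q `<=` iter m (@apollonian_step R) Q.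
Proof.
elim: m => [|m IH]; first by rewrite leqn0 => /eqP ->.
rewrite leq_eqVlt => /orP[/eqP -> //|/IH h] K /h; by left.
Qed.

Lemma packing_step Q A B C D : packing Q A -> packing Q B -> packing Q C ->
  descartes [set A; B; C; D] -> packing Q D.
Proof.
move=> [n _ HA] [m _ HB] [l _ HC] H.
exists (maxn n (maxn m l)).+1 => //; right; exists A, B, C; split=> //.
- by apply: iter_step_mono HA; rewrite leq_maxl.
- by apply: iter_step_mono HB; rewrite leq_max leq_maxl orbT.
- by apply: iter_step_mono HC; rewrite !leq_max leqnn !orbT.
Qed.

(** A swap is a step of the packing: the three circles left in place are already present, and
    together with the new one they are the quadruple of a chamber. *)
Lemma red_packing c f o : red (cf c) f o ->
  forall j, exists2 K, packing (range (circ c)) K & cform K = f j.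
Proof.
elim=> {f o} [|f o k H IH ok] j.
  by exists (circ c j); [exists 0%N => //; exists j|rewrite cform_circ].
have [jk|jk] := eqVneq j k; last by rewrite swapf_neq.
have [c' [s [E _]]] := red_realized (redS H ok).
have mem i : s i != k -> packing (range (circ c)) (circ c' i).
  move=> sk; have [K PK EK] := IH (s i).
  suff -> : circ c' i = K by [].
  by apply: cform_inj; rewrite cform_circ E swapf_neq.
exists (circ c' (s^-1 k)%g); last by rewrite cform_circ E permKV jk.
have [x [y [z U]]] := others (s^-1 k)%g.
have : uniq [:: (s^-1 k)%g; x; y; z] by [].
rewrite /= !inE !negb_or => /andP[/and3P[kx ky kz] _].
have ne i : (s^-1 k)%g != i -> s i != k.
  by apply: contra => /eqP <-; rewrite permK.
apply: (packing_step (mem _ (ne _ kx)) (mem _ (ne _ ky)) (mem _ (ne _ kz))).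
have U' : uniq [:: x; y; z; (s^-1 k)%g] by rewrite -(rot_uniq 1) in U.
by rewrite -(range4 (circ c') U'); exact: circ_descartes.
Qed.

Lemma common_chamber c i c' i' : kconnected (vtx c i) (vtx c' i') ->
  bil (cf c i) (cf c' i') = -1 -> exists c1 j j',
    [/\ cf c1 j = cf c i, cf c1 j' = cf c' i' & forall k l, kconnected (vtx c k) (vtx c1 l)].
Proof.
move=> /kconnected_reach[f [o [s [H E]]]] b.
have b' : bil (f (s i')) (cf c i) = -1 by rewrite -E bilC.
have [f' [o' [j0 [_ [j2 [H' E0 _ E2]]]]]] := red_tangent_triple (cf_gram c) H b' b'.
have [c1 [t [E1 K1]]] := red_realized H'.
exists c1, (t^-1 j0)%g, (t^-1 j2)%g; split=> //; rewrite E1 permKV //.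
by rewrite E2 E.
Qed.

Lemma kconnected_sym (x y : kvertex R) : kconnected x y -> kconnected y x.
Proof. exact: Relation_Operators.rst_sym. Qed.

(** First [x] and [y] are put in a common chamber; with reduced words starting there, a second one
    contains all three vertices. The circle [D] then belongs to this chamber or to its neighbor
    across the wall of the three. *)
Lemma component_step (x y z : kvertex R) D : kconnected x y -> kconnected x z ->
  descartes [set kphi x; kphi y; kphi z; D] -> exists2 w, kconnected x w & kphi w = D.
Proof.
have [cx [kx ->]] := vtxP x; have [cy [ky ->]] := vtxP y; have [cz [kz ->]] := vtxP z.
move=> xy xz /descartes_set[/ext_tangent_bil AB /ext_tangent_bil AC /ext_tangent_bil BC].
move=> [/ext_tangent_bil DA /ext_tangent_bil DB /ext_tangent_bil DC].
rewrite !kphiE in AB AC BC DA DB DC.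
have [c1 [j [j' [Ej Ej' K1]]]] := common_chamber xy AB.
have [f [o [s [H E]]]] : reach c1 cz.
  by apply: (@kconnected_reach _ _ j _ kz); exact: kconnected_trans (kconnected_sym (K1 kx j)) xz.
have b0 : bil (f (s kz)) (cf c1 j) = -1 by rewrite -E bilC Ej.
have b1 : bil (f (s kz)) (cf c1 j') = -1 by rewrite -E bilC Ej'.
have [f' [o' [p0 [p1 [p2 [H' E0 E1 E2]]]]]] := red_tangent_triple (cf_gram c1) H b0 b1.
have [c2 [t [Et K2]]] := red_realized H'.
pose q0 := (t^-1 p0)%g; pose q1 := (t^-1 p1)%g; pose q2 := (t^-1 p2)%g.
have F0 : cf c2 q0 = cf cx kx by rewrite Et permKV E0.
have F1 : cf c2 q1 = cf cy ky by rewrite Et permKV E1.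
have F2 : cf c2 q2 = cf cz kz by rewrite Et permKV E2 E.
have ne k l : bil (cf c2 k) (cf c2 l) = -1 -> k != l.
  by move=> h; apply/eqP => e; move: h; rewrite e cf_norm; lra.
have U : uniq [:: q0; q1; q2] by rewrite uniq3E !ne // ?F0 ?F1 ?F2.
have [d Ud] := fourth U.
have con l : kconnected (vtx cx kx) (vtx c2 l).
  exact: kconnected_trans (K1 kx j) (K2 j l).
have := @gram_complete _ (cf c2) d (cform D) (cf_gram c2) (bil_cform D).
case=> [m md|Ed|Ed].
- by case: (uniq4_cover m Ud) md => ->; rewrite ?F0 ?F1 ?F2 ?eqxx.
- by exists (vtx c2 d) => //; apply: cform_inj; rewrite kphiE.
have [c3 [p [V S]]] := neighbor c2 d.
exists (vtx c3 (p d)); last by apply: cform_inj; rewrite kphiE S.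
have q0d : q0 != d by move: Ud; rewrite /= !inE !negb_or => /andP[/and3P[_ _ ->]].
apply: (kconnected_trans (con q0)); rewrite V //; exact: chamber_kconnected.
Qed.

Lemma component_packing c i :
  kphi @` [set y | kconnected (vtx c i) y] = packing (range (circ c)).
Proof.
apply/seteqP; split=> [_ [y /= xy <-]|K [n _]].
  have [c' [k' Ey]] := vtxP y; rewrite Ey in xy *.
  have [f [o [s [H E]]]] := kconnected_reach xy.
  have [K PK EK] := red_packing H (s k').
  suff -> : kphi (vtx c' k') = K by [].
  by apply: cform_inj; rewrite kphiE E.
elim: n K => [K [j _ <-]|n IH K [/IH //|]]; last first.
  move=> [A [B [C [/IH[x /= xx <-] /IH[y /= xy <-] /IH[z /= xz <-]]]]].
  move=> /component_step[||w xw <-].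
  - exact: kconnected_trans (kconnected_sym xx) xy.
  - exact: kconnected_trans (kconnected_sym xx) xz.
  by exists w => //=; exact: kconnected_trans xx xw.
by exists (vtx c j) => //=; exact: chamber_kconnected.
Qed.

Lemma cells_class n (e : kcell R n) (z : cell R) : cells e z -> cells e = [set y | glued z y].
Proof.
have [x _ ->] := kcellP e => /= xz; apply/seteqP; split=> y /= h.
  exact: glued_trans (glued_sym xz) h.
exact: glued_trans xz h.
Qed.

Lemma cells_vertex (x : kvertex R) c k : cells x (c, [set k]%SET) -> x = vtx c k.
Proof. by move=> h; apply: kcell_ext; rewrite (cells_class h). Qed.

Lemma component_palace (x0 : kvertex R) :
  is_palace kphi [set y | kconnected x0 y] (kphi @` [set y | kconnected x0 y]).
Proof.
split=> // x y /= x0x x0y; split.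
- split=> [[e [c [i [j [ij _ /cells_vertex -> /cells_vertex ->]]]]]|[P T]].
    by have [] := circ_ext_tangent c ij.
  have xy := kconnected_trans (kconnected_sym x0x) x0y.
  have [cx [kx Ex]] := vtxP x; have [cy [ky Ey]] := vtxP y; rewrite Ex Ey in T xy *.
  have [oK oK'] : (on_circle (kphi (vtx cx kx)) `&` on_circle (kphi (vtx cy ky))) P by rewrite T.
  (* The common point bounds [bil] from below and [red_separated] bounds it from above unless the
     circles coincide; only [-1] remains. *)
  have ge : -1 <= bil (cf cx kx) (cf cy ky).
    rewrite -!kphiE; apply: (peval_cauchy (P := P)); rewrite ?bil_cform //; exact/on_circleE.
  have [f [o [s [H E]]]] := kconnected_reach xy.
  case: (@red_separated _ (cf cx) (cf_gram cx) kx f o (s ky) H) => h.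
    exfalso; apply: (@no_self_tangent R (kphi (vtx cx kx))); exists P.
    suff Exy : kphi (vtx cx kx) = kphi (vtx cy ky) by rewrite -Exy in T.
    by apply: cform_inj; rewrite !kphiE E.
  rewrite -E bilC in h.
  have b : bil (cf cx kx) (cf cy ky) = -1 by lra.
  have [c1 [j [j' [Ej Ej' _]]]] := common_chamber xy b.
  move/vtx_eq : (Ej) => <-; move/vtx_eq : (Ej') => <-; apply: chamber_joins.
  by apply/eqP => e; move: b; rewrite -Ej -Ej' e cf_norm; lra.
- move=> e e' [c [i [j [ij he /cells_vertex Ex /cells_vertex Ey]]]].
  move=> [c' [i' [j' [ij' he' /cells_vertex Ex' /cells_vertex Ey']]]].
  have Ei : cf c i = cf c' i' by apply/vtx_eq; rewrite -Ex -Ex'.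
  have Ej : cf c j = cf c' j' by apply/vtx_eq; rewrite -Ey -Ey'.
  (* The label of an edge is recovered from the sum of the forms at its ends. *)
  have El : lab c [set i; j]%SET = lab c' [set i'; j']%SET.
    have [a ra] := rep_ex (lab c [set i; j]%SET).
    have [a' ra'] := rep_ex (lab c' [set i'; j']%SET).
    have [b ab] := edge_unimod ij ra.
    apply: (nform_inj ra ra' ab).
    by rewrite -(laxformE ra) -(laxformE ra') -!cfP // Ei Ej.
  have [_ g] := same_edge_glued ij ij' Ei El.
  apply: kcell_ext; rewrite (cells_class he) (cells_class he').
  by apply/seteqP; split=> z /= h; [exact: glued_trans (glued_sym g) h|exact: glued_trans g h].
move=> e l [c [i [j [ij he /cells_vertex -> /cells_vertex ->]]]] [z ez <-].
have [a ra] := rep_ex (lab c [set i; j]%SET).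
have [t _] := circ_tangent ij ra.
exists (ratio (a 0 0) (a 1 0)) => //; exists a => //.
move: ez; rewrite (cells_class he) /= => g.
by rewrite -(glued_lab _ g) //= cards2 ij.
Qed.

(** The integral form [n x^2 + 2 q x y + m y^2] of discriminant zero is written as
    [t (s x - r y)^2], whence the minus sign in [q]. In the generic case [s] and [- r] are the
    quotients of [n] and [q] by their gcd [g]. *)
Lemma square_product (n m q : int) : 0 <= n -> 0 <= m -> (n != 0) || (m != 0) ->
  q * q = n * m -> exists t r s : int,
  [/\ 0 < t, n = t * s * s, m = t * r * r & q = - (t * r * s)].
Proof.
move=> n0 m0 nm E; have [nz|nz] := eqVneq n 0.
  have q0 : q = 0 by apply/eqP; rewrite -sqrf_eq0 expr2 E nz mul0r.
  exists m, 1, 0; rewrite nz q0 in nm *; split; [|ring..].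
  by move: nm; rewrite eqxx /= => mz; rewrite lt_def mz.
have [u [v Euv]] := Bezoutz n q; set g := gcdz n q in Euv.
have gn : (g %| n)%Z := dvdz_gcdl n q.
have gq : (g %| q)%Z := dvdz_gcdr n q.
have [s En] : exists s, n = g * s by exists (n %/ g)%Z; rewrite mulrC divzK.
have [r Eq] : exists r, q = g * r by exists (q %/ g)%Z; rewrite mulrC divzK.
have gz : g != 0 by apply: contra_neq nz => g0; rewrite En g0 mul0r.
clearbody g.
have B : u * s + v * r = 1 by apply: (mulfI gz); rewrite mulr1 -[RHS]Euv En Eq; ring.
have sm : s * m = g * r * r by apply: (mulfI gz); rewrite mulrA -En -E Eq; ring.
(* This is [g / s] in integral terms: expand [g = g (u s + v r)^2] and replace [g r^2] by [s m]. *)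
pose t := g * (u * u * s + 2 * u * v * r) + v * v * m.
have Eg : g = t * s.
  transitivity (g * ((u * s + v * r) * (u * s + v * r))); first by rewrite B !mulr1.
  transitivity (s * (g * (u * u * s + 2 * u * v * r)) + v * v * (g * r * r)); first by ring.
  by rewrite -sm /t; ring.
have sz : s != 0 by apply: contra_neq nz => s0; rewrite En s0 mulr0.
exists t, (- r), s; split.
- have h : 0 < t * (s * s) by rewrite mulrA -Eg -En lt_def nz.
  by rewrite pmulr_lgt0 // in h; rewrite -expr2 lt_def sqrf_eq0 sz sqr_ge0.
- by rewrite En Eg.
- by apply: (mulfI sz); rewrite sm Eg; ring.
- by rewrite Eq Eg; ring.
Qed.

Lemma feval_comb (h : hform R) (a b : 'cV[R[i]]_2) (x y : R[i]) :
  let ev (z : 'cV[R[i]]_2) := feval h (z 0 0) (z 1 0) in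
  ev (x *: a + y *: b) = sqn x * ev a + sqn y * ev b
    + Re (x * conjc y) * (ev (a + b) - ev a - ev b)
    - Im (x * conjc y) * (ev (a + 'i%C *: b) - ev a - ev b).
Proof.
rewrite /feval !mxE /sqn !cE; ring.
Qed.

Lemma form_basis_ext (h g : hform R) (a b : 'cV[R[i]]_2) : sqn (dt a b) = 1 ->
  let ev (f : hform R) (z : 'cV[R[i]]_2) := feval f (z 0 0) (z 1 0) in
  ev h a = ev g a -> ev h b = ev g b -> ev h (a + b) = ev g (a + b) ->
  ev h (a + 'i%C *: b) = ev g (a + 'i%C *: b) -> h = g.
Proof.
move=> D ev E1 E2 E3 E4; apply: feval_ext => p q.
pose z : 'cV[R[i]]_2 := \col_k (if k == 0 then p else q).
suff : ev h z = ev g z by rewrite /ev !mxE.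
rewrite (dt_decomp z D) /ev !feval_comb -!/(ev _ _); by rewrite E1 E2 E3 E4.
Qed.

Lemma feval_gauss (a b z : 'cV[R[i]]_2) : gvec a -> gvec b -> gvec z ->
  exists n : int, feval (basisform a b) (z 0 0) (z 1 0) = n%:~R.
Proof.
move=> ga gb gz; rewrite feval_basis2 -!/(dt _ _).
have := gaussM (gauss_dt gz gb) (gauss_conj (gauss_dt ga gz)).
by rewrite gaussIntE => /andP[_ /intrP[n En]]; exists n.
Qed.

(* The tangency point of two externally tangent Gaussian circles is rational:
   on the lattice of the first one, the null form [h + h'] takes integer values,
   and a degenerate integral binary quadratic form is a multiple of a square. *)
Lemma lattice_tangent (a b a' b' : 'cV[R[i]]_2) (k : R) (P Q : R[i]) :
  unimod a b -> unimod a' b' -> 0 < k -> (P != 0) || (Q != 0) ->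
  fadd (basisform a b) (basisform a' b') = fscale k (nullform P Q) ->
  exists t r s : int, 0 < t /\ fadd (basisform a b) (basisform a' b') =
    fscale t%:~R (nform (r%:~R *: a + s%:~R *: b)).
Proof.
move=> ab ab' k0 PQ E; have [ga gb D] := ab; have [ga' gb' D'] := ab'.
set X := P * a 1 0 - Q * a 0 0; set Y := P * b 1 0 - Q * b 0 0.
have dd : dt a b * conjc (dt a b) = 1 by exact: sqn1_conj.
have A0 (x y : R) : feval (basisform a b) ((x%:C%C *: a + y%:C%C *: b) 0 0)
    ((x%:C%C *: a + y%:C%C *: b) 1 0) = 0.
  rewrite feval_basis2 -!/(dt _ _).
  have -> : dt (x%:C%C *: a + y%:C%C *: b) b = x%:C%C * dt a b by rewrite /dt !mxE; ring.
  have -> : dt a (x%:C%C *: a + y%:C%C *: b) = y%:C%C * dt a b by rewrite /dt !mxE; ring.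
  by rewrite conjcM mulrACA dd mulr1 !cE; ring.
have sumE (z : 'cV[R[i]]_2) : feval (fadd (basisform a b) (basisform a' b')) (z 0 0) (z 1 0)
    = k * sqn (P * z 1 0 - Q * z 0 0).
  rewrite E -feval_null; rewrite /feval; fsimp; ring.
(* Up to the determinant, [(Y, - X)] are the coordinates of [(P, Q)] in the basis [a], [b]. Their
   ratio is real because the tangency point lies on the first circle. *)
have APQ : Im (X * conjc Y) = 0.
  have bAB : bil (basisform a b) (basisform a' b') = -1.
    have : bil (fscale k (nullform P Q)) (fscale k (nullform P Q)) = 0.
      by rewrite bilZl bilZr bil_nullnull !mulr0.
    rewrite -E bilDl !bilDr !bil_basisform D D' (bilC (basisform a' b')); lra.
  have : bil (basisform a b) (fscale k (nullform P Q)) = 0.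
    by rewrite -E bilDr bil_basisform D bAB; lra.
  rewrite bilZr bil_null feval_basis2 => /eqP; rewrite !mulf_eq0 (gt_eqF k0) oppr_eq0 pnatr_eq0 /=.
  have -> : (P * b 1 0 - Q * b 0 0) * conjc (a 0 0 * Q - a 1 0 * P) = - conjc (X * conjc Y).
    have -> : a 0 0 * Q - a 1 0 * P = - X by rewrite /X; ring.
    rewrite -/Y; clearbody X Y; apply: cext; rewrite !cE; ring.
  by rewrite Im_opp Im_conj opprK => /eqP.
have fa' : feval (basisform a' b') (a 0 0) (a 1 0) = k * sqn X.
  have := sumE a; rewrite fevalD; have := A0 1 0.
  rewrite !mxE -[1%:C%C]/(1 : R[i]) -[0%:C%C]/(0 : R[i]) !mul1r !mul0r !addr0 => ->.
  by rewrite add0r.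
have fb' : feval (basisform a' b') (b 0 0) (b 1 0) = k * sqn Y.
  have := sumE b; rewrite fevalD; have := A0 0 1.
  rewrite !mxE -[1%:C%C]/(1 : R[i]) -[0%:C%C]/(0 : R[i]) !mul1r !mul0r !add0r => ->.
  by rewrite add0r.
have fab' : feval (basisform a' b') ((a + b) 0 0) ((a + b) 1 0) = k * sqn (X + Y).
  have := sumE (a + b); rewrite fevalD; have := A0 1 1.
  rewrite -[1%:C%C]/(1 : R[i]) !scale1r => ->; rewrite add0r => ->.
  by congr (_ * sqn _); rewrite /X /Y !mxE; ring.
have [n En] := feval_gauss ga' gb' ga; have [m Em] := feval_gauss ga' gb' gb.
have [l El] := feval_gauss ga' gb' (gvecD ga gb).
rewrite fa' in En; rewrite fb' in Em; rewrite fab' in El.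
have cross : 2 * (k * Re (X * conjc Y)) = (l - n - m)%:~R.
  by rewrite !intrB -El -En -Em /sqn !cE; ring.
(* By [APQ] the product [X * conjc Y] is real, so its square is [|X|^2 |Y|^2]: the integral form on
   the lattice is degenerate. *)
have disc : (l - n - m) * (l - n - m) = 4 * (n * m).
  apply/eqP; rewrite -(eqr_int R) !intrM -cross -En -Em; apply/eqP.
  have -> : 4%:~R = 4 :> R by [].
  have := APQ; rewrite /sqn !cE => h.
  have := congr1 (fun z => z * z * (4 * k * k)) h; lra.
have [q Eq] : exists q, l - n - m = 2 * q.
  exists ((l - n - m) %/ 2)%Z; nia.
have qq : q * q = n * m by move: disc; rewrite Eq; lia.
have n0 : 0 <= n by rewrite -(ler_int R) -En mulr_ge0 ?sqn_ge0 // ltW.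
have m0 : 0 <= m by rewrite -(ler_int R) -Em mulr_ge0 ?sqn_ge0 // ltW.
have nm : (n != 0) || (m != 0).
  rewrite -negb_and; apply/negP => /andP[/eqP nz /eqP mz].
  have X0 : X = 0.
    by apply: sqn_eq0; move/eqP: En; rewrite nz mulf_eq0 (gt_eqF k0) /= => /eqP.
  have Y0 : Y = 0.
    by apply: sqn_eq0; move/eqP: Em; rewrite mz mulf_eq0 (gt_eqF k0) /= => /eqP.
  have d0 : dt a b != 0.
    by apply/eqP => d0; move: D; rewrite d0 /sqn !cE expr0n addr0 => /eqP; rewrite eq_sym oner_eq0.
  have Pz : P * dt a b = 0.
    have -> : P * dt a b = a 0 0 * Y - b 0 0 * X by rewrite /X /Y /dt; ring.
    by rewrite X0 Y0 !mulr0 subrr.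
  have Qz : Q * dt a b = 0.
    have -> : Q * dt a b = a 1 0 * Y - b 1 0 * X by rewrite /X /Y /dt; ring.
    by rewrite X0 Y0 !mulr0 subrr.
  move/eqP: Pz; move/eqP: Qz; rewrite !mulf_eq0 (negbTE d0) !orbF => /eqP Q0 /eqP P0.
  by move: PQ; rewrite P0 Q0 eqxx.
have [t [r [s [t0 Et1 Et2 Et3]]]] := square_product n0 m0 nm qq.
exists t, r, s; split=> //.
have nv (z : 'cV[R[i]]_2) : feval (fscale t%:~R (nform (r%:~R *: a + s%:~R *: b))) (z 0 0) (z 1 0)
   = t%:~R * sqn (dt (r%:~R *: a + s%:~R *: b) z).
  by rewrite /dt -feval_null /nform /feval; fsimp; ring.
have dtv (x y : R[i]) : sqn (dt (r%:~R *: a + s%:~R *: b) (x *: a + y *: b)) =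
    sqn (r%:~R * y - s%:~R * x).
  by rewrite dt_comb sqnM D mulr1.
have v1 (x y : R[i]) : let z := x *: a + y *: b in
    sqn (P * z 1 0 - Q * z 0 0) = sqn (x * X + y * Y).
  by rewrite /= /X /Y !mxE; congr sqn; ring.
have ea : a = 1 *: a + 0 *: b by rewrite scale1r scale0r addr0.
have eb : b = 0 *: a + 1 *: b by rewrite scale1r scale0r add0r.
have eab : a + b = 1 *: a + 1 *: b by rewrite !scale1r.
have eai : a + 'i%C *: b = 1 *: a + 'i%C *: b by rewrite scale1r.
have kq : 2 * (k * Re (X * conjc Y)) = - 2 * (t%:~R * r%:~R * s%:~R).
  by rewrite cross Eq Et3 !(intrM, mulrNz); have -> : 2%:~R = 2 :> R by []; ring.
have kn : k * sqn X = t%:~R * s%:~R * s%:~R by rewrite En Et1 !intrM.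
have km : k * sqn Y = t%:~R * r%:~R * r%:~R by rewrite Em Et2 !intrM.
clearbody X Y; rewrite /sqn !cE in kn km kq APQ.
have V (z : 'cV[R[i]]_2) (x y : R[i]) : z = x *: a + y *: b ->
    k * sqn (x * X + y * Y) = t%:~R * sqn (r%:~R * y - s%:~R * x) ->
    k * sqn (P * z 1 0 - Q * z 0 0) = t%:~R * sqn (dt (r%:~R *: a + s%:~R *: b) z).
  by move=> ->; rewrite v1 dtv.
apply: (form_basis_ext D); rewrite sumE nv.
- by apply: (V _ _ _ ea); rewrite /sqn !cE; lra.
- by apply: (V _ _ _ eb); rewrite /sqn !cE; lra.
- by apply: (V _ _ _ eab); rewrite /sqn !cE; lra.
- by apply: (V _ _ _ eai); rewrite /sqn !cE; have := congr1 ( *%R k) APQ; lra.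
Qed.

Lemma int_unit_product (n m q : int) : 0 < n -> 0 < m -> n * m * (q * q) = 1 ->
  [/\ n = 1, m = 1 & q * q = 1].
Proof.
move=> n0 m0 H.
have : (`|n| * (`|m| * (`|q| * `|q|)))%N = 1%N by rewrite -!abszM mulrA H.
move=> /eqP; rewrite !muln_eq1 => /and3P[/eqP n1 /eqP m1 /andP[/eqP q1 _]].
have : q = 1 \/ q = -1 by lia.
by case=> ->; split; lia.
Qed.

(** Three of the circles determine a wall with a chamber on it; the fourth circle belongs to this
    chamber or to the one across the wall. *)
Lemma gaussian_quadruple (K : 'I_4 -> ocircle R) :
  (forall i, gaussian_circle (K i)) -> (forall i j, i != j -> ext_tangent (K i) (K j)) ->
  exists c, range K = range (circ c).
Proof.
move=> GK T.
have G : gram (fun i => cform (K i)).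
  move=> i j; have [->|ij] := eqVneq i j; first exact: bil_cform.
  by apply/ext_tangent_bil/T.
have [a [b [ab EA]]] := (gaussian_circleP _).1 (GK o0).
have lat i : i != o0 -> exists t r s : int, 0 < t /\
    fadd (cform (K o0)) (cform (K i)) = fscale t%:~R (nform (r%:~R *: a + s%:~R *: b)).
  move=> i0; have [a' [b' [ab' EB]]] := (gaussian_circleP _).1 (GK i).
  have [|[P /sum_of_tangent H] /H[k k0 E]] := T o0 i; first by rewrite eq_sym.
  by rewrite EA EB in E *; exact: lattice_tangent (hom_neq0 P) E.
have [t1 [r1 [s1 [t10 E1]]]] := lat o1 isT.
have [t2 [r2 [s2 [t20 E2]]]] := lat o2 isT.
set v1 := r1%:~R *: a + s1%:~R *: b in E1; set v2 := r2%:~R *: a + s2%:~R *: b in E2.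
pose D := r1 * s2 - s1 * r2.
have [ga gb Dab] := ab.
have D12 : dt v1 v2 = D%:~R * dt a b by rewrite dt_comb /D intrB !intrM.
have sqnD (n : int) : sqn (n%:~R : R[i]) = n%:~R * n%:~R by rewrite /sqn !cE; ring.
(* The Gram matrix gives [bil (h0 + h1) (h0 + h2) = 1 - 1 - 1 - 1 = -2], the null forms give
   [-2 t1 t2 D^2]. *)
have [t11 t21 DD] : [/\ t1 = 1, t2 = 1 & D * D = 1].
  apply: int_unit_product => //; apply/eqP; rewrite -(eqr_int R) !intrM; apply/eqP.
  have : bil (fadd (cform (K o0)) (cform (K o1))) (fadd (cform (K o0)) (cform (K o2))) = -2.
    by rewrite bilDl !bilDr !G /=; ring.
  by rewrite E1 E2 bilZl bilZr bil_nform D12 sqnM Dab sqnD mulr1; lra.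
have one (h : hform R) : fscale 1%:~R h = h.
  by apply: form_ext; rewrite /fscale; cbn [fa fd fx fy]; rewrite mul1r.
rewrite t11 one in E1; rewrite t21 one in E2.
have gv1 : gvec v1 by apply: gvecD; apply: gvecZ => //; exact: gauss_int.
have gv2 : gvec v2 by apply: gvecD; apply: gvecZ => //; exact: gauss_int.
have D1 : sqn (D%:~R : R[i]) = 1 by rewrite sqnD -intrM DD.
have uv : unimod v1 (D%:~R *: v2).
  split=> //; first by apply: gvecZ => //; exact: gauss_int.
  by rewrite dtZr D12 !sqnM D1 Dab !mul1r.
(* Multiplying [v2] by [D] turns the determinant of the base change into [D^2 = 1], so the
   orientation is kept. *)
have Ev : basisform v1 (D%:~R *: v2) = cform (K o0).
  rewrite EA /v1 /v2 scalerDr !scalerA -!intrM; apply: basisform_SL.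
  by rewrite -DD /D; ring.
have [c [k [j [l [m [U F _]]]]]] := flag_construct uv.
have [U3 ra rb Ek] := F; rewrite Ev in Ek.
have : uniq [:: k; j; l; m] by [].
rewrite /= !inE !negb_or => /andP[/and3P[kj kl km] /andP[/andP[jl jm] /andP[lm _]]].
have Ej : cf c j = cform (K o1).
  by apply: (@fadd_inj _ (cf c k)); rewrite cfP // (laxformE ra) Ek E1.
have El : cf c l = cform (K o2).
  by apply: (@fadd_inj _ (cf c k)); rewrite cfP // (laxformE rb) Ek E2 nformZ.
have finish c' (k' j' l' m' : 'I_4) : uniq [:: k'; j'; l'; m'] -> cf c' k' = cform (K o0) ->
    cf c' j' = cform (K o1) -> cf c' l' = cform (K o2) -> cf c' m' = cform (K o3) ->
    exists c, range K = range (circ c).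
  move=> U' e0 e1 e2 e3; exists c'; rewrite (range4 (circ c') U').
  rewrite (@range4 _ K o0 o1 o2 o3 isT).
  have E i x : cf c' i = cform (K x) -> circ c' i = K x.
    by move=> e; apply: cform_inj; rewrite cform_circ.
  by rewrite (E _ _ e0) (E _ _ e1) (E _ _ e2) (E _ _ e3).
have := @gram_complete _ (cf c) m (cform (K o3)) (cf_gram c) (bil_cform _).
case=> [i im|Em|Em].
- case: (uniq4_cover i U) im => -> im; rewrite ?Ek ?Ej ?El ?G //.
  by rewrite eqxx in im.
- exact: (finish c k j l m).
have [c' [p [V S]]] := neighbor c m.
apply: (finish c' (p k) (p j) (p l) (p m)).
- by rewrite -(map_inj_uniq (@perm_inj _ p)) in U.
- by rewrite S swapf_neq.
- by rewrite S swapf_neq.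
- by rewrite S swapf_neq.
- by rewrite S Em.
Qed.

End Packings.

Theorem theorem2p7 (R : realType) :
  exists Phi : kvertex R -> ocircle R,
    [/\ is_Phi Phi,
        set_bij [set: kvertex R] gaussian_circle Phi,
        (forall K : set (kvertex R), kcomponent K ->
           exists P : set (ocircle R),
             [/\ apollonian_packing P, P `<=` gaussian_circle &
                 is_palace Phi K P]) &
        (forall P : set (ocircle R),
           apollonian_packing P -> P `<=` gaussian_circle ->
           exists! K : set (kvertex R), kcomponent K /\ is_palace Phi K P)].
Proof.
exists kphi; have [Gphi _ _] := @kphi_bij R.
split; [exact: kphi_is_Phi|exact: kphi_bij| |].
  move=> K [x ->]; have [c [k Ex]] := vtxP x.
  exists (kphi @` [set y | kconnected x y]); split; last exact: component_palace.
    rewrite Ex component_packing; exists (range (circ c)) => //; exact: circ_descartes.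
  by move=> _ [y _ <-]; exact: Gphi.
move=> P [Q [F EQ T] EP] GP.
have GF i : gaussian_circle (F i).
  by apply: GP; rewrite EP; exists 0%N => //=; rewrite EQ; exists i.
(* Realizing the initial quadruple by a chamber is enough, as the component of a chamber and the
   packing generated by its quadruple have the same circles. *)
have [c Ec] := gaussian_quadruple GF T.
have PE : P = kphi @` [set y | kconnected (vtx c o0) y].
  by rewrite component_packing EP EQ Ec.
exists [set y | kconnected (vtx c o0) y]; split.
  by split; [exists (vtx c o0)|rewrite PE; exact: component_palace].
move=> K [_ [EK _]].
have inj (A B : set (kvertex R)) : kphi @` A = kphi @` B -> A `<=` B.
  move=> E y Ay; have : (kphi @` B) (kphi y) by rewrite -E; exists y.
  by move=> [z Bz /kphi_inj <-].
by apply/seteqP; split; apply: inj; rewrite EK PE.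
Qed.
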